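(* Let $p\in(1,\infty)$, $K\in\mathbb R$, $N\in(-\infty,0]\cup(1,\infty]$, $D\in(0,\infty]$, and assume that the technical assumption (TA), stated in the context, holds. Let $$\mathcal D^{reg}_{(K,N,D)}=\{(\mathfrak h,d)\in\mathbb R\times(0,D_\delta):\ [-\tfrac d2,\tfrac d2]\subset U_{\mathfrak h}\},$$ and for $(\mathfrak h,d)\in\mathcal D^{reg}_{(K,N,D)}$ let $\lambda^{(1,p)}(\mathfrak h,d)=\Lambda^{(p)}_{Poi}\big(J_{K,N,\mathfrak h}(x)1_{[-d/2,d/2]}(x)\,dx\big)$. 1. For any fixed $\mathfrak h_0$ occurring as a first coordinate of a point of $\mathcal D^{reg}_{(K,N,D)}$, the function $d\mapsto\lambda^{(1,p)}(\mathfrak h_0,d)$ on $\{d:(\mathfrak h_0,d)\in\mathcal D^{reg}_{(K,N,D)}\}$ decreases as $d$ increases. 2. If $N\in(1,\infty]$, then for any fixed $d_0$ occurring as a second coordinate of a point of $\mathcal D^{reg}_{(K,N,D)}$, the function $\mathfrak h\mapsto\lambda^{(1,p)}(\mathfrak h,d_0)$ on $\{\mathfrak h:(\mathfrak h,d_0)\in\mathcal D^{reg}_{(K,N,D)}\}$ monotonically increases as $|\mathfrak h|$ increases.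
   Context: $\delta=\frac K{N-1}$ ($0$ if $N=\infty$); $D_\delta=\min\{D,\pi/\sqrt\delta\}$ if $\delta>0$ and $D_\delta=D$ otherwise. $\mathfrak s_\delta(x)=\sin(\sqrt\delta x)/\sqrt\delta$, $x$, $\sinh(\sqrt{-\delta}x)/\sqrt{-\delta}$ and $\mathfrak c_\delta(x)=\cos(\sqrt\delta x)$, $1$, $\cosh(\sqrt{-\delta}x)$ for $\delta>0,=0,<0$. For $\mathfrak h\in\mathbb R$, $U_{\mathfrak h}$ is the maximal open interval containing $0$ on which $\mathfrak c_\delta+\frac{\mathfrak h}{N-1}\mathfrak s_\delta>0$ ($\mathbb R$ if $N=\infty$); on $U_{\mathfrak h}$, $J_{K,N,\mathfrak h}=(\mathfrak c_\delta+\frac{\mathfrak h}{N-1}\mathfrak s_\delta)^{N-1}$ if $N<\infty$ and $J_{K,\infty,\mathfrak h}(x)=e^{\mathfrak hx-Kx^2/2}$. $\Lambda^{(p)}_{Poi}(\xi)=\inf\Big\{\frac{\int|f'|^pd\xi}{\int|f|^pd\xi}:0\not\equiv f\in C_c^\infty(\mathbb R),\ \int|f|^{p-2}f\,d\xi=0\Big\}$, a quotient with denominator $0$ being $+\infty$. Monotonicity is in the weak (non-strict) sense; ''increases as $|\mathfrak h|$ increases'' means $|\mathfrak h_1|\le|\mathfrak h_2|$ implies $\lambda^{(1,p)}(\mathfrak h_1,d_0)\le\lambda^{(1,p)}(\mathfrak h_2,d_0)$. Technical assumption (TA). Consider the Neumann problem $\frac{d}{dx}\big(J|f'|^{p-2}f'\big)+\lambda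 J|f|^{p-2}f=0$ on $(a,b)$, $f'(a)=f'(b)=0$, with $J$ smooth and strictly positive on $[a,b]$. Its eigenvalues depend continuously differentiably on the weight (in the Fréchet sense) and its eigenfunctions depend continuously on the weight. This is the analogue of the following fact for $p=2$. Let $E=(a',b')$ and let $\Omega_E$ be the set of triples $(a,b,J)$ with $a'<a<b<b'$ and $J\in C^1(E;(0,\infty))$, $J,1/J\in L^1_{loc}(E)$, with metric $d((a_1,b_1,J_1),(a_2,b_2,J_2))=|a_2-a_1|+|b_2-b_1|+\int_E|J_2^{-1}1_{[a_2,b_2]}-J_1^{-1}1_{[a_1,b_1]}|dx+\int_E|J_21_{[a_2,b_2]}-J_11_{[a_1,b_1]}|dx$. If $\lambda(\omega_0)$ is an eigenvalue for $\omega_0$, then on a neighbourhood $W$ of $\omega_0$ there are simple eigenvalues $\lambda(\omega)$ with normalized eigenfunctions $u(\cdot,\omega)$ such that, as $\omega\to\omega_0$, $u(\cdot,\omega)\to u(\cdot,\omega_0)$ and $Ju'(\cdot,\omega)\to Ju'(\cdot,\omega_0)$ (for general $p$: $J|u'|^{p-2}u'$) uniformly on compact subintervals of $E$; moreover $\lambda$ is continuously differentiable in $a,b$ and Fréchet differentiable in $J$. *)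

(* Defs.v *)
From HB Require Import structures.
From mathcomp Require Import all_boot all_order all_algebra.
From mathcomp Require Import all_classical all_reals all_analysis.
From mathcomp Require Import measurable_realfun.

Set Implicit Arguments.
Unset Strict Implicit.
Unset Printing Implicit Defensive.

Import Order.TTheory GRing.Theory Num.Theory.
Import numFieldNormedType.Exports.

Local Open Scope ring_scope.
Local Open Scope classical_set_scope.

Section model_weights.
Context {R : realType}.
Implicit Types (K h d x : R) (N D : \bar R).

(* Finite N is real; the remaining branch is N = +oo (-oo is excluded). *)
Definition delta K N : R :=
  match N with r%:E => K / (r - 1) | _ => 0 end.

Definition diam_bound K N D : \bar R :=
  if 0 < delta K N then Order.min D (pi / Num.sqrt (delta K N))%:E else D.

Definition s_ (dl x : R) : R :=
  if 0 < dl then sin (Num.sqrt dl * x) / Num.sqrt dl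
  else if dl == 0 then x
  else let t := Num.sqrt (- dl) in (expR (t * x) - expR (- (t * x))) / 2 / t.

Definition c_ (dl x : R) : R :=
  if 0 < dl then cos (Num.sqrt dl * x)
  else if dl == 0 then 1
  else let t := Num.sqrt (- dl) in (expR (t * x) + expR (- (t * x))) / 2.

Definition model_base K (r : R) h x : R :=
  c_ (K / (r - 1)) x + h / (r - 1) * s_ (K / (r - 1)) x.

(* The union of all open intervals containing 0 on which the base is positive
   is itself such an interval, hence the maximal one. *)
Definition U_ K N h : set R :=
  match N with
  | r%:E => [set x | exists I : set R,
      [/\ open I, is_interval I, I 0,
          forall y, I y -> 0 < model_base K r h y & I x]]
  | _ => setT
  end.

(* Only the values on U_ K N h matter; elsewhere powR gives junk values. *)
Definition J_ K N h x : R :=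
  match N with
  | r%:E => model_base K r h x `^ (r - 1)
  | _ => expR (h * x - K * x ^+ 2 / 2)
  end.

Definition Dreg K N D h d : Prop :=
  [/\ 0 < d, (d%:E < diam_bound K N D)%E
    & `[- (d / 2), d / 2]%classic `<=` U_ K N h].

End model_weights.

Section density_measure.
Context {R : realType}.
Variables (w : R -> R) (w_ge0 : forall x, 0 <= w x)
  (w_meas : measurable_fun setT w).

(* The two proofs are phantom arguments: they let the measure instance be
   inferred. *)
Definition density (_ : forall x, 0 <= w x) (_ : measurable_fun setT w)
    (A : set (measurableTypeR R)) : \bar R :=
  (\int[lebesgue_measure]_(x in A) (w x)%:E)%E.

Local Notation xi := (density w_ge0 w_meas).

Let xi0 : xi set0 = 0%E.
Proof. by rewrite /density integral_set0. Qed.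

Let xi_ge0 A : (0 <= xi A)%E.
Proof. by apply: integral_ge0 => x _; rewrite lee_fin. Qed.

Let xi_sigma_additive : semi_sigma_additive xi.
Proof.
move=> F mF tF mUF; rewrite /density; apply: cvg_toP.
  apply: ereal_nondecreasing_is_cvgn => m n mn.
  by apply: lee_sum_nneg_natr => // k _ _; exact: xi_ge0.
rewrite ge0_integral_bigcup//=.
- by apply: measurable_funTS; exact: measurableT_comp.
- by move=> x _; rewrite lee_fin.
Qed.

HB.instance Definition _ := isMeasure.Build _ _ _ xi
  xi0 xi_ge0 xi_sigma_additive.

End density_measure.

Section model_measure.
Context {R : realType}.
Implicit Types (K h d x : R) (N : \bar R).

Definition model_density K N h d x : R :=
  J_ K N h x * \1_(`[- (d / 2), d / 2]%classic : set R) x.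

Lemma model_density_ge0 K N h d x : 0 <= model_density K N h d x.
Proof.
rewrite /model_density mulr_ge0// /J_.
by case: N => [r||]; rewrite ?powR_ge0 ?expR_ge0.
Qed.

Lemma measurable_model_density K N h d :
  measurable_fun setT (model_density K N h d).
Proof.
apply: measurable_funM; last exact: measurable_indic.
have mX : measurable_fun setT (fun x : R => expR (h * x - K * x ^+ 2 / 2)).
  apply: measurableT_comp => //; apply: measurable_funB.
    exact: measurable_funM.
  by apply: measurable_funM => //; apply: measurable_funM => //;
     exact: measurable_funX.
case: N => [r||]; [|exact: mX|exact: mX].
have mE t : measurable_fun setT (fun x : R => expR (t * x)).
  by apply: measurableT_comp => //; exact: measurable_funM.
have mE' t : measurable_fun setT (fun x : R => expR (- (t * x))).
  rewrite (_ : (fun x => _) = (fun x => expR (- t * x))); first exact: mE.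
  by apply/funext => x; rewrite mulNr.
have mS t : measurable_fun setT (fun x : R => sin (t * x)).
  apply: measurableT_comp; last exact: measurable_funM.
  by apply: continuous_measurable_fun; exact: continuous_sin.
have mC t : measurable_fun setT (fun x : R => cos (t * x)).
  apply: measurableT_comp; last exact: measurable_funM.
  by apply: continuous_measurable_fun; exact: continuous_cos.
apply: (measurableT_comp (measurable_powR _)).
apply: measurable_funD; last apply: measurable_funM => //.
- rewrite /c_; case: (0 < _); first exact: mC.
  case: (_ == 0); first exact: measurable_cst.
  by apply: measurable_funM => //; exact: measurable_funD.
- rewrite /s_; case: (0 < _); first exact: measurable_funM.
  case: (_ == 0); first exact: measurable_id.
  do 2! (apply: measurable_funM => //).
  exact: measurable_funB.
Qed.

Definition model_measure K N h d :=
  density (model_density_ge0 K N h d) (measurable_model_density K N h d).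

HB.instance Definition _ K N h d := Measure.on (model_measure K N h d).

End model_measure.

Section poincare.
Context {R : realType}.

Definition Cc_infty (f : R -> R) : Prop :=
  (forall n x, derivable (derive1n n f) x 1) /\
  compact (closure [set x | f x != 0]).

Definition signed_pow (e y : R) : R := `|y| `^ (e - 2) * y.

Definition poincare_quotient (p : R)
    (xi : {measure set (measurableTypeR R) -> \bar R}) (f : R -> R) : \bar R :=
  let num := (\int[xi]_x (`|derive1 f x| `^ p)%:E)%E in
  let den := (\int[xi]_x (`|f x| `^ p)%:E)%E in
  (* in the library, 0 * 0^-1 is 0 in \bar R, whence the explicit case *)
  if den == 0%E then +oo%E else (num / den)%E.

Definition Lambda_Poi (p : R)
    (xi : {measure set (measurableTypeR R) -> \bar R}) : \bar R :=
  ereal_inf [set poincare_quotient p xi f | f in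
    [set f : R -> R | [/\ Cc_infty f, exists x, f x != 0
      & (\int[xi]_x (signed_pow p (f x))%:E)%E = 0%E]]].

Definition lambda1 (p K : R) (N : \bar R) (h d : R) : \bar R :=
  Lambda_Poi p (model_measure K N h d).

End poincare.

(* The (TA) assumption: C^1 dependence of the Neumann spectrum of the
   one-dimensional weighted p-Laplacian on the interval and on the weight.  An
   element (a, b, J) of Omega_E is given by three separate arguments; E is the
   open interval ]lo, hi[ with extended-real endpoints. *)
Section neumann.
Context {R : realType}.
Variables (p : R) (lo hi : \bar R).
Implicit Types (a b lam : R) (J h u : R -> R).
Local Notation mu := (@lebesgue_measure R).

Definition E_ : set R := [set x | (lo < x%:E)%E /\ (x%:E < hi)%E].

Definition C1_on_E h : Prop :=
  forall x, E_ x -> derivable h x 1 /\ {for x, continuous (derive1 h)}.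

(* With v = J |u'|^(p-2) u' the equation reads
     u' = J^(-1/(p-1)) |v|^(1/(p-1)-1) v,   v' = - lam J |u|^(p-2) u,
   so J^(-1/(p-1)) plays for general p the role of 1/J for p = 2. *)
Definition dual_weight J : R -> R := fun x => J x `^ (- (p - 1)^-1).

Definition Omega a b J : Prop :=
  [/\ [/\ (lo < a%:E)%E, a < b & (b%:E < hi)%E],
      forall x, E_ x -> 0 < J x,
      C1_on_E J,
      locally_integrable E_ J
    & locally_integrable E_ (dual_weight J)].

Definition Omega_dist (a1 b1 : R) (J1 : R -> R) (a2 b2 : R) (J2 : R -> R)
    : \bar R :=
  let chi1 : R -> R := \1_(`[a1, b1]%classic : set R) in
  let chi2 : R -> R := \1_(`[a2, b2]%classic : set R) in
  (`|a2 - a1|%:E + `|b2 - b1|%:E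
   + \int[mu]_(x in E_)
       `|dual_weight J2 x * chi2 x - dual_weight J1 x * chi1 x|%:E
   + \int[mu]_(x in E_) `|J2 x * chi2 x - J1 x * chi1 x|%:E)%E.

Definition flux J u : R -> R := fun x => J x * signed_pow p (derive1 u x).

(* Only the restriction of u to [a, b] matters: u is C^1 on [a, b], its
   derivative vanishes at the endpoints, u is not 0, and the equation holds on
   ]a, b[ (continuity of u' in ]a, b[ follows from that of the flux). *)
Definition neumann_eigenfunction a b J lam u : Prop :=
  [/\ {within `[a, b], continuous u} /\
        (forall x, a < x < b -> derivable u x 1),
      derive1 u x @[x --> a^'+] --> 0 /\ derive1 u x @[x --> b^'-] --> 0,
      forall x, a < x < b -> derivable (flux J u) x 1 /\
        derive1 (flux J u) x + lam * J x * signed_pow p (u x) = 0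
    & exists2 x, a <= x <= b & u x != 0].

Definition neumann_eigenvalue a b J lam : Prop :=
  exists u, neumann_eigenfunction a b J lam u.

Definition simple_neumann_eigenvalue a b J lam : Prop :=
  neumann_eigenvalue a b J lam /\
  forall u1 u2, neumann_eigenfunction a b J lam u1 ->
    neumann_eigenfunction a b J lam u2 ->
    exists c, forall x, a <= x <= b -> u2 x = c * u1 x.

Definition normalized a b J u : Prop :=
  (\int[mu]_(x in `[a, b]) (`|u x| `^ p * J x)%:E)%E = 1%E.

(* The metric only sees J times the indicator of [a, b]; accordingly u is
   continued to E with zero flux outside [a, b], that is by constants. *)
Definition extend a b u : R -> R := fun x => u (Num.max a (Num.min b x)).

Definition extend_flux a b J u : R -> R :=
  fun x => if a < x < b then flux J u x else 0.

(* Norm of the Banach space C^1([a, b]). *)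
Definition C1_norm a b h : R :=
  sup [set `|h x| | x in `[a, b]%classic] +
  sup [set `|derive1 h x| | x in `[a, b]%classic].

Definition C1_bounded_linear a b (L : (R -> R) -> R) : Prop :=
  (forall (k : R) h1 h2, C1_on_E h1 -> C1_on_E h2 ->
     L (fun x => k * h1 x + h2 x) = k * L h1 + L h2) /\
  (exists M : R, forall h, C1_on_E h -> `|L h| <= M * C1_norm a b h).

(* lam is, on W, of class C^1 in the weight in the Frechet sense: a and b being
   fixed, dlam is its Frechet derivative and is continuous in operator norm. *)
Definition frechet_C1_in_weight (W : R -> R -> (R -> R) -> Prop)
    (lam : R -> R -> (R -> R) -> R) : Prop :=
  exists dlam : R -> R -> (R -> R) -> (R -> R) -> R,
  forall a b J, W a b J ->
  [/\ C1_bounded_linear a b (dlam a b J),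
      forall e : R, 0 < e -> exists2 eta : R, 0 < eta &
        forall J2, Omega a b J2 ->
          let h : R -> R := fun x => J2 x - J x in
          C1_norm a b h < eta ->
          `|lam a b J2 - lam a b J - dlam a b J h| <= e * C1_norm a b h
    & forall e : R, 0 < e -> exists2 eta : R, 0 < eta &
        forall J2, Omega a b J2 ->
          C1_norm a b (fun x => J2 x - J x) < eta ->
          forall k, C1_on_E k ->
            `|dlam a b J2 k - dlam a b J k| <= e * C1_norm a b k].

(* The weight being fixed, lam is of class C^1 in (a, b). *)
Definition C1_in_endpoints (W : R -> R -> (R -> R) -> Prop)
    (lam : R -> R -> (R -> R) -> R) : Prop :=
  forall a b J, W a b J ->
  [/\ derivable (fun x => lam x b J) a 1,
      derivable (fun x => lam a x J) b 1,
      {for (a, b), continuous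
         (fun q : R * R => derive1 (fun x => lam x q.2 J) q.1)}
    & {for (a, b), continuous
         (fun q : R * R => derive1 (fun x => lam q.1 x J) q.2)}].

Definition spectral_dependence : Prop :=
  forall a0 b0 J0 lam0 u0, Omega a0 b0 J0 ->
  neumann_eigenfunction a0 b0 J0 lam0 u0 -> normalized a0 b0 J0 u0 ->
  exists (rho : R) (lam : R -> R -> (R -> R) -> R)
         (u : R -> R -> (R -> R) -> (R -> R)),
  let W a b J :=
    Omega a b J /\ (Omega_dist a0 b0 J0 a b J < rho%:E)%E in
  [/\ 0 < rho /\ lam a0 b0 J0 = lam0 /\
        (forall x, a0 <= x <= b0 -> u a0 b0 J0 x = u0 x),
      forall a b J, W a b J ->
        [/\ simple_neumann_eigenvalue a b J (lam a b J),
            neumann_eigenfunction a b J (lam a b J) (u a b J)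
          & normalized a b J (u a b J)],
      (forall e : R, 0 < e -> exists2 eta : R, 0 < eta &
         forall a b J, W a b J -> (Omega_dist a0 b0 J0 a b J < eta%:E)%E ->
           `|lam a b J - lam0| < e) /\
      (forall c1 c2 e : R, E_ c1 -> E_ c2 -> 0 < e ->
         exists2 eta : R, 0 < eta &
         forall a b J, W a b J -> (Omega_dist a0 b0 J0 a b J < eta%:E)%E ->
         forall x, c1 <= x <= c2 ->
           `|extend a b (u a b J) x - extend a0 b0 u0 x| < e /\
           `|extend_flux a b J (u a b J) x - extend_flux a0 b0 J0 u0 x| < e),
      C1_in_endpoints W lam
    & frechet_C1_in_weight W lam].

End neumann.

Definition TA (R : realType) (p : R) : Prop :=
  forall lo hi : \bar R, (lo < hi)%E -> spectral_dependence p lo hi.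

(* Main.v *)
(* For fixed h, a test function on the shorter interval is extended by constants;
   cutting its derivative off steeply near the end points changes the energy
   little, and a function whose moment vanishes minimises the p-norm among its
   translates by constants, so the denominator does not decrease.

   For fixed d, the quantity s = |f'|^(p-2) f' / (|f|^(p-2) f), as a function of
   the distance t to an end of the interval, turns the Neumann equation into
   s' = l + U s + (p-1) s^(p/(p-1)), s(0) = 0, with U the logarithmic derivative
   of the weight. If l exceeds the eigenvalue for h2, then the solutions started
   at the two ends reach any level b before they meet: otherwise Barta's
   inequality would make l a lower bound. Their inverse functions t1, t4 satisfy
   t1(b) + t4(b) <= d. Write h1 = k h2 with k^2 <= 1, y for the base of the
   weight, and u = (t4 - t1)/2; a contraction v with y_h1(v(u)) equal to
   sqrt(1 - k^2 + k^2 y_h2(u)^2) yields curves (t1 + t4)/2 -+ v(u) with the same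
   sum that are supersolutions of the equation of the inverse functions for h1.
   From them one builds test functions for h1 on two disjoint subintervals whose
   quotients are at most l' > l once b is large, and glues these with opposite
   signs. *)
Require Import Defs.
From mathcomp Require Import all_boot all_order all_algebra.
From mathcomp Require Import all_classical all_reals all_analysis.
From mathcomp Require Import measurable_realfun ring lra.

Set Implicit Arguments.
Unset Strict Implicit.
Unset Printing Implicit Defensive.

Import Order.TTheory GRing.Theory Num.Theory.
Import numFieldNormedType.Exports.

Local Open Scope classical_set_scope.
Local Open Scope ring_scope.

(** The eigenfunctions for two slopes [h1], [h2] may change sign at different points, so their
    Riccati solutions cannot be compared directly as functions of the distance. With the level as
    independent variable all curves live on one interval (0, b). At a given level the two points
    involved are symmetric about a centre u, and the addition theorems of the oscillator c, s
    express everything by values at u and at the half-distance N. The comparison becomes one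
    rational identity whose sign is that of 1 - k^2. Stopping at a finite level keeps the Riccati
    equations away from blow-up, so no eigenfunction has to be constructed: Barta's inequality
    bounds the constant from below, explicit test functions from above. Both parts argue by
    contradiction also for a technical reason: the failing inequality supplies a nonzero test
    function, and from it come the smooth steps that all smoothing relies on. *)

Section real_calculus.
Context {R : realType}.
Implicit Types (f g : R -> R) (x y a b l : R).

(** * Derivatives and continuity of real functions *)

Definition der f x l := is_derive (x : R) (1 : R) f l.

Lemma der_ext f g x l : f =1 g -> der f x l -> der g x l.
Proof. by move=> /funext ->. Qed.

Lemma der_eq f x l l' : der f x l -> l = l' -> der f x l'.
Proof. by move=> h <-. Qed.

Lemma der_near f g x l : (\forall y \near x, f y = g y) -> der f x l -> der g x l.
Proof.
by move=> fg df; apply: near_eq_is_derive df; rewrite ?oner_eq0.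
Qed.

Lemma der_cst c x : der (fun=> c) x 0.
Proof. exact: is_derive_cst. Qed.

Lemma der_id x : der (fun y => y) x 1.
Proof. exact: is_derive_id. Qed.

Lemma derD f g x l l' : der f x l -> der g x l' ->
  der (fun y => f y + g y) x (l + l').
Proof. by move=> df dg; exact: is_deriveD. Qed.

Lemma derN f x l : der f x l -> der (fun y => - f y) x (- l).
Proof. by move=> df; exact: is_deriveN. Qed.

Lemma derB f g x l l' : der f x l -> der g x l' ->
  der (fun y => f y - g y) x (l - l').
Proof. by move=> df dg; exact: is_deriveB. Qed.

Lemma derM f g x l l' : der f x l -> der g x l' ->
  der (fun y => f y * g y) x (f x * l' + g x * l).
Proof. by move=> df dg; exact: is_deriveM. Qed.

Lemma derZ f x l k : der f x l -> der (fun y => k * f y) x (k * l).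
Proof. by move=> df; have := derM (der_cst k x) df; rewrite mulr0 addr0. Qed.

Lemma der_comp f g x l l' : der f (g x) l -> der g x l' ->
  der (fun y => f (g y)) x (l * l').
Proof. by move=> df dg; exact: (@is_derive1_comp _ f g). Qed.

Lemma derV f x l : f x != 0 -> der f x l ->
  der (fun y => (f y)^-1) x (- (f x) ^- 2 * l).
Proof. by move=> fx df; exact: is_deriveV. Qed.

Lemma der_expR f x l : der f x l -> der (fun y => expR (f y)) x (expR (f x) * l).
Proof. by move=> df; exact: (der_comp (is_derive_expR _) df). Qed.

Lemma der_powR f x l r : 0 < f x -> der f x l ->
  der (fun y => f y `^ r) x (r * f x `^ (r - 1) * l).
Proof. by move=> fx df; exact: (der_comp (is_derive1_powR r fx) df). Qed.

Lemma der_affine x k c : der (fun y => c + k * y) x k.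
Proof.
by apply: der_eq (derD (der_cst c x) (derZ k (der_id x))) _; rewrite add0r mulr1.
Qed.

Lemma der_continuous f x l : der f x l -> {for x, continuous f}.
Proof. by move=> [df _]; apply: differentiable_continuous; exact/derivable1_diffP. Qed.

Lemma der_derive1 f x l : der f x l -> derivable f x 1 /\ derive1 f x = l.
Proof. by move=> [df dE]; split=> //; rewrite derive1E. Qed.

Lemma derivable_der f x : derivable f x 1 -> der f x (derive1 f x).
Proof. by move=> df; rewrite derive1E; exact: derivableP. Qed.

Lemma der_unique f x l l' : der f x l -> der f x l' -> l = l'.
Proof. by move=> [_ <-] [_ <-]. Qed.

Lemma near_lt f x a : {for x, continuous f} -> f x < a -> \forall y \near x, f y < a.
Proof. by move=> cf fa; exact: (@cvgr_lt R R (nbhs x) _ f (f x) cf a fa). Qed.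

Lemma near_gt f x a : {for x, continuous f} -> a < f x -> \forall y \near x, a < f y.
Proof. by move=> cf fa; exact: (@cvgr_gt R R (nbhs x) _ f (f x) cf a fa). Qed.

Lemma near_oo a b x : a < x < b -> \forall y \near x, a < y < b.
Proof.
move=> /andP[ax xb]; have := near_in_itvoo (x := x) (a := a) (b := b).
rewrite in_itv/= ax xb => /(_ erefl) h; apply: (filterS _ h) => y.
by rewrite in_itv.
Qed.

Lemma mean_value f df a b : a < b -> (forall x, a < x < b -> der f x (df x)) ->
  continuous f -> exists2 c : R, a < c < b & f b - f a = df c * (b - a).
Proof.
move=> ab d cf; have [||c cab e] := @MVT R f df a b ab.
- by move=> x; rewrite in_itv/=; exact: d.
- exact: continuous_subspaceT.
- by exists c => //; move: cab; rewrite in_itv.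
Qed.

Lemma der_ge0_le f df a b : a <= b -> continuous f ->
  (forall x, a < x < b -> der f x (df x)) ->
  (forall x, a < x < b -> 0 <= df x) -> f a <= f b.
Proof.
rewrite le_eqVlt => /predU1P[->//|ab] cf d d0.
have [c cab e] := mean_value ab d cf.
by rewrite -subr_ge0 e mulr_ge0 ?d0// subr_ge0 ltW.
Qed.

Lemma der_gt0_lt f df a b : a < b -> continuous f ->
  (forall x, a < x < b -> der f x (df x)) ->
  (forall x, a < x < b -> 0 < df x) -> f a < f b.
Proof.
move=> ab cf d d0.
have [c cab e] := mean_value ab d cf.
by rewrite -subr_gt0 e mulr_gt0 ?d0// subr_gt0.
Qed.

Lemma der_le_le f df g dg a b : a <= b -> continuous f -> continuous g ->
  (forall x, a < x < b -> der f x (df x)) ->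
  (forall x, a < x < b -> der g x (dg x)) ->
  (forall x, a < x < b -> df x <= dg x) -> f b - f a <= g b - g a.
Proof.
move=> ab cf cg d d' h.
rewrite -subr_ge0 (_ : _ - _ = (g b - f b) - (g a - f a)); last by ring.
rewrite subr_ge0; apply: (@der_ge0_le (fun x => g x - f x) (fun x => dg x - df x)) => //.
- by move=> x; apply: continuousB; [exact: cg|exact: cf].
- by move=> x xab; apply: derB; [exact: d'|exact: d].
- by move=> x xab; rewrite subr_ge0; exact: h.
Qed.

Lemma der_norm_le f df a b k : a <= b -> continuous f ->
  (forall x, a < x < b -> der f x (df x)) ->
  (forall x, a < x < b -> `|df x| <= k) -> `|f b - f a| <= k * (b - a).
Proof.
rewrite le_eqVlt => /predU1P[->|ab] cf d h.
  by rewrite !subrr normr0 mulr0.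
have [c cab ->] := mean_value ab d cf.
rewrite normrM (@gtr0_norm _ (b - a)) ?subr_gt0// ler_wpM2r ?subr_ge0 ?(ltW ab)//.
exact: h.
Qed.

Lemma intermediate_value f a b v : a <= b -> continuous f ->
  f a <= v <= f b \/ f b <= v <= f a -> exists2 c : R, a <= c <= b & f c = v.
Proof.
move=> ab cf h; have [||c cab e] := @IVT R f a b v ab.
- exact: continuous_subspaceT.
- rewrite ge_min le_max; by case: h => /andP[-> ->]; rewrite ?orbT.
- by exists c => //; move: cab; rewrite in_itv.
Qed.

Lemma max_value f a b : a <= b -> continuous f ->
  exists2 c : R, a <= c <= b & forall x, a <= x <= b -> f x <= f c.
Proof.
move=> ab cf; have [|c cab h] := @EVT_max R f a b ab; first exact: continuous_subspaceT.
by exists c => [|x xab]; [move: cab; rewrite in_itv|apply: h; rewrite in_itv].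
Qed.

Lemma bounded_on f a b : continuous f ->
  exists2 M : R, 0 < M & forall x, a <= x <= b -> `|f x| <= M.
Proof.
move=> cf; have [ab|ba] := leP a b; last first.
  by exists 1 => // x /andP[h1 h2]; have := le_lt_trans (le_trans h1 h2) ba; rewrite ltxx.
have [c _ h] := @max_value (fun x => `|f x|) a b ab
  (fun x => continuous_comp (cf x) (@norm_continuous _ _ _)).
exists (`|f c| + 1); first by rewrite ltr_wpDl.
by move=> x /h/le_trans; apply; rewrite lerDl.
Qed.

Lemma ccst k : continuous ((fun=> k) : R -> R). Proof. by move=> x; exact: cvg_cst. Qed.

Lemma cidf : continuous (fun x : R => x). Proof. by move=> x; exact: cvg_id. Qed.

Lemma cadd f g : continuous f -> continuous g -> continuous (fun x => f x + g x).
Proof. by move=> cf cg x; apply: continuousD; [exact: cf|exact: cg]. Qed.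

Lemma copp f : continuous f -> continuous (fun x => - f x).
Proof. by move=> cf x; apply: continuousN; exact: cf. Qed.

Lemma csub f g : continuous f -> continuous g -> continuous (fun x => f x - g x).
Proof. by move=> cf cg x; apply: continuousB; [exact: cf|exact: cg]. Qed.

Lemma cmul f g : continuous f -> continuous g -> continuous (fun x => f x * g x).
Proof. by move=> cf cg x; apply: continuousM; [exact: cf|exact: cg]. Qed.

Lemma ccomp f g : continuous f -> continuous g -> continuous (fun x => f (g x)).
Proof. by move=> cf cg x; apply: (@continuous_comp _ _ _ g f); [exact: cg|exact: cf]. Qed.

Lemma cmax f g : continuous f -> continuous g -> continuous (fun x => Num.max (f x) (g x)).
Proof. exact: max_fun_continuous. Qed.

Lemma cmin f g : continuous f -> continuous g -> continuous (fun x => Num.min (f x) (g x)).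
Proof. exact: min_fun_continuous. Qed.

Lemma cinv f : continuous f -> (forall x, f x != 0) -> continuous (fun x => (f x)^-1).
Proof. by move=> cf f0 x; apply: continuousV; [exact: f0|exact: cf]. Qed.

Lemma der_cont f df : (forall x, der f x (df x)) -> continuous f.
Proof. by move=> d x; exact: der_continuous (d x). Qed.

End real_calculus.

(** * Integrals of continuous functions over intervals *)

Section integrals.
Context {R : realType}.
Implicit Types (f g F G : R -> R) (x y a b l : R).
Local Notation mu := (@lebesgue_measure R).

Definition integ f a b : R := \int[mu]_(x in `[a, b]) f x.

Lemma continuous_itv_integrable f a b : continuous f ->
  mu.-integrable `[a, b] (EFin \o f).
Proof.
move=> cf; apply: continuous_compact_integrable; first exact: segment_compact.
exact: continuous_subspaceT.
Qed.

Lemma integral_integ f a b : continuous f ->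
  (\int[mu]_(x in `[a, b]) (f x)%:E)%E = (integ f a b)%:E.
Proof.
move=> cf; rewrite /integ /Rintegral fineK//.
by apply: integrable_fin_num => //; exact: continuous_itv_integrable.
Qed.

Lemma integ_prim f F a b : a <= b -> continuous f -> continuous F ->
  (forall x, a < x < b -> der F x (f x)) -> integ f a b = F b - F a.
Proof.
rewrite le_eqVlt => /predU1P[<- *|ab cf cF dF].
  by rewrite /integ set_itv1 Rintegral_set1 subrr.
rewrite /integ /Rintegral (@continuous_FTC2 _ f F a b)//.
- exact: continuous_subspaceT.
- split.
  + by move=> x; rewrite in_itv/= => /dF[].
  + by apply: cvg_at_right_filter; exact: cF.
  + by apply: cvg_at_left_filter; exact: cF.
- by move=> x; rewrite in_itv/= => /dF/der_derive1[].
Qed.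


Lemma integ_der f a x : continuous f -> a < x -> der (fun y => integ f a y) x (f x).
Proof.
move=> cf ax; have x1 : x < x + 1 by rewrite ltrDl.
have [h1 h2] := @continuous_FTC1_closed R f a x (x + 1) x1
  (continuous_itv_integrable _ _ cf) ax (cf x).
by rewrite /integ -h2; exact: derivable_der.
Qed.

Lemma der0_cst F a b : a <= b -> continuous F ->
  (forall x, a < x < b -> der F x 0) -> F a = F b.
Proof.
move=> ab cF dF; apply/eqP; rewrite eq_le (der_ge0_le ab cF dF)//=.
rewrite -lerN2; apply: (@der_ge0_le R (fun x => - F x) (fun=> 0)) => //.
- by move=> x; apply: continuousN; exact: cF.
- by move=> x /dF/derN; rewrite oppr0.
Qed.

Lemma integD_itv f a b c : continuous f -> a <= b -> b <= c ->
  integ f a c = integ f a b + integ f b c.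
Proof.
move=> cf ab bc; rewrite /integ.
have := @Rintegral_itvB R f (BLeft a) (BRight c) b (continuous_itv_integrable _ _ cf).
rewrite !bnd_simp => /(_ ab bc) /eqP; rewrite subr_eq => /eqP ->.
rewrite addrC Rintegral_itv_obnd_cbnd//.
by apply: (integrableS _ _ _ (continuous_itv_integrable b c cf)) => //; exact: subset_itv_oc_cc.
Qed.

(** [integ_der] differentiates only to the right of the base point, so the base point moves left
    with [x]; subtracting the integral up to 0 makes the value independent of it. *)
Lemma primitive f : continuous f -> exists F, forall x, der F x (f x).
Proof.
move=> cf.
pose F a x := integ f a x - integ f a 0.
have FE a a' x : a <= a' -> a' <= 0 -> a' <= x -> F a x = F a' x.
  by move=> aa a0 ax; rewrite /F (@integD_itv f a a' x)// (@integD_itv f a a' 0)//; ring.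
exists (fun x => F (Num.min x 0 - 1) x) => x.
(* For y within distance 1 of x, min x 0 - 2 lies to the left of min y 0 - 1, so one fixed base
   point serves near x. *)
have dF : der (F (Num.min x 0 - 2)) x (f x).
  rewrite -[f x]subr0; apply: derB; last exact: der_cst.
  apply: integ_der => //; rewrite ltrBlDr (@le_lt_trans _ _ x)//; last by rewrite ltrDl.
  by rewrite ge_min lexx.
apply: der_near dF.
have hx : x - 1 < x < x + 1 by rewrite ltrBlDr !ltrDl !ltr01.
apply: filterS (near_oo hx) => y /andP[y1 y2].
apply: FE.
- rewrite lerBrDr (_ : _ - 2 + 1 = Num.min x 0 - 1); last by ring.
  rewrite le_min; apply/andP; split.
    by rewrite (le_trans _ (ltW y1))// lerB// ge_min lexx.
  by rewrite lerBlDr add0r (@le_trans _ _ 0)// ge_min lexx orbT.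
- by rewrite subr_le0 (@le_trans _ _ 0)// ge_min lexx orbT.
- by rewrite lerBlDr (@le_trans _ _ y)// ?ge_min ?lexx// lerDl.
Qed.

Lemma prim0 f : continuous f -> exists F, [/\ F 0 = 0, continuous F &
  forall x, der F x (f x)].
Proof.
move=> cf; have [F dF] := primitive cf.
have dG x : der (fun x => F x - F 0) x (f x).
  by rewrite -[f x]subr0; apply: derB; [exact: dF|exact: der_cst].
exists (fun x => F x - F 0); split; first by rewrite subrr.
  by move=> x; exact: der_continuous (dG x).
by [].
Qed.

Section linear.
Variables (a b : R) (ab : a <= b).

Lemma integ_le f g : continuous f -> continuous g ->
  (forall x, a <= x <= b -> f x <= g x) -> integ f a b <= integ g a b.
Proof.
move=> cf cg fg; apply: le_Rintegral => //; try exact: continuous_itv_integrable.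
Qed.

Lemma eq_integ f g : (forall x, a <= x <= b -> f x = g x) -> integ f a b = integ g a b.
Proof. by move=> fg; apply: eq_Rintegral => x; rewrite inE/= in_itv/=; exact: fg. Qed.

Lemma integD f g : continuous f -> continuous g ->
  integ (fun x => f x + g x) a b = integ f a b + integ g a b.
Proof. by move=> cf cg; apply: RintegralD => //; exact: continuous_itv_integrable. Qed.

Lemma integB f g : continuous f -> continuous g ->
  integ (fun x => f x - g x) a b = integ f a b - integ g a b.
Proof. by move=> cf cg; apply: RintegralB => //; exact: continuous_itv_integrable. Qed.

Lemma integZ f k : continuous f -> integ (fun x => k * f x) a b = k * integ f a b.
Proof. by move=> cf; apply: RintegralZl => //; exact: continuous_itv_integrable. Qed.

Lemma integ_cst k : integ (fun=> k) a b = k * (b - a).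
Proof.
rewrite (@integ_prim (fun=> k) (fun x => 0 + k * x) a b ab); first by ring.
- by move=> x; exact: cst_continuous.
- by move=> x; apply: der_continuous (der_affine x k 0).
- by move=> x _; exact: der_affine.
Qed.

Lemma integ_ge0 f : (forall x, a <= x <= b -> 0 <= f x) -> 0 <= integ f a b.
Proof. by move=> f0; apply: Rintegral_ge0 => x /=; rewrite in_itv/=; exact: f0. Qed.

(** The derivative [dF] may be discontinuous, as for the derivatives picked by choice in
    [curve_test]; comparing [F] with a primitive of [f] avoids integrating it. *)
Lemma integ_der_le f F dF : continuous f -> continuous F ->
  (forall x, a < x < b -> der F x (dF x)) ->
  (forall x, a < x < b -> dF x <= f x) -> F b - F a <= integ f a b.
Proof.
move=> cf cF dFE le; have [G dG] := primitive cf.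
have cG : continuous G by move=> x; exact: der_continuous (dG x).
rewrite (@integ_prim f G a b ab)//.
exact: (@der_le_le _ F dF G f).
Qed.

(** If the integral were 0, a primitive would be constant by monotonicity and its derivative [f c]
    would vanish. *)
Lemma integ_gt0 f c : continuous f -> (forall x, a <= x <= b -> 0 <= f x) ->
  a < c < b -> 0 < f c -> 0 < integ f a b.
Proof.
move=> cf f0 /andP[ac cb] fc.
have [G dG] := primitive cf.
have cG : continuous G by move=> x; exact: der_continuous (dG x).
have mono x y : a <= x -> x <= y -> y <= b -> G x <= G y.
  move=> ax xy yb; apply: (@der_ge0_le _ G f) => // z /andP[z1 z2]; apply: f0.
  by rewrite (ltW (le_lt_trans ax z1)) (ltW (lt_le_trans z2 yb)).
rewrite (@integ_prim f G a b ab)// subr_gt0 lt_neqAle mono// andbT; apply/eqP => e.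
have eG x : a <= x <= b -> G x = G a.
  move=> /andP[ax xb]; apply/eqP; rewrite eq_le; apply/andP; split.
    by rewrite e mono.
  by rewrite mono.
suff : f c = 0 by move=> e0; move: fc; rewrite e0 ltxx.
apply: (der_unique (dG c)).
apply: (@der_near _ (fun=> G a)); last exact: der_cst.
have acb : a < c < b by rewrite ac.
by apply: filterS (near_oo acb) => y /andP[ay yb]; rewrite eG// !ltW.
Qed.

End linear.

End integrals.

(** * Smooth functions, steps and cutoffs *)

Section smooth_functions.
Context {R : realType}.
Implicit Types (f g F G : R -> R) (x y a b l : R).

(** The recursion is on the derivative, so that the product rule passes through the induction. *)
Fixpoint smooth_upto n f : Prop :=
  (forall x, derivable f x 1) /\ if n is m.+1 then smooth_upto m (derive1 f) else True.

Definition smooth f := forall n, smooth_upto n f.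

Lemma smooth_upto_derive1n n f : smooth_upto n f -> forall x, derivable (derive1n n f) x 1.
Proof.
elim: n f => [|n ih] f [df h]; first exact: df.
by move=> x; rewrite /derive1n iterSr; exact: (ih _ h).
Qed.

Lemma derive1n_smooth_upto n f :
  (forall m x, derivable (derive1n m f) x 1) -> smooth_upto n f.
Proof.
elim: n f => [|n ih] f df; split => //; try exact: (df 0%N).
by apply: ih => m x; have := df m.+1 x; rewrite /derive1n iterSr.
Qed.

Lemma smooth_uptoS n f : smooth_upto n.+1 f -> smooth_upto n f.
Proof. by elim: n f => [|n ih] f [df h]; split => //; apply: ih. Qed.

Lemma smooth_der f x : smooth f -> der f x (derive1 f x).
Proof. by move=> sf; apply: derivable_der; have [] := sf 0%N. Qed.

Lemma smooth_continuous f : smooth f -> continuous f.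
Proof. by move=> sf x; exact: der_continuous (smooth_der x sf). Qed.

Lemma smooth_derive1 f : smooth f -> smooth (derive1 f).
Proof. by move=> sf n; have [] := sf n.+1. Qed.

Lemma smooth_intro f g : (forall x, der f x (g x)) -> smooth g -> smooth f.
Proof.
move=> df sg n.
have fg : derive1 f = g by apply/funext => x; have [] := der_derive1 (df x).
have d x : derivable f x 1 by have [] := der_derive1 (df x).
by case: n => [|n]; split => //; rewrite fg; exact: sg.
Qed.

Lemma smooth_cst c : smooth (fun=> c).
Proof.
move=> n; elim: n c => [|n ih] c; split => //=.
have -> : derive1 (fun=> c) = fun=> 0 :> R.
  by apply/funext => x; have [] := der_derive1 (der_cst c x).
exact: ih.
Qed.

Lemma smooth_uptoD n f g : smooth_upto n f -> smooth_upto n g ->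
  smooth_upto n (fun x => f x + g x).
Proof.
elim: n f g => [|n ih] f g [df hf] [dg hg];
  have d x := der_derive1 (derD (derivable_der (df x)) (derivable_der (dg x)));
  (split; first exact: (fun x => (d x).1)); first exact: I.
have -> : derive1 (fun x => f x + g x) = fun x => derive1 f x + derive1 g x.
  by apply/funext => x; have [] := d x.
exact: ih.
Qed.

Lemma smooth_uptoM n f g : smooth_upto n f -> smooth_upto n g ->
  smooth_upto n (fun x => f x * g x).
Proof.
elim: n f g => [|n ih] f g sf sg; have [df hf] := sf; have [dg hg] := sg;
  have d x := der_derive1 (derM (derivable_der (df x)) (derivable_der (dg x)));
  (split; first exact: (fun x => (d x).1)); first exact: I.
have -> : derive1 (fun x => f x * g x) = fun x => f x * derive1 g x + g x * derive1 f x.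
  by apply/funext => x; have [] := d x.
by apply: smooth_uptoD; apply: ih => //; exact: smooth_uptoS.
Qed.

Lemma smoothD f g : smooth f -> smooth g -> smooth (fun x => f x + g x).
Proof. by move=> sf sg n; exact: smooth_uptoD. Qed.

Lemma smoothM f g : smooth f -> smooth g -> smooth (fun x => f x * g x).
Proof. by move=> sf sg n; exact: smooth_uptoM. Qed.

Lemma smoothZ k f : smooth f -> smooth (fun x => k * f x).
Proof. by move=> sf; apply: smoothM => //; exact: smooth_cst. Qed.

Lemma smoothB f g : smooth f -> smooth g -> smooth (fun x => f x - g x).
Proof.
move=> sf sg; have := smoothD sf (smoothZ (-1) sg).
by congr smooth; apply/funext => x; rewrite mulN1r.
Qed.

Lemma smooth_affine_comp f k c : smooth f -> smooth (fun x => f (c + k * x)).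
Proof.
move=> sf n; elim: n f sf => [|n ih] f sf;
  have d x := der_derive1 (@der_comp _ f (fun y => c + k * y) x _ _
    (smooth_der (c + k * x) sf) (der_affine x k c));
  (split; first exact: (fun x => (d x).1)); first exact: I.
have -> : derive1 (fun x => f (c + k * x)) = fun x => derive1 f (c + k * x) * k.
  by apply/funext => x; have [] := d x.
apply: smooth_uptoM; first by apply: ih; exact: smooth_derive1.
exact: smooth_cst.
Qed.

Lemma Cc_infty_smooth f : Cc_infty f -> smooth f.
Proof. by move=> [df _] n; apply: derive1n_smooth_upto => m x; exact: df. Qed.

Lemma Cc_infty_support f : Cc_infty f -> exists2 M : R, 0 < M & forall x, M <= `|x| -> f x = 0.
Proof.
move=> [_ /compact_bounded [M [_ hM]]].
exists (Num.max 1 (M + 1) + 1); first by rewrite ltr_wpDl// le_max ler01.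
move=> x hx; apply/eqP; apply/negPn/negP => fx.
have /(_ (Num.max 1 (M + 1)) _ x) := hM.
rewrite lt_max ltrDl ltr01 orbT => /(_ isT) h.
have : `|x| <= Num.max 1 (M + 1) by apply: h; apply: subset_closure.
by move=> /(le_trans hx); rewrite gerDl ler10.
Qed.

Lemma Cc_infty_intro f M : smooth f -> (forall x, M <= `|x| -> f x = 0) -> Cc_infty f.
Proof.
move=> sf h; split; first by move=> n x; exact: smooth_upto_derive1n.
apply: (@subclosed_compact _ _ `[- M, M]).
- exact: closed_closure.
- exact: segment_compact.
have -> : `[- M, M]%classic = closure `[- M, M]%classic :> set R.
  by apply/closure_id; exact: itv_closed.
apply: closureS => x /= fx; rewrite in_itv/= -ler_norml leNgt; apply/negP => Mx.
by move: fx; rewrite h ?eqxx// ltW.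
Qed.

Definition smooth_step f := [/\ smooth f, forall x, 0 <= f x <= 1,
  forall x, x <= 0 -> f x = 0 & forall x, 1 <= x -> f x = 1].

(** The square of a nonzero test function, moved to [0, 1], is a bump, and its normalised primitive
    is the step. Since the bump is given, no explicit flat function such as exp(-1/x) is built. *)
Lemma exists_smooth_step f : Cc_infty f -> (exists x, f x != 0) ->
  exists P : R -> R, smooth_step P.
Proof.
move=> cf [x0 fx0].
have sf := Cc_infty_smooth cf; have [M M0 fM] := Cc_infty_support cf.
pose h x := f (- M + (2 * M) * x) ^+ 2.
have sh : smooth h.
  have s := smooth_affine_comp (2 * M) (- M) sf.
  by have := smoothM s s; congr smooth; apply/funext => x; rewrite /h expr2.
have ch := smooth_continuous sh.
have [F [F0 cF dF]] := prim0 ch.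
have h0 x : 0 <= h x by rewrite /h sqr_ge0.
have M20 : 2 * M != 0 by rewrite mulf_neq0 ?gt_eqF.
have hl x : x <= 0 -> h x = 0.
  move=> x_le0; rewrite /h fM ?expr0n//.
  have : - M + 2 * M * x <= - M by rewrite gerDl mulr_ge0_le0// mulr_ge0// ltW.
  by move=> le; rewrite ler_normr lerNr le orbT.
have hr x : 1 <= x -> h x = 0.
  move=> x_ge1; rewrite /h fM ?expr0n//.
  have : M <= - M + 2 * M * x by nra.
  by move=> le; rewrite ler_normr le.
have Fmono x y : x <= y -> F x <= F y.
  by move=> xy; apply: (@der_ge0_le _ F h).
have Fl x : x <= 0 -> F x = 0.
  move=> x0'; rewrite -F0; apply: der0_cst => // y /andP[_ y0].
  by rewrite -(hl y (ltW y0)).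
have Fr x : 1 <= x -> F x = F 1.
  move=> x1; apply/esym; apply: der0_cst => // y /andP[y1 _].
  by rewrite -(hr y (ltW y1)).
(* The point that the change of variable sends to [x0]. *)
pose z := (x0 + M) / (2 * M).
have hz : 0 < h z.
  rewrite lt_neqAle h0 andbT eq_sym /h sqrf_eq0 /z mulrCA divff// mulr1.
  by rewrite addrCA addNr addr0.
have z01 : 0 < z < 1.
  apply/andP; split; rewrite ltNge; apply/negP => zz; move: hz.
    by rewrite hl// ltxx.
  by rewrite hr// ltxx.
have F1 : 0 < F 1.
  have -> : F 1 = integ h 0 1 by rewrite (@integ_prim _ h F) ?F0 ?subr0.
  exact: (integ_gt0 _ ch _ z01).
exists (fun x => (F 1)^-1 * F x); split.
- by apply: smoothZ; exact: smooth_intro dF sh.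
- move=> x; have [xl|/ltW xl] := leP x 0; first by rewrite (Fl x xl) mulr0 lexx ler01.
  have Fx : 0 <= F x by rewrite -F0; exact: Fmono.
  apply/andP; split; first by apply: mulr_ge0 => //; rewrite invr_ge0 ltW.
  rewrite mulrC ler_pdivrMr// mul1r.
  have [xr|xr] := leP x 1; first exact: Fmono.
  by rewrite (Fr x (ltW xr)).
- by move=> x x0'; rewrite (Fl x x0') mulr0.
- by move=> x x1; rewrite (Fr x x1) mulVf// gt_eqF.
Qed.

Lemma smooth_step_between P a b : smooth_step P -> a < b ->
  exists Q : R -> R, [/\ smooth Q, forall x, 0 <= Q x <= 1,
    forall x, x <= a -> Q x = 0 & forall x, b <= x -> Q x = 1].
Proof.
move=> [sP P01 P0 P1] ab; have ba : 0 < b - a by rewrite subr_gt0.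
exists (fun x => P (- (a / (b - a)) + (b - a)^-1 * x)).
have e x : - (a / (b - a)) + (b - a)^-1 * x = (x - a) / (b - a) by rewrite mulrC; ring.
split; first exact: smooth_affine_comp.
- by move=> x; exact: P01.
- by move=> x xa; rewrite P0// e pmulr_lle0 ?invr_gt0// subr_le0.
- by move=> x bx; rewrite P1// e ler_pdivlMr// mul1r lerB.
Qed.

Lemma exists_cutoff P d : smooth_step P ->
  exists2 X : R -> R, Cc_infty X & forall x, - d <= x <= d -> X x = 1.
Proof.
move=> hP.
have h1 : - d - 1 < - d by rewrite gtrBl.
have h2 : d < d + 1 by rewrite ltrDl.
have [Q [sQ _ Q0 Q1]] := smooth_step_between hP h1.
have [S [sS _ S0 S1]] := smooth_step_between hP h2.
exists (fun x => Q x * (1 - S x)).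
  apply: (@Cc_infty_intro _ (`|d| + 1)).
    by apply: smoothM => //; apply: smoothB => //; exact: smooth_cst.
  move=> x; have := ler_norm d; have [x0|x0] := leP 0 x.
    by rewrite (ger0_norm x0) => hd hx; rewrite (S1 x) ?subrr ?mulr0//; lra.
  by rewrite (ltr0_norm x0) => hd hx; rewrite (Q0 x) ?mul0r//; lra.
by move=> x /andP[x1 x2]; rewrite Q1// S0// subr0 mulr1.
Qed.

End smooth_functions.

(** * Uniform approximation by smooth functions *)

Section approximation.
Context {R : realType}.
Implicit Types (f g F G P Q : R -> R) (x y a b l e : R).

Lemma continuous_dist g x e : {for x, continuous g} -> 0 < e ->
  exists2 d : R, 0 < d & forall y, `|y - x| < d -> `|g y - g x| < e.
Proof.
move=> cg e0; have /cvgrPdist_lt/(_ e e0)[d d0 h] : g y @[y --> x] --> g x by [].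
by exists d => // y yx; rewrite distrC; apply: h; rewrite /= distrC.
Qed.

Lemma convex_dist u v w t e : 0 <= t <= 1 -> `|u - w| <= e -> `|v - w| <= e ->
  `|u * (1 - t) + v * t - w| <= e.
Proof.
move=> /andP[t0 t1] hu hv.
have -> : u * (1 - t) + v * t - w = (u - w) * (1 - t) + (v - w) * t by ring.
apply: le_trans (ler_normD _ _) _; rewrite !normrM.
rewrite (@ger0_norm _ (1 - t)) ?subr_ge0// (@ger0_norm _ t)//.
have -> : e = e * (1 - t) + e * t by ring.
by apply: lerD; rewrite ler_wpM2r// subr_ge0.
Qed.

(** Let s be the supremum of the right ends up to which an approximation exists. Near s the constant
    [g s] is a good approximant, and gluing it on through a smooth step carries the approximation
    beyond s unless b is reached. *)
Lemma smooth_approximation P g a b e : smooth_step P -> continuous g -> a <= b ->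
  0 < e -> exists2 G, smooth G & forall x, a <= x <= b -> `|G x - g x| <= e.
Proof.
move=> hP cg ab e0.
pose S := [set c | a <= c <= b /\
  exists2 G, smooth G & forall x, a <= x <= c -> `|G x - g x| <= e].
have Sa : S a.
  split; first by rewrite lexx.
  exists (fun=> g a); first exact: smooth_cst.
  by move=> x; rewrite -eq_le => /eqP <-; rewrite subrr normr0 ltW.
have hS : has_sup S.
  by split; [exists a|exists b => x [/andP[]]].
set s := sup S.
have sb : s <= b by apply: ge_sup; [exists a|move=> x [/andP[]]].
have as_ : a <= s by apply: ub_le_sup => //; case: hS.
have [d d0 hd] := continuous_dist (cg s) e0.
have [c Sc sc] := sup_adherent d0 hS; rewrite -/s in sc.
have [/andP[ac cb] [G sG GE]] := Sc.
have cs : c <= s by apply: ub_le_sup => //; case: hS.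
have [Q [sQ Q01 Q0 Q1]] := smooth_step_between hP sc.
(* On the transition zone of [Q], from s - d to c, both [G] and the constant [g s] are within [e] of
   [g], hence so is their convex combination. *)
have St : S (Num.min b (s + d / 2)).
  split.
    by rewrite ge_min lexx /= le_min ab/= (le_trans as_)// lerDl divr_ge0// ltW.
  exists (fun x => G x * (1 - Q x) + g s * Q x).
    apply: smoothD; apply: smoothM => //; try exact: smooth_cst.
    by apply: smoothB => //; exact: smooth_cst.
  move=> x /andP[ax]; rewrite le_min => /andP[xb xs].
  have [xsd|xsd] := leP x (s - d).
    rewrite Q0// subr0 mulr0 mulr1 addr0; apply: GE.
    by rewrite ax (le_trans xsd)// ltW.
  have gx : `|g s - g x| <= e.
    by rewrite distrC ltW// hd// ltr_norml; apply/andP; split; lra.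
  have [xc|xc] := leP x c.
    by apply: convex_dist; [exact: Q01|by apply: GE; rewrite ax|exact: gx].
  by rewrite (Q1 x (ltW xc)) subrr mulr0 mulr1 add0r.
have : Num.min b (s + d / 2) <= s by apply: ub_le_sup => //; case: hS.
have sd : s < s + d / 2 by rewrite ltrDl divr_gt0.
rewrite ge_min leNgt => /orP[|]; last by rewrite leNgt sd.
rewrite -leNgt => bs.
case: St => _ [H sH HE]; exists H => // x /andP[ax xb]; apply: HE.
by rewrite ax le_min xb (le_trans xb)// (le_trans bs)// ltW.
Qed.

(** A smooth approximant within e/3 is Lipschitz on the interval, which gives [d] explicitly. *)
Lemma uniform_continuity P g a b e : smooth_step P -> continuous g -> a <= b -> 0 < e ->
  exists2 d : R, 0 < d & forall x y, a <= x <= b -> a <= y <= b -> `|x - y| < d ->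
    `|g x - g y| < e.
Proof.
move=> hP cg ab e0.
have e30 : 0 < e / 3 by rewrite divr_gt0.
have [G sG GE] := smooth_approximation hP cg ab e30.
have [M M0 hM] := bounded_on a b (smooth_continuous (smooth_derive1 sG)).
have lip x y : a <= x -> x <= y -> y <= b -> `|G y - G x| <= M * (y - x).
  move=> ax; rewrite le_eqVlt => /predU1P[<- _|xy yb].
    by rewrite !subrr normr0 mulr0.
  have [c /andP[xc cy] ->] := @mean_value _ G (derive1 G) x y xy
    (fun z _ => smooth_der z sG) (smooth_continuous sG).
  rewrite normrM (@gtr0_norm _ (y - x)) ?subr_gt0// ler_wpM2r ?subr_ge0 ?(ltW xy)//.
  by apply: hM; rewrite (le_trans ax (ltW xc)) (le_trans (ltW cy) yb).
have lip' x y : a <= x <= b -> a <= y <= b -> `|G x - G y| <= M * `|x - y|.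
  move=> /andP[ax xb] /andP[ay yb]; have [xy|/ltW yx] := leP x y.
    by rewrite distrC (distrC x) (@ger0_norm _ (y - x)) ?subr_ge0// lip.
  by rewrite (@ger0_norm _ (x - y)) ?subr_ge0// lip.
exists (e / 3 / M); first by rewrite divr_gt0.
move=> x y hx hy; rewrite ltr_pdivlMr// mulrC => xy.
have := lip' x y hx hy; have := GE x hx; have := GE y hy.
rewrite !ler_norml => /andP[h1 h2] /andP[h3 h4] /andP[h5 h6].
by rewrite ltr_norml; apply/andP; split; lra.
Qed.

End approximation.

(** * Powers of absolute values and the signed power *)

Section power.
Context {R : realType}.
Implicit Types (p q r a b x y k : R).

Lemma normr_powR_continuous p : 0 < p -> continuous (fun x : R => `|x| `^ p).
Proof.
move=> p0 x; have [->|x0] := eqVneq x 0.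
  apply/cvgrPdist_lt => e e0; rewrite normr0 powR0 ?gt_eqF//.
  exists (e `^ p^-1); first exact: powR_gt0.
  move=> y /=; rewrite !sub0r !normrN norm_powR// normr_id => ye.
  have := gt0_ltr_powR p0 _ _ ye.
  by rewrite -powRrM mulVf ?gt_eqF// powRr1 ?ltW//; apply; rewrite nnegrE ?powR_ge0.
apply: (@continuous_comp _ _ _ (fun x : R => `|x|) (fun x => x `^ p)).
  exact: norm_continuous.
have x'0 : 0 < `|x| by rewrite normr_gt0.
exact: der_continuous (is_derive1_powR p x'0).
Qed.

Lemma signed_pow0 p : signed_pow p (0 : R) = 0.
Proof. by rewrite /signed_pow mulr0. Qed.

Lemma signed_powE p x : 1 < p -> signed_pow p x * x = `|x| `^ p.
Proof.
move=> p1; rewrite /signed_pow; have [->|x0] := eqVneq x 0.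
  by rewrite !mulr0 normr0 powR0// gt_eqF// (lt_trans _ p1).
rewrite -mulrA -expr2 -real_normK ?num_real// -powR_mulrn// -powRD.
  by congr (_ `^ _); rewrite -natr1; ring.
by apply/implyP => _; rewrite normr_eq0.
Qed.

Lemma norm_signed_pow p x : 1 < p -> `|signed_pow p x| = `|x| `^ (p - 1).
Proof.
move=> p1; rewrite /signed_pow; have [->|x0] := eqVneq x 0.
  by rewrite mulr0 normr0 powR0// subr_eq0 gt_eqF.
rewrite normrM norm_powR// normr_id mulrC.
have {1}-> : `|x| = `|x| `^ 1 by rewrite powRr1.
rewrite -powRD; last by apply/implyP => _; rewrite normr_eq0.
by congr (_ `^ _); ring.
Qed.

Lemma signed_pow_continuous p : 1 < p -> continuous (signed_pow p : R -> R).
Proof.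
move=> p1 x; have p10 : 0 < p - 1 by rewrite subr_gt0.
have [->|x0] := eqVneq x 0.
  apply/cvgrPdist_lt => e e0; rewrite signed_pow0.
  exists (e `^ (p - 1)^-1); first exact: powR_gt0.
  move=> y /=; rewrite !sub0r !normrN norm_signed_pow// => ye.
  have := gt0_ltr_powR p10 _ _ ye.
  by rewrite -powRrM mulVf ?gt_eqF// powRr1 ?ltW//; apply; rewrite nnegrE ?powR_ge0.
apply: (@continuousM R R (fun y => `|y| `^ (p - 2)) (fun y => y)); last exact: cvg_id.
apply: (@continuous_comp _ _ _ (fun x : R => `|x|) (fun x => x `^ (p - 2))).
  exact: norm_continuous.
have x'0 : 0 < `|x| by rewrite normr_gt0.
exact: der_continuous (is_derive1_powR _ x'0).
Qed.

Lemma signed_powM p c x : 1 < p -> 0 <= c ->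
  signed_pow p (c * x) = c `^ (p - 1) * signed_pow p x.
Proof.
move=> p1 c0; have [->|cN0] := eqVneq c 0.
  by rewrite mul0r signed_pow0 powR0 ?mul0r// subr_eq0 gt_eqF.
rewrite /signed_pow normrM (ger0_norm c0) powRM//.
have -> : c `^ (p - 1) = c `^ (p - 2) * c.
  rewrite -[X in _ * X](powRr1 c0) -powRD; last by apply/implyP.
  by congr (_ `^ _); ring.
by ring.
Qed.

Lemma signed_powN p x : signed_pow p (- x) = - signed_pow p x.
Proof. by rewrite /signed_pow normrN mulrN. Qed.

Lemma ge0_signed_pow p x : 1 < p -> 0 <= x -> signed_pow p x = x `^ (p - 1).
Proof.
move=> p1 x0; rewrite -[RHS](ger0_norm (powR_ge0 _ _)) norm_powR//.
rewrite -norm_signed_pow// ger0_norm//.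
by rewrite /signed_pow mulr_ge0// powR_ge0.
Qed.

Lemma der_normr_powR p x : 1 < p -> der (fun x : R => `|x| `^ p) x (p * signed_pow p x).
Proof.
move=> p1; have p0 : 0 < p by rewrite (lt_trans _ p1).
have [->|x0] := eqVneq x 0.
  rewrite signed_pow0 mulr0; apply/is_derive1_caratheodory.
  (* At 0 the slope function is [signed_pow p] itself, since its product with z is |z|^p. *)
  exists (signed_pow p); split.
  - move=> z; rewrite !subr0 normr0 powR0 ?subr0 ?gt_eqF//.
    by rewrite signed_powE.
  - exact: signed_pow_continuous.
  - exact: signed_pow0.
have [xp|xn|xe] := ltgtP 0 x; last by rewrite xe eqxx in x0.
  have := der_powR p xp (der_id x); rewrite mulr1 ge0_signed_pow ?ltW//.
  apply: der_near; apply: filterS (near_gt (der_continuous (der_id x)) xp) => y y0.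
  by rewrite gtr0_norm.
have xn' : 0 < - x by rewrite oppr_gt0.
have := der_powR p xn' (derN (der_id x)).
rewrite mulrN1 -[signed_pow _ _]opprK -signed_powN ge0_signed_pow ?ltW// -mulrN.
apply: der_near; apply: filterS (near_lt (der_continuous (der_id x)) xn) => y y0.
by rewrite ltr0_norm.
Qed.

(** The tangent of the convex function |x|^p at b, obtained from Young's inequality for |a| and
    |b|^(p-1). *)
Lemma normr_powR_tangent p a b : 1 < p ->
  p * signed_pow p b * a - (p - 1) * `|b| `^ p <= `|a| `^ p.
Proof.
move=> p1; have p0 : 0 < p by rewrite (lt_trans _ p1).
have p10 : 0 < p - 1 by rewrite subr_gt0.
pose q := p / (p - 1).
have q0 : 0 < q by rewrite divr_gt0.
have pq : p^-1 + q^-1 = 1 by rewrite /q; field; rewrite ?gt_eqF.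
have := @conjugate_powR R `|a| `|signed_pow p b| p q (normr_ge0 _) (normr_ge0 _) p0 q0 pq.
rewrite norm_signed_pow// -powRrM.
have -> : (p - 1) * q = p by rewrite /q; field; rewrite ?gt_eqF.
have h : signed_pow p b * a <= `|a| * `|b| `^ (p - 1).
  by rewrite -norm_signed_pow// -normrM mulrC ler_norm.
move=> /(le_trans h); rewrite -(ler_pM2l p0) => h2.
have e : p * (`|a| `^ p / p + `|b| `^ p / q) = `|a| `^ p + (p - 1) * `|b| `^ p.
  by rewrite /q; field; rewrite ?gt_eqF.
by move: h2; rewrite e mulrA; lra.
Qed.

(** One-sided on purpose: the tangent at x needs a bound on x only, so y may be uncontrolled. *)
Lemma normr_powR_lipschitz p M x y : 1 < p -> `|x| <= M ->
  `|x| `^ p - `|y| `^ p <= p * M `^ (p - 1) * `|x - y|.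
Proof.
move=> p1 xM; have p0 : 0 < p by rewrite (lt_trans _ p1).
have := @normr_powR_tangent p y x p1.
have e := signed_powE x p1.
have h : signed_pow p x * (x - y) <= M `^ (p - 1) * `|x - y|.
  apply: le_trans (ler_norm _) _; rewrite normrM norm_signed_pow// ler_wpM2r//.
  by rewrite ge0_ler_powR ?nnegrE ?subr_ge0 ?(ltW p1)// (le_trans _ xM).
have := ler_wpM2l (ltW p0) h; rewrite (mulrBr (signed_pow p x)) e.
lra.
Qed.

Lemma signed_pow_ge0 p x : 0 <= x -> 0 <= signed_pow p x.
Proof. by move=> x0; rewrite /signed_pow mulr_ge0// powR_ge0. Qed.

Lemma signed_pow_le0 p x : x <= 0 -> signed_pow p x <= 0.
Proof. by move=> x0; rewrite /signed_pow mulr_ge0_le0// powR_ge0. Qed.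

End power.

(** * Integration against a density *)

Section density_integral.
Context {R : realType}.
Variables (w : R -> R) (w0 : forall x, 0 <= w x) (mw : measurable_fun setT w).
Local Notation mu := (@lebesgue_measure R).
Local Notation xi := (density w0 mw).

Import HBNNSimple.

Let mwE : measurable_fun setT (EFin \o w).
Proof. exact/measurable_EFinP. Qed.

Let integral_density_indic (E : set (measurableTypeR R)) : measurable E ->
  (\int[xi]_x (\1_E x)%:E = \int[mu]_x ((\1_E x)%:E * (w x)%:E))%E.
Proof.
move=> mE; rewrite integral_indic//= /density setIT [LHS]integral_mkcond/=.
apply: eq_integral => x _; rewrite patchE indicE.
by case: ifPn => _; rewrite ?mul1e ?mul0e.
Qed.

Let integral_density_nnsfun (f : {nnsfun (measurableTypeR R) >-> R}) :
  (\int[xi]_x (f x)%:E = \int[mu]_x ((f x)%:E * (w x)%:E))%E.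
Proof.
under [LHS]eq_integral do rewrite fimfunE -fsumEFin//.
rewrite [LHS]ge0_integral_fsum//; last 2 first.
  - by move=> r; exact/measurable_EFinP/measurableT_comp.
  - by move=> n x _; rewrite EFinM nnfun_muleindic_ge0.
under [RHS]eq_integral.
  move=> x xD; rewrite fimfunE -fsumEFin// muleC ge0_mule_fsumr; last first.
    by move=> r; rewrite EFinM nnfun_muleindic_ge0.
  over.
rewrite [RHS]ge0_integral_fsum//; last 2 first.
  - move=> r; apply: emeasurable_funM => //.
    by apply/measurable_EFinP/measurableT_comp.
  - by move=> n x _; rewrite mule_ge0 ?lee_fin// -lee_fin EFinM nnfun_muleindic_ge0.
apply: eq_fsbigr => r _.
rewrite integralZl_indic_nnsfun// integral_density_indic//.
have [r0|r0] := leP 0 r; last first.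
  rewrite preimage_nnfun0// !indic0.
  by rewrite !integral0_eq ?mule0// => x _; rewrite /= ?mulr0 ?mul0e ?mule0.
rewrite -ge0_integralZl//.
- by apply: eq_integral => x _; rewrite EFinM muleA [RHS]muleC.
- by apply: emeasurable_funM => //; exact/measurable_EFinP/measurable_indic.
- by move=> x _; rewrite mule_ge0// lee_fin.
Qed.

Lemma ge0_integral_density (f : measurableTypeR R -> \bar R) :
  measurable_fun setT f -> (forall x, 0 <= f x)%E ->
  (\int[xi]_x f x = \int[mu]_x (f x * (w x)%:E))%E.
Proof.
move=> mf f0.
pose f_ := nnsfun_approx measurableT mf.
have cf x : (EFin \o f_ ^~ x) n @[n --> \oo] --> f x by exact: cvg_nnsfun_approx.
transitivity (lim (\int[xi]_x (f_ n x)%:E @[n --> \oo])%E).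
  rewrite -monotone_convergence//=.
  - by apply: eq_integral => x _; apply/esym/cvg_lim => //; exact: cf.
  - by move=> n; exact/measurable_EFinP/measurable_funTS.
  - by move=> n ? _; rewrite lee_fin.
  - by move=> ? _ ? ? mn; rewrite lee_fin; exact/lefP/nd_nnsfun_approx.
transitivity (lim (\int[mu]_x ((f_ n x)%:E * (w x)%:E) @[n --> \oo])%E); last first.
  rewrite -monotone_convergence//=.
  - apply: eq_integral => x _; apply/cvg_lim => //.
    by apply: cvgeZr => //; exact: cf.
  - move=> n; apply: emeasurable_funM => //.
    exact/measurable_EFinP/measurable_funTS.
  - by move=> n ? _; rewrite mule_ge0// lee_fin.
  - by move=> x _ ? ? mn; rewrite lee_wpmul2r ?lee_fin//; exact/lefP/nd_nnsfun_approx.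
by apply: congr_lim; apply/funext => n /=; exact: integral_density_nnsfun.
Qed.

End density_integral.

(** * The Poincare constant of a weighted interval *)

Section weighted_measure.
Context {R : realType}.
Implicit Types (f g h j F P : R -> R) (a b p : R).
Local Notation mu := (@lebesgue_measure R).

(** The only access to the measure in the later estimates, which thus deal with interval integrals
    of continuous functions only. *)
Definition represents (xi : {measure set (measurableTypeR R) -> \bar R}) j a b :=
  forall f, continuous f ->
    (\int[xi]_x (f x)%:E)%E = (integ (fun x => f x * j x) a b)%:E.

Lemma density_represents (w : R -> R) (w0 : forall x, 0 <= w x)
    (mw : measurable_fun setT w) j a b : continuous j ->
  (forall x, w x = j x * \1_(`[a, b]%classic : set R) x) ->
  represents (density w0 mw) j a b.
Proof.
move=> cj wE f cf.
have pos g : continuous g -> (forall x, 0 <= g x) ->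
    (\int[density w0 mw]_x (g x)%:E)%E = (integ (fun x => g x * j x) a b)%:E.
  move=> cg g0; have mg : measurable_fun setT (fun x => (g x)%:E).
    by apply/measurable_EFinP; exact: continuous_measurable_fun.
  rewrite (@ge0_integral_density _ _ w0 mw (fun x => (g x)%:E) mg)//.
  rewrite -integral_integ; last exact: cmul.
  rewrite [RHS]integral_mkcond/=; apply: eq_integral => x _.
  rewrite patchE -EFinM wE indicE.
  by case: ifPn => _; [rewrite mulr1|rewrite !mulr0].
pose fp x := Num.max (f x) 0.
pose fn x := Num.max (- f x) 0.
have cfp : continuous fp by apply: cmax => //; exact: ccst.
have cfn : continuous fn by apply: cmax; [exact: copp|exact: ccst].
rewrite integralE /=.
have -> : (fun x => (f x)%:E)^\+%E = fun x => (fp x)%:E.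
  by apply/funext => x; rewrite funeposE /fp EFin_max.
have -> : (fun x => (f x)%:E)^\-%E = fun x => (fn x)%:E.
  by apply/funext => x; rewrite funenegE /fn -EFinN EFin_max.
rewrite !pos//; last 2 first.
- by move=> x; rewrite le_max lexx orbT.
- by move=> x; rewrite le_max lexx orbT.
rewrite -EFinB -integB.
- congr (_%:E); apply: eq_integ => x _; rewrite -mulrBl; congr (_ * _).
  by rewrite /fp /fn /Order.max; case: ifPn; case: ifPn; lra.
- exact: cmul.
- exact: cmul.
Qed.

Let arith_mass (C eta m : R) : 0 < eta -> 0 <= C -> eta * (2 * (C + 1)) <= m -> C * eta < m.
Proof. by move=> *; nra. Qed.

Let arith_quotient (C C' l e eta m : R) : 0 < eta ->
  eta * (C' + (l + e) * C + 1) <= e * m -> l * m + C' * eta <= (l + e) * (m - C * eta).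
Proof. by move=> *; nra. Qed.

Section Lambda.
Variables (p : R) (xi : {measure set (measurableTypeR R) -> \bar R}).
Variables (j : R -> R) (a b : R).
Hypotheses (p1 : 1 < p) (cj : continuous j) (j0 : forall x, 0 < j x) (ab : a < b).
Hypothesis xij : represents xi j a b.

Definition mass f := integ (fun x => `|f x| `^ p * j x) a b.
Definition moment f := integ (fun x => signed_pow p (f x) * j x) a b.

Let p0 : 0 < p. Proof. by rewrite (lt_trans _ p1). Qed.

Lemma continuous_normr_powR f : continuous f -> continuous (fun x => `|f x| `^ p).
Proof.
move=> cf x; apply: (@continuous_comp _ _ _ f (fun y => `|y| `^ p)); first exact: cf.
exact: normr_powR_continuous.
Qed.

Lemma continuous_signed_pow f : continuous f -> continuous (fun x => signed_pow p (f x)).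
Proof.
move=> cf x; apply: (@continuous_comp _ _ _ f (signed_pow p)); first exact: cf.
exact: signed_pow_continuous.
Qed.

Lemma mass_ge0 f : 0 <= mass f.
Proof.
by apply: integ_ge0 => x _; rewrite mulr_ge0 ?powR_ge0// ltW.
Qed.

Lemma quotientE f : smooth f -> poincare_quotient p xi f =
  if mass f == 0 then +oo%E else (mass (derive1 f) / mass f)%:E.
Proof.
move=> sf; rewrite /poincare_quotient.
rewrite xij; last by apply: continuous_normr_powR; exact: smooth_continuous.
rewrite xij; last first.
  by apply: continuous_normr_powR; apply: smooth_continuous; exact: smooth_derive1.
rewrite -/(mass f) -/(mass (derive1 f)) eqe; case: ifPn => // m0.
by rewrite inver (negbTE m0) -EFinM.
Qed.

Lemma momentE f : continuous f ->
  (\int[xi]_x (signed_pow p (f x))%:E)%E = (moment f)%:E.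
Proof. by move=> cf; rewrite xij//; exact: continuous_signed_pow. Qed.

Lemma Lambda_lower l : (forall f, smooth f -> moment f = 0 ->
  l * mass f <= mass (derive1 f)) -> (l%:E <= Lambda_Poi p xi)%E.
Proof.
move=> h; apply: le_ereal_inf_tmp => _ [f [cf _ mf] <-].
have sf := Cc_infty_smooth cf.
rewrite quotientE//; case: ifPn => [_|m0]; first by rewrite leey.
rewrite lee_fin ler_pdivlMr; last by rewrite lt_neqAle eq_sym m0 mass_ge0.
apply: h => //; apply: EFin_inj; rewrite -momentE//; exact: smooth_continuous.
Qed.

Lemma Lambda_witness (L : \bar R) : (Lambda_Poi p xi < L)%E ->
  exists f (l : R), [/\ Cc_infty f, exists x, f x != 0, moment f = 0, 0 < mass f &
    [/\ mass (derive1 f) <= l * mass f, (l%:E < L)%E & (Lambda_Poi p xi <= l%:E)%E]].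
Proof.
move=> /ereal_inf_lt[_ [f [cf nf mf] <-]].
have sf := Cc_infty_smooth cf.
have le : (Lambda_Poi p xi <= poincare_quotient p xi f)%E.
  by apply: ereal_inf_lbound; exists f.
move: le; rewrite (quotientE sf); case: ifPn => [_ _|m0 le lt]; first by rewrite ltNge leey.
have mp : 0 < mass f by rewrite lt_neqAle eq_sym m0 mass_ge0.
exists f, (mass (derive1 f) / mass f); split => //.
  by apply: EFin_inj; rewrite -momentE; [|exact: smooth_continuous].
by split; [rewrite (divfK m0); exact: lexx|exact: lt|exact: le].
Qed.

(** Integrate the tangent of |x|^p at [f x], evaluated at [f x - k]: its linear term contributes a
    multiple of the moment, which is 0. *)
Lemma der_mass_cst f k : continuous f -> moment f = 0 ->
  mass f <= mass (fun x => f x - k).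
Proof.
move=> cf mf.
have -> : mass f = mass f - p * k * moment f by rewrite mf mulr0 subr0.
have cm : continuous (fun x => signed_pow p (f x) * j x).
  by apply: cmul => //; exact: continuous_signed_pow.
have cM g : continuous g -> continuous (fun x => `|g x| `^ p * j x).
  by move=> cg; apply: cmul => //; exact: continuous_normr_powR.
rewrite /mass /moment -integZ// -integB//.
- apply: integ_le; [|by apply: cM; apply: csub => //; exact: ccst|].

    by apply: csub; [exact: cM|apply: cmul => //; exact: ccst].
  move=> x _; rewrite mulrA -mulrBl ler_wpM2r ?(ltW (j0 x))//.
  have := @normr_powR_tangent _ p (f x - k) (f x) p1.
  have e := signed_powE (f x) p1.
  rewrite (mulrBr (p * _)) -(mulrA p _ (f x)) e; lra.
- exact: cM.
- by apply: cmul => //; exact: ccst.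
Qed.

Lemma continuous_moment P f : smooth_step P -> continuous f ->
  continuous (fun k => moment (fun x => f x - k)).
Proof.
move=> hP cf k0; apply/cvgrPdist_lt => e e0.
have [M M0 hM] := bounded_on a b cf.
have cm k : continuous (fun x => signed_pow p (f x - k)).
  by apply: (@continuous_signed_pow (fun x => f x - k)); apply: csub => //; exact: ccst.
set W := integ j a b.
have W0 : 0 < W.
  have ab2 : a < (a + b) / 2 < b by have h := midf_lt ab; rewrite !h.
  by apply: (integ_gt0 (ltW ab) cj _ ab2) => // x _; exact: ltW.
(* Bounds |f - k| on [a, b] for all k within 1 of [k0]. *)
pose A := M + `|k0| + 1.
have A0 : - A <= A.
  have k00 : 0 <= `|k0| by [].
  by rewrite /A; lra.
have eW : 0 < e / (W + 1) by rewrite divr_gt0// addr_gt0.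
have [d d0 hd] := uniform_continuity hP (@signed_pow_continuous _ _ p1) A0 eW.
exists (Num.min d 1); first by rewrite /= lt_min d0 ltr01.
move=> k /=; rewrite lt_min => /andP[kd k1].
rewrite /moment -integB; last 2 first.
- by apply: cmul.
- by apply: cmul.
have le : forall x, a <= x <= b ->
    `|signed_pow p (f x - k0) - signed_pow p (f x - k)| <= e / (W + 1).
  move=> x /hM; rewrite ler_norml => /andP[h1 h2]; apply/ltW/hd.
  - have := ler_norm k0; have := ler_norm (- k0); rewrite normrN /A.
    by move=> ? ?; apply/andP; split; lra.
  - have := ler_norm k0; have := ler_norm (- k0); rewrite normrN /A.
    by move: k1; rewrite ltr_norml => /andP[? ?] ? ?; apply/andP; split; lra.
  - by rewrite (_ : _ - _ = - (k0 - k)) ?normrN//; ring.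
have cd : continuous (fun x => signed_pow p (f x - k0) * j x - signed_pow p (f x - k) * j x).
  by apply: csub; exact: cmul.
have cw (s : R) : continuous (fun x => s * j x) by apply: cmul => //; exact: ccst.
have up : integ (fun x => signed_pow p (f x - k0) * j x - signed_pow p (f x - k) * j x) a b
    <= e / (W + 1) * W.
  rewrite -integZ//; apply: integ_le => //.
  move=> x /le; rewrite ler_norml => /andP[_ h].
  by rewrite -mulrBl ler_wpM2r ?(ltW (j0 x)).
have lo : - (e / (W + 1)) * W <=
    integ (fun x => signed_pow p (f x - k0) * j x - signed_pow p (f x - k) * j x) a b.
  rewrite -integZ//; apply: integ_le => //.
  move=> x /le; rewrite ler_norml => /andP[h _].
  by rewrite -mulrBl ler_wpM2r ?(ltW (j0 x)).
have eWW : e / (W + 1) * W < e.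
  by rewrite mulrAC ltr_pdivrMr ?addr_gt0// mulrDr mulr1 ltrDl.
by rewrite ltr_norml; apply/andP; split; lra.
Qed.

Lemma mass_perturb f h (M e : R) : continuous f -> continuous h ->
  (forall x, a <= x <= b -> `|f x| <= M) ->
  (forall x, a <= x <= b -> `|f x - h x| <= e) ->
  mass f <= mass h + p * M `^ (p - 1) * e * integ j a b.
Proof.
move=> cf ch fM fh.
have cm g : continuous g -> continuous (fun x => `|g x| `^ p * j x).
  by move=> cg; apply: cmul => //; exact: continuous_normr_powR.
have := powR_ge0 M (p - 1); move: (M `^ (p - 1)) (@normr_powR_lipschitz R p M) => C lip C0.
have cw : continuous (fun x => p * C * e * j x) by apply: cmul => //; exact: ccst.
rewrite /mass -integZ// -integD; [|exact: cm|exact: cw].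
apply: integ_le; [exact: cm|by apply: cadd; [exact: cm|exact: cw]|move=> x hx].
rewrite -mulrDl ler_wpM2r ?(ltW (j0 x))// -lerBlDl.
apply: le_trans (lip _ _ p1 (fM x hx)) _.
by apply: ler_wpM2l; [rewrite mulr_ge0 ?(ltW p0)|exact: fh].
Qed.

(** Trial functions may be merely C^1 and of nonzero moment: [g] is approximated by a smooth
    function, integrated, shifted by a constant [c] and cut off. The shift is not known in advance,
    so the mass bound is asked of all translates by constants of bounded size. *)
Lemma Lambda_upper P g F (l m B : R) : smooth_step P -> continuous g ->
  (forall x, der F x (g x)) -> 0 < B -> (forall x, a <= x <= b -> `|F x| <= B) ->
  0 < m -> mass g <= l * m ->
  (forall k, `|k| <= B + (b - a) -> m <= mass (fun x => F x - k)) ->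
  (Lambda_Poi p xi <= l%:E)%E.
Proof.
move=> hP cg dF B0 hB m0 eg mF; have cF := der_cont dF; have ab_ := ab.
have cM f : continuous f -> continuous (fun x => `|f x| `^ p * j x).
  by move=> cf; apply: cmul => //; exact: continuous_normr_powR.
have cw (s : R) : continuous (fun x => s * j x) by apply: cmul => //; exact: ccst.
have [A A0 hA] := bounded_on a b cg.
have [W [W0 WE]] : exists W : R, 0 <= W /\ integ j a b = W.
  by exists (integ j a b); split => //; apply: integ_ge0 => x _; exact: ltW.
have l0 : 0 <= l.
  rewrite -(pmulr_lge0 _ m0); apply: le_trans eg.
  by apply: integ_ge0 => x _; rewrite mulr_ge0 ?powR_ge0// ltW.
(* [C1] and [C2] bound, per unit of [eta], the loss of mass and the gain of energy caused by
   replacing [g] by a function within [eta] of it. *)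
have [C1 [C10 C1E]] : exists C1 : R, 0 <= C1 /\
    p * (B + (B + (b - a))) `^ (p - 1) * (b - a) * W = C1.
  by eexists; split; last reflexivity;
    rewrite !mulr_ge0 ?powR_ge0 ?subr_ge0 ?(ltW ab) ?(ltW p0).
have [C2 [C20 C2E]] : exists C2 : R, 0 <= C2 /\ p * (A + 1) `^ (p - 1) * W = C2.
  by eexists; split; last reflexivity; rewrite !mulr_ge0 ?powR_ge0 ?(ltW p0).
apply/lee_addgt0Pr => e e0; rewrite -EFinD.
have D0 : 0 < C2 + (l + e) * C1 + 1.
  by rewrite ltr_wpDl// addr_ge0// mulr_ge0// addr_ge0// ltW.
have E0 : 0 < 2 * (C1 + 1) by rewrite mulr_gt0// ltr_wpDl.
(* The first product bound makes the perturbed quotient at most l + e, the second keeps the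
   perturbed mass positive. *)
have [eta [eta0 eta1 etaD etaE]] : exists eta : R, [/\ 0 < eta, eta <= 1,
    eta * (C2 + (l + e) * C1 + 1) <= e * m & eta * (2 * (C1 + 1)) <= m].
  exists (Num.min 1 (Num.min (e * m / (C2 + (l + e) * C1 + 1)) (m / (2 * (C1 + 1))))).
  split.
  - by rewrite !lt_min ltr01 !divr_gt0// mulr_gt0.
  - by rewrite ge_min lexx.
  - by rewrite -ler_pdivlMr// ge_min; apply/orP; right; rewrite ge_min lexx.
  - by rewrite -ler_pdivlMr// ge_min; apply/orP; right; rewrite ge_min lexx orbT.
have [G sG GE] := smooth_approximation hP cg (ltW ab) eta0.
have cG := smooth_continuous sG.
have [H0 dH0] := primitive cG.
pose H x := H0 x - (H0 a - F a).
have dH x : der H x (G x).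
  by have := derB (dH0 x) (der_cst (H0 a - F a) x); rewrite subr0.
have sH : smooth H by exact: smooth_intro dH sG.
have cH := smooth_continuous sH.
have HF x : a <= x <= b -> `|H x - F x| <= eta * (b - a).
  move=> /andP[ax xb].
  have Ha : H a = F a by rewrite /H subKr.
  have -> : H x - F x = (H x - F x) - (H a - F a) by rewrite Ha subrr subr0.
  apply: le_trans (_ : eta * (x - a) <= _); last first.
    by apply: ler_wpM2l; [exact: ltW|rewrite lerD2r].
  apply: (@der_norm_le _ (fun y => H y - F y) (fun y => G y - g y)) => //.
  - exact: csub.
  - by move=> y _; apply: derB.
  - by move=> y /andP[ay yx]; apply: GE; rewrite !ltW// (lt_le_trans yx).
have etaba : eta * (b - a) <= b - a by rewrite ler_piMl// subr_ge0 ltW.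
have bH x : a <= x <= b -> `|H x| <= B + (b - a).
  move=> hx; have := HF x hx; have := hB x hx; rewrite !ler_norml.
  by move=> /andP[? ?] /andP[? ?]; apply/andP; split; lra.
pose Q := B + (b - a).
(* |H| <= Q on the interval, so the moment of H - c is nonnegative at c = -Q and nonpositive at c =
   Q. *)
have [c hc mc] : exists2 c : R, - Q <= c <= Q & moment (fun x => H x - c) = 0.
  apply: intermediate_value; [|exact: (continuous_moment hP cH)|right; apply/andP; split].
  + by rewrite /Q; lra.
  + rewrite -oppr_ge0 -mulN1r -integZ; last first.
    * apply: cmul => //; apply: (@continuous_signed_pow (fun x => H x - Q)).
      by apply: csub => //; exact: ccst.
    apply: integ_ge0 => x /bH; rewrite ler_norml => /andP[? ?].
    rewrite mulN1r -mulNr mulr_ge0 ?(ltW (j0 x))// oppr_ge0 signed_pow_le0//.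
    by rewrite /Q; lra.
  + apply: integ_ge0 => x /bH; rewrite ler_norml => /andP[? ?].
    rewrite mulr_ge0 ?(ltW (j0 x))// signed_pow_ge0//.
    by rewrite /Q; lra.
(* The cutoff is 1 on a neighbourhood of [a, b], hence leaves the derivative at the end points
   unchanged too. *)
have [X cX X1] := @exists_cutoff _ P (`|a| + `|b| + 1) hP.
have sX := Cc_infty_smooth cX.
have sHc : smooth (fun x => H x - c) by apply: smoothB => //; exact: smooth_cst.
pose f x := (H x - c) * X x.
have sf : smooth f by exact: smoothM.
have inab x : a <= x <= b -> - (`|a| + `|b| + 1) < x < `|a| + `|b| + 1.
  move=> /andP[? ?]; have := ler_norm b; have := ler_norm (- a); rewrite normrN.
  by have := normr_ge0 a; have := normr_ge0 b => *; apply/andP; split; lra.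
have fE x : a <= x <= b -> f x = H x - c.
  by move=> /inab/andP[? ?]; rewrite /f X1 ?mulr1// !ltW.
have f'E x : a <= x <= b -> derive1 f x = G x.
  move=> /inab hx; apply: (der_derive1 _).2.
  have := derB (dH x) (der_cst c x); rewrite subr0.
  apply: der_near; apply: filterS (near_oo hx) => y /andP[? ?].
  by rewrite /f X1 ?mulr1// !ltW.
have mfE : mass f = mass (fun x => H x - c).
  by apply: eq_integ => x /fE ->.
have efE : mass (derive1 f) = mass G.
  by apply: eq_integ => x /f'E ->.
have momf : moment f = 0.
  by rewrite -mc; apply: eq_integ => x /fE ->.
have le_mass : m - C1 * eta <= mass f.
  rewrite mfE lerBlDr; apply: le_trans (mF c _) _; first by rewrite ler_norml.
  have -> : C1 * eta = p * (B + (B + (b - a))) `^ (p - 1) * (eta * (b - a)) * W.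
    by rewrite -C1E; ring.
  rewrite -WE; apply: mass_perturb.
  - by apply: csub; [exact: cF|exact: ccst].
  - by apply: csub; [exact: cH|exact: ccst].
  - move=> x hx; apply: le_trans (ler_normB _ _) _.
    by apply: lerD; [exact: hB|rewrite ler_norml].
  - move=> x hx; rewrite (_ : _ - _ = - (H x - F x)); last by ring.
    by rewrite normrN; exact: HF.
have le_energy : mass G <= l * m + C2 * eta.
  apply: (@le_trans _ _ (mass g + C2 * eta)); last by rewrite lerD2r.
  have -> : C2 * eta = p * (A + 1) `^ (p - 1) * eta * W by rewrite -C2E; ring.
  rewrite -WE; apply: mass_perturb; [exact: cG|exact: cg| |exact: GE].
  move=> x hx; rewrite -[G x](subrK (g x)) addrC.
  apply: le_trans (ler_normD _ _) _.
  by apply: lerD; [exact: hA|exact: le_trans (GE x hx) eta1].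
have mf0 : 0 < mass f.
  by apply: lt_le_trans le_mass; rewrite subr_gt0 arith_mass.
apply: ge_ereal_inf; exists (poincare_quotient p xi f).
  exists f; last reflexivity; split.
  - have [M M0 hM] := Cc_infty_support cX.
    apply: (@Cc_infty_intro _ _ M sf) => x /hM; rewrite /f => ->; exact: mulr0.
  - apply: contrapT => nf; move: mf0; suff -> : mass f = 0 by rewrite ltxx.
    rewrite /mass -[RHS](mul0r (b - a)) -(integ_cst (ltW ab)).
    apply: eq_integ => x _; have -> : f x = 0.
      by apply/eqP/negPn/negP => fx; apply: nf; exists x.
    by rewrite normr0 powR0 ?mul0r ?gt_eqF.
  - by rewrite (momentE (smooth_continuous sf)) momf.
rewrite (quotientE sf) (gt_eqF mf0) lee_fin (ler_pdivrMr _ _ mf0) efE.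
apply: le_trans le_energy _; apply: le_trans (ler_wpM2l _ le_mass).
  exact: arith_quotient.
exact: (addr_ge0 l0 (ltW e0)).
Qed.

End Lambda.

End weighted_measure.

(** * Dependence on the length of the interval *)

Section domain_monotonicity.
Context {R : realType}.
Implicit Types (f g j F P : R -> R) (p : R).

Lemma ereal_between (l : R) (L : \bar R) : (l%:E < L)%E ->
  exists2 l' : R, l < l' & (l'%:E < L)%E.
Proof.
case: L => [r| |] //; last by exists (l + 1); rewrite ?ltrDl ?ltry.
rewrite lte_fin => lr; exists ((l + r) / 2); first by rewrite (midf_lt lr).
by rewrite lte_fin (midf_lt lr).
Qed.

Lemma integ_eq0 f a b : a <= b -> (forall x, a <= x <= b -> f x = 0) -> integ f a b = 0.
Proof.
move=> ab f0; rewrite -[RHS](mul0r (b - a)) -(integ_cst ab).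
exact: eq_integ.
Qed.

Lemma mass_subset p j f a b a' b' : continuous j -> (forall x, 0 < j x) -> 1 < p ->
  continuous f -> a' <= a -> a <= b -> b <= b' ->
  mass p j a b f <= mass p j a' b' f.
Proof.
move=> cj j0 p1 cf aa ab bb.
have cm : continuous (fun x => `|f x| `^ p * j x).
  by apply: cmul => //; exact: continuous_normr_powR.
have ge0 a1 b1 : 0 <= integ (fun x => `|f x| `^ p * j x) a1 b1.
  by apply: integ_ge0 => x _; rewrite mulr_ge0 ?powR_ge0// ltW.
rewrite /mass (integD_itv cm aa (le_trans ab bb)) (integD_itv cm ab bb).
by rewrite addrCA lerDl addr_ge0.
Qed.

Lemma mass_support p j f a b a' b' : continuous j -> (forall x, 0 < j x) -> 1 < p ->
  continuous f -> a' <= a -> a <= b -> b <= b' ->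
  (forall x, x <= a \/ b <= x -> f x = 0) ->
  mass p j a' b' f = mass p j a b f.
Proof.
move=> cj j0 p1 cf aa ab bb f0; have p0 : p != 0 by rewrite gt_eqF// (lt_trans _ p1).
have cm : continuous (fun x => `|f x| `^ p * j x).
  by apply: cmul => //; exact: continuous_normr_powR.
rewrite /mass (integD_itv cm aa (le_trans ab bb)) (integD_itv cm ab bb).
rewrite (integ_eq0 aa); last first.
  by move=> x /andP[_ xa]; rewrite f0; [rewrite normr0 powR0 ?mul0r|left].
rewrite add0r (@integ_eq0 _ b) ?addr0// => x /andP[bx _].
by rewrite f0; [rewrite normr0 powR0 ?mul0r|right].
Qed.

(** The room between [l] and [l'] absorbs a mass error C eta once eta is small. *)
Let arith_slack (l l' m C : R) : l < l' -> 0 <= l -> 0 < m -> 0 <= C ->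
  exists eta : R, [/\ 0 < eta, eta <= 1, C * eta < m & l * m <= l' * (m - C * eta)].
Proof.
move=> ll l0 m0 C0.
have d1 : 0 < 2 * (C + 1) by lra.
have l'C : 0 <= l' * C by rewrite mulr_ge0// (le_trans l0 (ltW ll)).
have d2 : 0 < l' * C + 1 by lra.
exists (Num.min 1 (Num.min (m / (2 * (C + 1))) ((l' - l) * m / (l' * C + 1)))).
set e1 := m / _; set e2 := _ / (l' * C + 1).
have e10 : 0 < e1 by rewrite divr_gt0.
have e20 : 0 < e2 by rewrite divr_gt0 ?mulr_gt0 ?subr_gt0.
have e1E : e1 * (2 * (C + 1)) = m by rewrite divfK ?gt_eqF.
have e2E : e2 * (l' * C + 1) = (l' - l) * m by rewrite divfK ?gt_eqF.
set e := Num.min _ _.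
have h0 : 0 < e by rewrite !lt_min ltr01 e10.
have h1 : e <= 1 by rewrite ge_min lexx.
have h2 : e <= e1 by rewrite /e !ge_min lexx orbT.
have h3 : e <= e2 by rewrite /e !ge_min lexx !orbT.
have h4 : e * (2 * (C + 1)) <= m by rewrite -e1E ler_wpM2r// ltW.
have h5 : e * (l' * C + 1) <= (l' - l) * m by rewrite -e2E ler_wpM2r// ltW.
have Ce : 0 <= C * e by rewrite mulr_ge0// ltW.
clearbody e e1 e2; clear e10 e20 e1E e2E h2 h3 e1 e2.
split => //; lra.
Qed.

Lemma trapezoid (r eta : R) : 0 < eta -> exists t : R -> R,
  [/\ continuous t, forall x, 0 <= t x <= 1, forall x, r <= `|x| -> t x = 0 &
      forall x, `|x| <= r - eta -> t x = 1].
Proof.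
move=> e0; exists (fun x => Num.max 0 (Num.min 1 ((r - `|x|) / eta))); split.
- apply: cmax; [exact: ccst|apply: cmin; [exact: ccst|]].
  apply: cmul; last exact: ccst.
  by apply: csub; [exact: ccst|exact: norm_continuous].
- by move=> x; rewrite le_max lexx/= ge_max ler01/= ge_min lexx.
- move=> x h; apply/max_idPl; rewrite ge_min; apply/orP; right.
  by rewrite pmulr_lle0 ?invr_gt0// subr_le0.
- move=> x h; rewrite min_l; first by apply/max_idPr; exact: ler01.
  by rewrite ler_pdivlMr// mul1r lerBrDr addrC -lerBrDr.
Qed.

(** The difference F - f vanishes where the factor [t] is 1 and elsewhere changes with slope at most
    [A] along a stretch of length at most [eta]. *)
Lemma truncated_primitive f f' F t (r A eta : R) : 0 < eta -> 0 < A ->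
  (forall x, der f x (f' x)) -> (forall x, der F x (f' x * t x)) -> F 0 = f 0 ->
  (forall x, 0 <= t x <= 1) -> (forall x, `|x| <= r - eta -> t x = 1) ->
  (forall x, - r <= x <= r -> `|f' x| <= A) ->
  forall x, - r <= x <= r -> `|F x - f x| <= A * eta.
Proof.
move=> e0 A0 df dF F0 t01 t1 hA x /andP[h1 h2].
(* Equal to 0 when [eta] exceeds [r] and the plateau is empty; the stretch to be estimated is then
   the whole half interval, still no longer than [eta]. *)
pose z := Num.max 0 (r - eta).
have z0 : 0 <= z by rewrite le_max lexx.
have zr : r - z <= eta by rewrite lerBlDr -lerBlDl le_max lexx orbT.
have dD y : der (fun y => F y - f y) y (f' y * t y - f' y) by exact: derB.
have cD := der_cont dD.
have D0 : F 0 - f 0 = 0 by rewrite F0 subrr.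
have bD k u v : u <= v -> (forall y, u < y < v -> `|f' y * t y - f' y| <= k) ->
    `|(F v - f v) - (F u - f u)| <= k * (v - u).
  by move=> uv; apply: (@der_norm_le _ (fun y => F y - f y)).
have D0z y : - z < y < z -> `|f' y * t y - f' y| <= 0.
  rewrite -ltr_norml /z => yz; rewrite t1 ?mulr1 ?subrr ?normr0//.
  by move: yz; rewrite lt_max ltNge normr_ge0 => /ltW.
have D1 y : - r < y < r -> `|f' y * t y - f' y| <= A.
  move=> /andP[y1 y2]; rewrite -{2}(mulr1 (f' y)) -mulrBr normrM.
  have /andP[t0 t1'] := t01 y.
  rewrite -[leRHS]mulr1; apply: ler_pM => //.
    by apply: hA; rewrite !ltW.
  by rewrite ler0_norm ?subr_le0// opprB gerBl.
have zero u : `|u| <= z -> F u - f u = 0.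
  rewrite ler_norml => /andP[u1 u2]; apply/normr0_eq0/eqP.
  rewrite eq_le normr_ge0 andbT; have [u0|/ltW u0] := leP 0 u.
    have := bD 0 0 u u0; rewrite D0 subr0 mul0r; apply=> y /andP[y1 y2].
    by apply: D0z; rewrite (lt_le_trans y2 u2) (le_lt_trans _ y1)// oppr_le0.
  have := bD 0 u 0 u0; rewrite D0 sub0r normrN mul0r; apply=> y /andP[y1 y2].
  by apply: D0z; rewrite (le_lt_trans u1 y1) (lt_le_trans y2 z0).
have [xz|xz] := leP `|x| z; first by rewrite zero// normr0 mulr_ge0 ?(ltW A0) ?(ltW e0).
have Az u : u <= r -> A * (u - z) <= A * eta.
  by move=> ur; rewrite ler_pM2l// (le_trans _ zr)// lerB.
have zz : `|z| <= z by rewrite ger0_norm.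
have zz' : `|- z| <= z by rewrite normrN.
move: xz; rewrite ltr_normr => /orP[zx|zx].
  have := bD A z x (ltW zx); rewrite (zero z zz) subr0.
  move=> h; apply: le_trans (h _) (Az x h2) => y /andP[y1 y2].
  by apply: D1; rewrite (lt_le_trans y2 h2) andbT (le_lt_trans _ y1)//; lra.
have xz' : x <= - z by rewrite lerNr ltW.
have := bD A x (- z) xz'; rewrite (zero (- z) zz') sub0r normrN.
rewrite (_ : - z - x = - x - z); last by rewrite addrC.
move=> h; apply: le_trans (h _) (Az (- x) _); last by rewrite lerNl.
by move=> y /andP[y1 y2]; apply: D1; rewrite (le_lt_trans h1 y1)//=; lra.
Qed.

Lemma Lambda_domain_monotone p j (r1 r2 : R)
    (xi1 xi2 : {measure set (measurableTypeR R) -> \bar R}) :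
  1 < p -> continuous j -> (forall x, 0 < j x) -> 0 < r1 -> r1 <= r2 ->
  represents xi1 j (- r1) r1 -> represents xi2 j (- r2) r2 ->
  (Lambda_Poi p xi2 <= Lambda_Poi p xi1)%E.
Proof.
move=> p1 cj j0 r10 r12 x1 x2; rewrite leNgt; apply/negP => lt.
have p0 : 0 < p by rewrite (lt_trans _ p1).
have r1r1 : - r1 < r1 by lra.
have r2r2 : - r2 < r2 by lra.
have r21 : - r2 <= - r1 by rewrite lerN2.
have [f [l [cf nf mf m0 [ml lL _]]]] := Lambda_witness p1 j0 x1 lt.
have [l' ll' lL'] := ereal_between lL.
have [P hP] := exists_smooth_step cf nf.
have sf := Cc_infty_smooth cf.
have cf0 := smooth_continuous sf.
have cf1 := smooth_continuous (smooth_derive1 sf).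
have [A A0 hA] := bounded_on (- r1) r1 cf1.
have [B B0 hB] := bounded_on (- r1) r1 cf0.
have [W [W0 WE]] : exists W : R, 0 <= W /\ integ j (- r1) r1 = W.
  by exists (integ j (- r1) r1); split => //; apply: integ_ge0 => x _; exact: ltW.
(* [F] is bounded by B + A, and [Lambda_upper] considers translates by k up to this bound plus the
   length 2 r2; hence |f - k| <= M on [-r1, r1]. *)
pose M := B + (B + A + (r2 + r2)).
have [C [C0 CE]] : exists C : R, 0 <= C /\ p * M `^ (p - 1) * A * W = C.
  by eexists; split; last reflexivity; rewrite !mulr_ge0 ?powR_ge0 ?(ltW p0) ?(ltW A0).
have l0 : 0 <= l.
  rewrite -(pmulr_lge0 _ m0); apply: le_trans ml; exact: mass_ge0.
have [eta [e0 e1 eC el]] := arith_slack ll' l0 m0 C0.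
have [trap [ctrap trap01 trap0 trap1]] := trapezoid r1 e0.
pose g x := derive1 f x * trap x.
have cg : continuous g by exact: cmul.
have [F0 [F00 cF0 dF0]] := prim0 cg.
pose F x := F0 x + f 0.
have dF x : der F x (g x).
  by have := derD (dF0 x) (der_cst (f 0) x); rewrite addr0.
have cF := der_cont dF.
have g0 x : x <= - r1 \/ r1 <= x -> g x = 0.
  move=> h; rewrite /g trap0 ?mulr0//; rewrite ler_normr; case: h => h.
    by rewrite (lerNr r1) h orbT.
  by rewrite h.
have FF0 : F 0 = f 0 by rewrite /F F00 add0r.
have Dabs := @truncated_primitive f (derive1 f) F trap r1 A eta e0 A0
  (fun x => smooth_der x sf) dF FF0 trap01 trap1 hA.
have Aeta : A * eta <= A by rewrite ler_piMr// ltW.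
have Fin x : - r1 <= x <= r1 -> `|F x| <= B + A.
  move=> hx; rewrite -[F x](subrK (f x)); apply: le_trans (ler_normD _ _) _.
  by rewrite addrC; apply: lerD; [exact: hB|exact: le_trans (Dabs x hx) Aeta].
have Fr x : r1 <= x -> F x = F r1.
  by move=> h; apply/esym; apply: der0_cst => // y /andP[y1 _]; rewrite -(g0 y)//; right; exact: ltW.
have Fl x : x <= - r1 -> F x = F (- r1).
  by move=> h; apply: der0_cst => // y /andP[_ y1]; rewrite -(g0 y)//; left; exact: ltW.
have FB x : `|F x| <= B + A.
  have [h1|/ltW h1] := leP x (- r1); first by rewrite Fl// Fin// lexx ltW.
  have [h2|/ltW h2] := leP r1 x; first by rewrite Fr// Fin// lexx ltW.
  by apply: Fin; rewrite h1.
have BA0 : 0 < B + A by rewrite addr_gt0.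
have gm : mass p j (- r2) r2 g <= l' * (mass p j (- r1) r1 f - C * eta).
  apply: le_trans el; apply: le_trans ml.
  rewrite (mass_support cj j0 p1 cg r21 (ltW r1r1) r12 g0).
  apply: integ_le.
  - by apply: cmul => //; exact: continuous_normr_powR.
  - by apply: cmul => //; exact: continuous_normr_powR.
  move=> x _; rewrite ler_wpM2r ?(ltW (j0 x))// ge0_ler_powR ?nnegrE ?(ltW p0)//.
  have /andP[t0 t1] := trap01 x.
  by rewrite /g normrM ler_piMr// ger0_norm.
suff : (Lambda_Poi p xi2 <= l'%:E)%E by rewrite leNgt lL'.
have mC : 0 < mass p j (- r1) r1 f - C * eta by rewrite subr_gt0.
apply: (Lambda_upper p1 cj j0 r2r2 x2 hP cg dF BA0 (fun x _ => FB x) mC gm).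
move=> k hk; rewrite lerBlDr.
have cFk : continuous (fun x => F x - k) by apply: csub; [exact: cF|exact: ccst].
have cfk : continuous (fun x => f x - k) by apply: csub; [exact: cf0|exact: ccst].
apply: le_trans (der_mass_cst p1 cj j0 k cf0 mf) _.
apply: (@le_trans _ _ (mass p j (- r1) r1 (fun x => F x - k) + C * eta)); last first.
  by rewrite lerD2r; exact: (mass_subset cj j0 p1 cFk r21 (ltW r1r1) r12).
have -> : C * eta = p * M `^ (p - 1) * (A * eta) * W by rewrite -CE; ring.
rewrite -WE; apply: mass_perturb => //.
- move=> x hx; apply: le_trans (ler_normB _ _) _; apply: lerD; first exact: hB.
  by move: hk; rewrite opprK.
- move=> x hx; rewrite (_ : _ - _ = - (F x - f x)); last by ring.
  by rewrite normrN; exact: Dabs.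
Qed.

End domain_monotonicity.

(** * The model weights *)

Section model_functions.
Context {R : realType}.
Implicit Types (K h d x dl r : R) (N D : \bar R).

Lemma der_sin_lin k x : der (fun y => sin (k * y)) x (k * cos (k * x)).
Proof.
apply: der_eq (@der_comp _ sin (fun y => k * y) x _ _ (is_derive_sin _) (derZ k (der_id x))) _.
by rewrite mulr1 mulrC.
Qed.

Lemma der_cos_lin k x : der (fun y => cos (k * y)) x (- k * sin (k * x)).
Proof.
apply: der_eq (@der_comp _ cos (fun y => k * y) x _ _ (is_derive_cos _) (derZ k (der_id x))) _.
by rewrite mulr1 mulNr mulrC mulNr.
Qed.

Lemma der_exp_lin k x : der (fun y => expR (k * y)) x (k * expR (k * x)).
Proof.
by apply: der_eq (der_expR (derZ k (der_id x))) _; rewrite mulr1 mulrC.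
Qed.

Lemma der_s_ dl x : der (s_ dl) x (c_ dl x).
Proof.
rewrite /s_ /c_; have [dl0|dl0] := ltP 0 dl.
  have t0 : Num.sqrt dl != 0 by rewrite gt_eqF// sqrtr_gt0.
  apply: der_eq (derM (der_sin_lin _ x) (der_cst (Num.sqrt dl)^-1 x)) _.
  by rewrite mulr0 add0r mulrA mulVf// mul1r.
have [_|dlN0] := eqVneq dl 0; first exact: der_id.
have t0 : Num.sqrt (- dl) != 0.
  by rewrite gt_eqF// sqrtr_gt0 oppr_gt0 lt_neqAle dlN0.
move: (Num.sqrt (- dl)) t0 => t t0.
have d1 := der_exp_lin t x.
have d2 : der (fun y => expR (- (t * y))) x (- t * expR (- (t * x))).
  by have := der_exp_lin (- t) x; rewrite [- t * x]mulNr; apply: der_ext => y; rewrite mulNr.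
have := derZ (2^-1 * t^-1) (derB d1 d2); rewrite (_ : _ * _ = (expR (t * x) + expR (- (t * x))) / 2); last by field; rewrite t0.
by apply: der_ext => y; ring.
Qed.

Lemma der_c_ dl x : der (c_ dl) x (- dl * s_ dl x).
Proof.
rewrite /s_ /c_; have [dl0|dl0] := ltP 0 dl.
  have t0 : Num.sqrt dl != 0 by rewrite gt_eqF// sqrtr_gt0.
  have e : dl = Num.sqrt dl ^+ 2 by rewrite sqr_sqrtr// ltW.
  apply: der_eq (der_cos_lin _ x) _; move: (Num.sqrt dl) t0 e => t t0 ->.
  by field.
have [->|dlN0] := eqVneq dl 0; first by rewrite oppr0 mul0r; exact: der_cst.
have dln : 0 < - dl by rewrite oppr_gt0 lt_neqAle dlN0.
have t0 : Num.sqrt (- dl) != 0 by rewrite gt_eqF// sqrtr_gt0.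
have e : - dl = Num.sqrt (- dl) ^+ 2 by rewrite sqr_sqrtr// ltW.
move: (Num.sqrt (- dl)) t0 e => t t0 ->.
have d1 := der_exp_lin t x.
have d2 : der (fun y => expR (- (t * y))) x (- t * expR (- (t * x))).
  by have := der_exp_lin (- t) x; rewrite [- t * x]mulNr; apply: der_ext => y; rewrite mulNr.
apply: der_eq (der_ext (_ : _ =1 _) (derZ 2^-1 (derD d1 d2))) _ => [y|]; first by ring.
by field; rewrite t0.
Qed.

Lemma s_0 dl : s_ dl 0 = 0.
Proof. by rewrite /s_ !mulr0 sin0 oppr0 subrr !mul0r; case: ifP => // _; case: ifP. Qed.

Lemma c_0 dl : c_ dl 0 = 1.
Proof.
rewrite /c_ !mulr0 cos0 oppr0 expR0; case: ifP => // _; case: ifP => // _.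
by rewrite -mulr2n mulfV.
Qed.

Lemma der_model_base K r h x : der (model_base K r h) x
  (- (K / (r - 1)) * s_ (K / (r - 1)) x + h / (r - 1) * c_ (K / (r - 1)) x).
Proof. by apply: derD; [exact: der_c_|apply: derZ; exact: der_s_]. Qed.

Lemma Dreg_base K (r : R) D h d x : Dreg K r%:E D h d -> - (d / 2) <= x <= d / 2 ->
  0 < model_base K r h x.
Proof.
move=> [_ _ sub] hx; have /sub : `[- (d / 2), d / 2]%classic x by rewrite /= in_itv.
by move=> [I [_ _ _ pos Ix]]; exact: pos.
Qed.

Definition clamp (r x : R) := Num.max (- r) (Num.min r x).

Lemma clamp_continuous r : continuous (clamp r).
Proof. by apply: cmax; [exact: ccst|apply: cmin; [exact: ccst|exact: cidf]]. Qed.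

Lemma clamp_in r x : 0 <= r -> - r <= clamp r x <= r.
Proof.
move=> r0; rewrite /clamp le_max lexx /= ge_max ge_min lexx andbT.
by rewrite (le_trans _ r0)// oppr_le0.
Qed.

Lemma clampK r x : - r <= x <= r -> clamp r x = x.
Proof. by move=> /andP[h1 h2]; rewrite /clamp min_r// max_r. Qed.

Lemma clamp_ext r (f : R -> R) : 0 <= r ->
  (forall x, - r <= x <= r -> {for x, continuous f}) -> continuous (fun x => f (clamp r x)).
Proof.
move=> r0 cf x; apply: (@continuous_comp _ _ _ (clamp r) f); first exact: clamp_continuous.
by apply: cf; exact: clamp_in.
Qed.

(* Freezing [J_] outside [-d/2, d/2] makes it positive and continuous on the
   whole line, without changing the model measure. *)
Definition weight K N h d x := J_ K N h (clamp (d / 2) x).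

Lemma der_J_oo K h x : der (fun x => expR (h * x - K * x ^+ 2 / 2)) x
  ((h - K * x) * expR (h * x - K * x ^+ 2 / 2)).
Proof.
have d1 : der (fun x => h * x - K / 2 * (x * x)) x (h - K * x).
  apply: der_eq (derB (derZ h (der_id x)) (derZ (K / 2) (derM (der_id x) (der_id x)))) _.
  by field.
apply: der_eq (der_ext _ (der_expR d1)) _ => [y|]; first by congr expR; field.
by rewrite mulrC; congr (_ * expR _); field.
Qed.

Lemma J_gt0 K N D h d x : N != -oo%E -> Dreg K N D h d -> - (d / 2) <= x <= d / 2 ->
  0 < J_ K N h x.
Proof.
case: N => [r| |] // _ hD hx; last exact: expR_gt0.
by rewrite /J_ powR_gt0//; exact: Dreg_base hD hx.
Qed.

Lemma J_continuous K N D h d x : N != -oo%E -> Dreg K N D h d ->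
  - (d / 2) <= x <= d / 2 -> {for x, continuous (J_ K N h)}.
Proof.
case: N => [r| |] // _ hD hx; last exact: der_continuous (der_J_oo K h x).
have := der_powR (r - 1) (Dreg_base hD hx) (der_model_base K r h x).
exact: der_continuous.
Qed.

Lemma Dreg_half K N D h d : Dreg K N D h d -> 0 < d / 2.
Proof. by move=> [d0 _ _]; rewrite divr_gt0. Qed.

Lemma weight_gt0 K N D h d x : N != -oo%E -> Dreg K N D h d -> 0 < weight K N h d x.
Proof.
move=> hN hD; apply: (J_gt0 hN hD); apply: clamp_in; exact: ltW (Dreg_half hD).
Qed.

Lemma weight_continuous K N D h d : N != -oo%E -> Dreg K N D h d ->
  continuous (weight K N h d).
Proof.
move=> hN hD; apply: clamp_ext; first exact: ltW (Dreg_half hD).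
by move=> x; exact: (J_continuous hN hD).
Qed.

Lemma weight_represents K N D h d d' : N != -oo%E -> Dreg K N D h d -> d' <= d ->
  represents (model_measure K N h d') (weight K N h d) (- (d' / 2)) (d' / 2).
Proof.
move=> hN hD dd; apply: density_represents; first exact: (weight_continuous hN hD).
move=> x; rewrite /model_density /weight indicE.
case: (boolP (x \in _)) => [|_]; last by rewrite !mulr0.
rewrite inE/= in_itv/= => /andP[h1 h2]; rewrite clampK//.
have d2 : d' / 2 <= d / 2 by rewrite ler_pM2r.
by rewrite (le_trans _ h1) ?lerN2// (le_trans h2).
Qed.

(** One oscillator covers all N in (1, oo]: e = 1/(N-1), with e = 0, c = 1, s = x in the limit N =
    oo. In each case the logarithmic derivative of J is (h c - K s)/(c + h e s), and N > 1 provides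
    e >= 0. *)
Lemma model_system K N : (1 < N)%E -> exists (e : R) (c s : R -> R),
  [/\ 0 <= e, (forall x, der c x (- (K * e) * s x)), (forall x, der s x (c x)),
      (c 0 = 1 /\ s 0 = 0) &
      forall D h d, Dreg K N D h d -> forall x, - (d / 2) <= x <= d / 2 ->
        0 < c x + h * e * s x /\
        der (J_ K N h) x ((h * c x - K * s x) / (c x + h * e * s x) * J_ K N h x)].
Proof.
case: N => [r| |] //; last first.
  move=> _; exists 0, (fun=> 1), (fun x => x); split => //.
  - by move=> x; apply: der_eq (der_cst 1 x) _; rewrite mulr0 oppr0 mul0r.
  - by move=> x; exact: der_id.
  - move=> D h d _ x _; rewrite mulr0 mul0r addr0 ltr01; split => //.
    by apply: der_eq (der_J_oo K h x) _; rewrite mulr1 divr1.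
rewrite lte_fin => r1; have r10 : 0 < r - 1 by rewrite subr_gt0.
have rn : r - 1 != 0 by rewrite gt_eqF.
exists (r - 1)^-1, (c_ (K / (r - 1))), (s_ (K / (r - 1))); split.
- by rewrite invr_ge0 ltW.
- by move=> x; exact: der_c_.
- by move=> x; exact: der_s_.
- by rewrite c_0 s_0.
move=> D h d hD x hx; have y0 := Dreg_base hD hx.
split; first exact: y0.
apply: der_eq (der_powR (r - 1) y0 (der_model_base K r h x)) _.
have yE : model_base K r h x = c_ (K / (r - 1)) x + h * (r - 1)^-1 * s_ (K / (r - 1)) x by [].
rewrite /J_ -yE.
have -> : model_base K r h x `^ (r - 1) =
    model_base K r h x `^ (r - 1 - 1) * model_base K r h x.
  rewrite -[X in _ * X]powRr1 ?ltW// -powRD ?subrK//.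
  by apply/implyP => _; rewrite gt_eqF.
have yn : model_base K r h x != 0 by rewrite gt_eqF.
field; rewrite rn yn //.
Qed.

End model_functions.

(** * Picard iteration for a globally Lipschitz equation *)

Section picard.
Context {R : realType}.
Implicit Types (x t s : R).

Lemma half_expn_ge0 n : 0 <= 2^-1 ^+ n :> R.
Proof. by rewrite exprn_ge0// invr_ge0. Qed.

Lemma half_expn_small (C e : R) : 0 < e -> exists n, C * 2^-1 ^+ n < e.
Proof.
move=> e0; pose n := Num.bound `|C / e|; exists n.
have h1 : C / e < n%:R.
  by apply: le_lt_trans (ler_norm _) _; exact: archi_boundP.
have h2 : (n%:R : R) <= 2 ^+ n.
  by rewrite -natrX ler_nat ltnW// ltn_expl.
rewrite exprVn ltr_pdivrMr ?exprn_gt0// -ltr_pdivrMl// mulrC.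
exact: lt_le_trans h1 h2.
Qed.

Lemma half_expn_le0 (C x : R) : (forall n, x <= C * 2^-1 ^+ n) -> x <= 0.
Proof.
move=> h; rewrite leNgt; apply/negP => x0.
have [n hn] := half_expn_small C x0.
by have := le_lt_trans (h n) hn; rewrite ltxx.
Qed.

(** The error bounds u_n - 2 C 2^-n and u_n + 2 C 2^-n form nested intervals; the limit is the
    infimum of the upper ends. *)
Lemma geometric_limit (u : nat -> R) (C : R) :
  (forall n, `|u n.+1 - u n| <= C * 2^-1 ^+ n) ->
  exists l, forall n, `|l - u n| <= 2 * C * 2^-1 ^+ n.
Proof.
move=> hu; pose v n := u n + 2 * C * 2^-1 ^+ n.
pose w n := u n - 2 * C * 2^-1 ^+ n.
have vd n : v n.+1 <= v n.
  have := hu n; rewrite ler_norml /v exprS => /andP[_ h].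
  by rewrite (_ : 2 * C * (2^-1 * 2^-1 ^+ n) = C * 2^-1 ^+ n); [lra|field].
have wi n : w n <= w n.+1.
  have := hu n; rewrite ler_norml /w exprS => /andP[h _].
  by rewrite (_ : 2 * C * (2^-1 * 2^-1 ^+ n) = C * 2^-1 ^+ n); [lra|field].
have C0 n : 0 <= C * 2^-1 ^+ n by apply: le_trans (hu n).
have wv n : w n <= v n by rewrite /w /v; have := C0 n; lra.
have vm n k : v (n + k)%N <= v n.
  by elim: k => [|k ih]; rewrite ?addn0// addnS (le_trans (vd _)).
have wm n k : w n <= w (n + k)%N.
  by elim: k => [|k ih]; rewrite ?addn0// addnS (le_trans ih).
have wv' n m : w n <= v m.
  have := wm n m; have := vm m n; rewrite addnC => h1 h2.
  exact: le_trans h2 (le_trans (wv _) h1).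
pose S := range v.
have Sn : S !=set0 by exists (v 0%N), 0%N.
have Sb : has_inf S by split => //; exists (w 0%N) => _ [m _ <-].
exists (inf S) => n; rewrite ler_norml; apply/andP; split.
  have : w n <= inf S by apply: lb_le_inf => // _ [m _ <-].
  by rewrite /w; lra.
have : inf S <= v n by apply: ge_inf; [case: Sb|exists n].
by rewrite /v; lra.
Qed.

(** Measured against the weight exp(2 L t), one iteration halves the distance of consecutive
    iterates on all of [0, d], so the interval need not be subdivided. Continuity of [G] along
    continuous curves is what makes the integral operator well defined. *)
Lemma picard (G : R -> R -> R) (L d : R) : 0 < L -> 0 <= d ->
  (forall f : R -> R, continuous f -> continuous (fun t => G t (f t))) ->
  (forall t s s', `|G t s - G t s'| <= L * `|s - s'|) ->
  exists f : R -> R, [/\ continuous f, f 0 = 0 &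
    forall t, 0 <= t <= d -> der f t (G t (f t))].
Proof.
move=> L0 d0 cG lipG.
(* [A] is the integral operator: [A f] is the primitive, vanishing at 0, of [G] along [f]. *)
have /choice[A hA] : forall f : R -> R, exists F : R -> R, continuous f ->
    [/\ F 0 = 0, continuous F & forall t, der F t (G t (f t))].
  move=> f; have [cf|ncf] := pselect (continuous f); last by exists (fun=> 0).
  by have [F hF] := prim0 (cG f cf); exists F.
pose u n := iter n A (fun=> 0).
have cu n : continuous (u n).
  elim: n => [|n ih]; first exact: ccst.
  by have [] := hA _ ih.
have du n t : der (u n.+1) t (G t (u n t)) by have [_ _] := hA _ (cu n); exact.
have u0 n : u n 0 = 0 by case: n => // n; have [] := hA _ (cu n).
have [M M0 hM] := bounded_on 0 d (cu 1%N).
have bound n t : 0 <= t <= d -> `|u n.+1 t - u n t| <= M * 2^-1 ^+ n * expR ((2 * L) * t).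
  elim: n t => [|n ih] t /andP[t0 td].
    rewrite expr0 mulr1 (_ : u 0%N t = 0)// subr0.
    apply: le_trans (hM t _) _; first by rewrite t0.
    by rewrite ler_peMr ?(ltW M0)// -expR0 ler_expR !mulr_ge0// ltW.
  have dE y : der (fun y => M * 2^-1 ^+ n.+1 * expR ((2 * L) * y)) y
      (L * (M * 2^-1 ^+ n * expR ((2 * L) * y))).
    apply: der_eq (derZ _ (der_expR (derZ (2 * L) (der_id y)))) _.
    by rewrite exprS; field.
  have cE := der_cont dE.
  have dD y : der (fun y => u n.+2 y - u n.+1 y) y (G y (u n.+1 y) - G y (u n y)).
    exact: derB.
  have cD := der_cont dD.
  have Dle y : 0 < y < t -> `|G y (u n.+1 y) - G y (u n y)| <=
      L * (M * 2^-1 ^+ n * expR ((2 * L) * y)).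
    move=> /andP[y0 yt]; apply: le_trans (lipG _ _ _) _; rewrite ler_pM2l//.
    by apply: ih; rewrite ltW//= (le_trans (ltW yt)).
  have E0 : 0 <= M * 2^-1 ^+ n.+1 * expR ((2 * L) * 0).
    by rewrite !mulr_ge0 ?expR_ge0 ?half_expn_ge0// ltW.
  have D0 : u n.+2 0 - u n.+1 0 = 0 by rewrite !u0 subrr.
  have k1 := @der_le_le _ _ _ _ _ 0 t t0 cD cE (fun y _ => dD y) (fun y _ => dE y)
    (fun y hy => le_trans (ler_norm _) (Dle y hy)).
  have k2 := @der_le_le _ _ _ _ _ 0 t t0 (copp cD) cE (fun y _ => derN (dD y)) (fun y _ => dE y)
    (fun y hy => le_trans (ler_norm _) (eq_ind_r (fun z => z <= _) (Dle y hy) (normrN _))).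
  move: k1 k2; rewrite D0 oppr0 !subr0 => k1 k2.
  by rewrite ler_norml; apply/andP; split; lra.
pose K := M * expR ((2 * L) * d).
have bound' n t : 0 <= t <= d -> `|u n.+1 t - u n t| <= K * 2^-1 ^+ n.
  move=> /andP[t0 td]; apply: le_trans (bound n t _) _; first by rewrite t0.
  rewrite /K mulrAC ler_wpM2r ?half_expn_ge0// ler_pM2l// ler_expR.
  by rewrite ler_pM2l// mulr_gt0.
(* Freezing the limit outside [0, d] makes it continuous on the line, so that [A] applies to it and
   [A s] is differentiable at the end points as well. *)
pose cl x := Num.max 0 (Num.min d x).
have ccl : continuous cl by apply: cmax; [exact: ccst|apply: cmin; [exact: ccst|exact: cidf]].
have cl_in x : 0 <= cl x <= d by rewrite /cl le_max lexx/= ge_max d0 ge_min lexx.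
have clK x : 0 <= x <= d -> cl x = x.
  by move=> /andP[x0 xd]; rewrite /cl min_r// max_r.
have /choice[s hs] : forall t, exists l : R, forall n, `|l - u n (cl t)| <= 2 * K * 2^-1 ^+ n.
  by move=> t; apply: geometric_limit => n; exact: bound'.
have cs : continuous s.
  move=> t; apply/cvgrPdist_lt => e e0.
  have e3 : 0 < e / 3 by rewrite divr_gt0.
  have [n hn] := half_expn_small (2 * K) e3.
  have [r r0 hr] := continuous_dist (@ccomp _ (u n) cl (cu n) ccl t) e3.
  exists r => // y /=; rewrite distrC => /hr; have := hs t n; have := hs y n.
  rewrite !ler_norml !ltr_norml => /andP[a1 a2] /andP[a3 a4] /andP[a5 a6].
  by apply/andP; split; lra.
have [F0 cF dF] := hA s cs.
exists (A s); split => // t /andP[t0 td].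
suff <- : s t = A s t by [].
have h n : `|A s t - s t| <= (L * (2 * K) * d + 2 * K) * 2^-1 ^+ n.
  have h1 : `|A s t - u n.+1 t| <= L * (2 * K * 2^-1 ^+ n) * (t - 0).
    have := @der_norm_le _ (fun y => A s y - u n.+1 y)
      (fun y => G y (s y) - G y (u n y)) 0 t (L * (2 * K * 2^-1 ^+ n)) t0.
    rewrite F0 u0 subrr (subr0 (_ - _)); apply.
    - exact: csub.
    - by move=> y _; exact: derB.
    - move=> y /andP[y0 yt]; apply: le_trans (lipG _ _ _) _; rewrite ler_pM2l//.
      by have := hs y n; rewrite clK// ltW//= (le_trans (ltW yt)).
  have h2 : `|s t - u n.+1 t| <= 2 * K * 2^-1 ^+ n.+1 by have := hs t n.+1; rewrite clK ?t0.
  have K0 : 0 <= 2 * K * 2^-1 ^+ n.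
    by rewrite !mulr_ge0 ?half_expn_ge0 ?expR_ge0// ltW.
  have h3 : L * (2 * K * 2^-1 ^+ n) * (t - 0) <= L * (2 * K * 2^-1 ^+ n) * d.
    by rewrite subr0 ler_wpM2l// mulr_ge0// ltW.
  have h4 : 2 * K * 2^-1 ^+ n.+1 <= 2 * K * 2^-1 ^+ n by rewrite exprS; lra.
  rewrite (_ : A s t - s t = (A s t - u n.+1 t) - (s t - u n.+1 t)); last by ring.
  apply: le_trans (ler_normB _ _) _.
  rewrite (_ : _ * 2^-1 ^+ n = L * (2 * K * 2^-1 ^+ n) * d + 2 * K * 2^-1 ^+ n); last by ring.
  by apply: lerD; [exact: le_trans h3|exact: le_trans h4].
have /half_expn_le0 : forall n, _ := h.
by rewrite normr_le0 subr_eq0 => /eqP.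
Qed.

End picard.

(** * Inverses of increasing functions *)

Section inverse.
Context {R : realType}.
Implicit Types (f g : R -> R) (x y a b l : R).

Lemma increasing_inverse f : continuous f -> (forall x y, x < y -> f x < f y) ->
  (forall y, exists2 a, f a <= y & exists2 b, y <= f b & a <= b) ->
  exists g : R -> R, [/\ continuous g, forall x, g (f x) = x & forall y, f (g y) = y].
Proof.
move=> cf inc surj.
have /choice[g fg] : forall y, exists x, f x = y.
  move=> y; have [a fa [b fb ab]] := surj y.
  have fab : f a <= y <= f b by rewrite fa.
  by have [c _ fc] := intermediate_value ab cf (or_introl fab); exists c.
have inc' x y : (f x < f y) = (x < y).
  case: (ltgtP x y) => [/inc->//|/inc h|->]; last by rewrite ltxx.
  by rewrite ltNge ltW.
have gf x : g (f x) = x.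
  have := fg (f x); case: (ltgtP (g (f x)) x) => // /inc h e; move: h; rewrite e ltxx //.
exists g; split => // y; apply/cvgrPdist_lt => e e0.
pose x := g y.
have lo : f (x - e) < y by rewrite -[ltRHS]fg inc' gtrBl.
have hi : y < f (x + e) by rewrite -[ltLHS]fg inc' ltrDl.
have yy : f (x - e) < y < f (x + e) by rewrite lo.
apply: filterS (near_oo yy) => z /andP[z1 z2].
have : x - e < g z by rewrite -inc' fg.
have : g z < x + e by rewrite -inc' fg.
by move=> h1 h2; rewrite -/x ltr_norml; apply/andP; split; lra.
Qed.

(** Continuing [f] with slope 1 on both sides of [a, b] turns it into an increasing bijection of the
    line, to which [increasing_inverse] applies. *)
Lemma increasing_inverse_itv f a b : a <= b -> continuous f ->
  (forall x y, a <= x -> x < y -> y <= b -> f x < f y) ->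
  exists g : R -> R, [/\ continuous g, forall x, a <= x <= b -> g (f x) = x,
    forall y, f a <= y <= f b -> a <= g y <= b /\ f (g y) = y,
    forall y, f a < y < f b -> a < g y < b &
    forall x l, a < x < b -> der f x l -> l != 0 -> der g (f x) l^-1].
Proof.
move=> ab cf inc.
pose cl x := Num.max a (Num.min b x).
have ccl : continuous cl by apply: cmax; [exact: ccst|apply: cmin; [exact: ccst|exact: cidf]].
have clK x : a <= x <= b -> cl x = x by move=> /andP[h1 h2]; rewrite /cl min_r// max_r.
have cll x : x <= a -> cl x = a by move=> h; rewrite /cl min_r ?(le_trans h)// max_l.
have clr x : b <= x -> cl x = b by move=> h; rewrite /cl min_l// max_r.
have clin x : a <= cl x <= b by rewrite /cl le_max lexx/= ge_max ab ge_min lexx.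
have clle x y : x <= y -> cl x <= cl y /\ cl y - cl x <= y - x.
  move=> xy; rewrite /cl; split.
    by rewrite ge_max le_max lexx/= le_max le_min !ge_min lexx xy orbT !orbT.
  have [|] := leP b x; have [|] := leP b y => h1 h2; rewrite ?(max_r ab);
    rewrite /Order.max; do ?case: ifPn; rewrite -?leNgt; lra.
pose F x := f (cl x) + (x - cl x).
have cF : continuous F.
  by apply: cadd; [exact: ccomp|apply: csub; [exact: cidf|]].
have inc' x y : a <= x -> x <= y -> y <= b -> f x <= f y.
  by move=> ax; rewrite le_eqVlt => /predU1P[->//|xy] yb; apply/ltW/inc.
have Finc x y : x < y -> F x < F y.
  move=> xy; have [h1 h2] := clle x y (ltW xy).
  have /andP[a1 b1] := clin x; have /andP[a2 b2] := clin y.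
  move: h1; rewrite le_eqVlt /F => /predU1P[->|h1]; first by rewrite ltrD2l ltrD2r.
  by apply: ltr_leD; [exact: inc|lra].
have FE x : a <= x <= b -> F x = f x by move=> h; rewrite /F clK// subrr addr0.
have Fa : F a = f a by rewrite FE ?lexx.
have Fb : F b = f b by rewrite FE ?lexx ?ab.
have fab : f a <= f b by exact: inc'.
have surj y : exists2 u, F u <= y & exists2 v, y <= F v & u <= v.
  exists (a - (`|y| + `|f a|)).
    rewrite /F cll; last by rewrite gerBl addr_ge0.
    have := ler_norm (- y); have := ler_norm (f a); rewrite normrN; lra.
  exists (b + (`|y| + `|f b|)).
    rewrite /F clr; last by rewrite lerDl addr_ge0.
    have := ler_norm y; have := ler_norm (- f b); rewrite normrN; lra.
  have h1 := normr_ge0 y; have h2 := normr_ge0 (f a); have h3 := normr_ge0 (f b).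
  rewrite (le_trans (_ : _ <= a)) ?gerBl ?addr_ge0//.
  by rewrite (le_trans ab)// lerDl addr_ge0.
have [g [cg gF Fg]] := increasing_inverse cF Finc surj.
have Fmono x y : (F x < F y) = (x < y).
  case: (ltgtP x y) => [/Finc->//|/Finc h|->]; last by rewrite ltxx.
  by rewrite ltNge ltW.
have Fmono' x y : (F x <= F y) = (x <= y) by rewrite !leNgt Fmono.
have gin y : f a <= y <= f b -> a <= g y <= b.
  by rewrite -Fa -Fb -[y]Fg !Fmono' !Fg.
exists g; split => //.
- by move=> x h; rewrite -(FE x h) gF.
- by move=> y h; have h' := gin y h; split => //; rewrite -(FE _ h') Fg.
- by move=> y; rewrite -Fa -Fb -[y]Fg !Fmono Fg.
- move=> x l hx df l0.
  have near_in := near_oo hx.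
  apply: is_derive_inverse => //.
    apply: filterS near_in => y /andP[y1 y2].
    by rewrite /= -(FE y) ?gF// !ltW.
  by apply: filterS near_in => y _; exact: cf.
Qed.

End inverse.

(** * The Riccati equation up to a finite level *)

Section riccati.
Context {R : realType}.
Implicit Types (x y t s : R).

Lemma clip_dist (a b x y : R) : a <= b ->
  `|Num.max a (Num.min b x) - Num.max a (Num.min b y)| <= `|x - y|.
Proof.
move=> ab; have le (u v : R) : u <= v ->
    0 <= Num.max a (Num.min b v) - Num.max a (Num.min b u) <= v - u.
  move=> uv; rewrite /Order.max /Order.min.
  by do ?case: ifPn; rewrite -?leNgt => *; apply/andP; split; lra.
case: (leP x y) => [/le|/ltW/le] /andP[h1 h2].
  by rewrite distrC (ger0_norm h1) distrC ger0_norm// (le_trans h1 h2).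
by rewrite (ger0_norm h1) ger0_norm// (le_trans h1 h2).
Qed.

Lemma neg_part_dist x y : `|Num.max (- x) 0 - Num.max (- y) 0| <= `|x - y|.
Proof.
have le (u v : R) : u <= v -> 0 <= Num.max (- u) 0 - Num.max (- v) 0 <= v - u.
  by move=> uv; rewrite /Order.max; do ?case: ifPn; rewrite -?leNgt => *;
    apply/andP; split; lra.
case: (leP x y) => [/le|/ltW/le] /andP[h1 h2].
  by rewrite (ger0_norm h1) distrC ger0_norm// (le_trans h1 h2).
by rewrite distrC (ger0_norm h1) ger0_norm// (le_trans h1 h2).
Qed.

(* If [(J |f'|^(p-2) f')' + l J |f|^(p-2) f = 0] and [t] is the distance to the
   right end, then [s = |f'|^(p-2) f' / (|f|^(p-2) f)] satisfies
   [ds/dt = riccati_rhs p l (J'/J) s]. *)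
Definition riccati_rhs (p l u s : R) := l + u * s + (p - 1) * s `^ (p / (p - 1)).

(** Solutions may blow up, and the power is meant for nonnegative arguments only. Clipping the
    unknown to [0, B] makes the right side globally Lipschitz, and the true equation holds wherever
    f <= B. *)
Lemma riccati_truncated (p l B d : R) (U : R -> R) : 1 < p -> 0 < l -> 0 < B -> 0 < d ->
  continuous U -> exists f : R -> R, [/\ continuous f, f 0 = 0,
    forall t, 0 < t <= d -> 0 < f t &
    forall t, 0 <= t <= d -> f t <= B -> der f t (riccati_rhs p l (U t) (f t))].
Proof.
move=> p1 l0 B0 d0 cU.
have p10 : 0 < p - 1 by rewrite subr_gt0.
pose q := p / (p - 1).
have q1 : 1 < q by rewrite /q ltr_pdivlMr// mul1r gtrBl.
have q0 : 0 < q by rewrite (lt_trans _ q1).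
have [M M0 hM] := bounded_on 0 d cU.
pose V t := U (Num.max 0 (Num.min d t)).
have cV : continuous V.
  by apply: ccomp => //; apply: cmax; [exact: ccst|apply: cmin; [exact: ccst|exact: cidf]].
have VM t : `|V t| <= M.
  by apply: hM; rewrite le_max lexx/= ge_max (ltW d0) ge_min lexx.
have VU t : 0 <= t <= d -> V t = U t.
  by move=> /andP[t0 td]; rewrite /V min_r// max_r.
pose cl x := Num.max 0 (Num.min B x).
have ccl : continuous cl by apply: cmax; [exact: ccst|apply: cmin; [exact: ccst|exact: cidf]].
have cl0 x : 0 <= cl x by rewrite /cl le_max lexx.
have clB x : cl x <= B by rewrite /cl ge_max (ltW B0) ge_min lexx.
pose ng x := Num.max (- x) 0.
have cng : continuous ng by apply: cmax; [apply: copp; exact: cidf|exact: ccst].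
(* The last term acts on negative values only. With it, [G t x + M * x] is positive for every [x],
   so f exp(M t) increases strictly from 0 and [f] is positive after time 0. *)
pose G t x := l + V t * cl x + (p - 1) * `|cl x| `^ q + M * ng x.
pose C := q * B `^ (q - 1).
have C0 : 0 <= C by rewrite mulr_ge0 ?powR_ge0 ?ltW.
have lipq x y : `| `|cl x| `^ q - `|cl y| `^ q| <= C * `|x - y|.
  have h u v : `|cl u| `^ q - `|cl v| `^ q <= C * `|u - v|.
    apply: le_trans (normr_powR_lipschitz (cl v) q1 (_ : `|cl u| <= B)) _.
      by rewrite ger0_norm.
    by rewrite ler_wpM2l// clip_dist// ltW.
  by rewrite ler_norml lerNl opprB h andbT distrC h.
have lipG t x y : `|G t x - G t y| <= (M + (p - 1) * C + M) * `|x - y|.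
  rewrite (_ : G t x - G t y = V t * (cl x - cl y) +
    (p - 1) * (`|cl x| `^ q - `|cl y| `^ q) + M * (ng x - ng y)); last by rewrite /G; ring.
  apply: le_trans (ler_normD _ _) _; rewrite [leRHS]mulrDl; apply: lerD; last first.
    by rewrite normrM (gtr0_norm M0) ler_pM2l// neg_part_dist.
  apply: le_trans (ler_normD _ _) _; rewrite [leRHS]mulrDl; apply: lerD.
    by rewrite normrM; apply: ler_pM => //; rewrite clip_dist// ltW.
  by rewrite normrM (gtr0_norm p10) -mulrA ler_pM2l.
have L0 : 0 < M + (p - 1) * C + M by rewrite addr_gt0// ltr_wpDr// mulr_ge0// ltW.
have cG (f : R -> R) : continuous f -> continuous (fun t => G t (f t)).
  move=> cf; apply: cadd; last by apply: cmul; [exact: ccst|exact: ccomp].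
  apply: cadd; last first.
    apply: cmul; first exact: ccst.
    apply: (@ccomp _ (fun x => `|x| `^ q) (fun t => cl (f t))); last exact: ccomp.
    exact: normr_powR_continuous.
  apply: cadd; first exact: ccst.
  by apply: cmul => //; exact: ccomp.
have [f [cf f0 df]] := picard L0 (ltW d0) cG lipG.
have pos x t : 0 < G t x + M * x.
  have := VM t; rewrite ler_norml => /andP[v1 v2].
  have cq : 0 <= (p - 1) * `|cl x| `^ q by rewrite mulr_ge0 ?powR_ge0 ?ltW.
  rewrite /G; have [x0|x0] := leP x 0.
    have -> : cl x = 0 by rewrite /cl min_r ?(le_trans x0 (ltW B0))// max_l.
    have -> : ng x = - x by rewrite /ng max_l// oppr_ge0.
    rewrite normr0 powR0 ?gt_eqF// !mulr0 !addr0 mulrN; lra.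
  have -> : ng x = 0 by rewrite /ng max_r// oppr_le0 ltW.
  have clx : cl x <= x by rewrite /cl ge_max (ltW x0) ge_min lexx orbT.
  have h1 : M * cl x <= M * x by rewrite ler_pM2l.
  have h2 : 0 <= (V t + M) * cl x by rewrite mulr_ge0//; lra.
  by move: h2; rewrite mulrDl mulr0; lra.
have fpos t : 0 < t <= d -> 0 < f t.
  move=> /andP[t0 td].
  have dE y : der (fun y => expR (M * y)) y (expR (M * y) * M).
    by apply: der_eq (der_expR (derZ M (der_id y))) _; rewrite mulr1.
  have : f 0 * expR (M * 0) < f t * expR (M * t).
    apply: (@der_gt0_lt _ (fun y => f y * expR (M * y))
      (fun y => (G y (f y) + M * f y) * expR (M * y))) => //.
    + by apply: cmul => //; exact: der_cont dE.
    + move=> y /andP[y0 yt]; apply: der_eq (derM (df y _) (dE y)) _.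
        by rewrite ltW//= (le_trans (ltW yt)).
      by ring.
    + by move=> y _; rewrite mulr_gt0 ?expR_gt0.
  by rewrite f0 mul0r pmulr_lgt0 ?expR_gt0.
exists f; split => // t ht fB; apply: der_eq (df t ht) _.
have ft0 : 0 <= f t.
  move: ht => /andP[]; rewrite le_eqVlt => /predU1P[<- _|t0 td]; first by rewrite f0.
  by rewrite ltW// fpos// t0.
have clf : cl (f t) = f t by rewrite /cl min_r// max_r.
have ngf : ng (f t) = 0 by rewrite /ng max_r// oppr_le0.
by rewrite /G clf ngf VU// ger0_norm// mulr0 addr0.
Qed.

End riccati.

(** * Barta's inequality *)

Section barta.
Context {R : realType}.
Implicit Types (x y t a b c r p l : R) (f g u j T s : R -> R).

Lemma continuous_reflect f r : continuous f -> continuous (fun x => f (r - x)).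
Proof. by move=> cf; apply: ccomp => //; apply: csub; [exact: ccst|exact: cidf]. Qed.

Lemma der_reflect f r x l : der f (r - x) l -> der (fun y => f (r - y)) x (- l).
Proof.
move=> df; have d : der (fun y => r - y) x (-1).
  by have := derB (der_cst r x) (der_id x); rewrite sub0r.
by apply: der_eq (@der_comp _ f (fun y => r - y) x _ _ df d) _; rewrite mulrN1.
Qed.

Lemma integ_reflect f a b r : a <= b -> continuous f ->
  integ (fun x => f (r - x)) a b = integ f (r - b) (r - a).
Proof.
move=> ab cf; have [F dF] := primitive cf; have cF := der_cont dF.
have rab : r - b <= r - a by rewrite lerB.
rewrite (integ_prim rab cf cF)//.
have dG x : der (fun y => - F (r - y)) x (f (r - x)).
  by have := derN (der_reflect (dF (r - x))); rewrite opprK.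
rewrite (@integ_prim _ _ _ _ _ ab (continuous_reflect cf) (der_cont dG))//.
by ring.
Qed.

(** The tangent inequality at the point s^(1/(p-1)) u. *)
Lemma riccati_tangent p (s u v : R) : 1 < p -> 0 <= s ->
  p * s * signed_pow p u * v - (p - 1) * s `^ (p / (p - 1)) * `|u| `^ p <= `|v| `^ p.
Proof.
move=> p1 s0; have p10 : 0 < p - 1 by rewrite subr_gt0.
have pn : p - 1 != 0 by rewrite gt_eqF.
set k := s `^ (p - 1)^-1; have k0 : 0 <= k by rewrite powR_ge0.
have := @normr_powR_tangent _ p v (k * u) p1.
rewrite signed_powM// normrM (ger0_norm k0) powRM// /k -!powRrM.
by rewrite mulVf// powRr1// (mulrC (p - 1)^-1) !mulrA.
Qed.

(** A Picone argument: by [riccati_tangent] the derivative of s j |u|^p is at most (|u'|^p - l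
    |u|^p) j, and this product vanishes at [r] because s(0) = 0 and at [c] because u(c) = 0. *)
Lemma barta_right p l j T s u du c r : 1 < p -> continuous j -> (forall x, 0 < j x) ->
  (forall x, c < x < r -> der j x (T x * j x)) -> c <= r ->
  continuous s -> s 0 = 0 -> (forall t, 0 < t < r - c -> 0 <= s t) ->
  (forall t, 0 < t < r - c -> der s t (riccati_rhs p l (T (r - t)) (s t))) ->
  (forall x, der u x (du x)) -> continuous du -> u c = 0 ->
  l * mass p j c r u <= mass p j c r du.
Proof.
move=> p1 cj j0 dj cr cs s0 sp ds duE cdu uc.
have p0 : 0 < p by rewrite (lt_trans _ p1).
have cu := der_cont duE.
have cup := continuous_normr_powR p1 cu.
have cdup := continuous_normr_powR p1 cdu.
have cm : continuous (fun x => `|u x| `^ p * j x) by exact: cmul.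
have cl : continuous (fun x => l * (`|u x| `^ p * j x)) by apply: cmul => //; exact: ccst.
have cdm : continuous (fun x => `|du x| `^ p * j x) by exact: cmul.
rewrite -subr_ge0 /mass -integZ// -integB//.
pose Phi x := s (r - x) * j x * `|u x| `^ p.
have cPhi : continuous Phi.
  by apply: cmul => //; apply: cmul => //; exact: continuous_reflect.
have e : Phi r - Phi c = 0.
  by rewrite /Phi subrr s0 !mul0r uc normr0 powR0 ?gt_eqF// mulr0 subrr.
rewrite -e; apply: (@integ_der_le _ c r cr _ Phi (fun x =>
    (s (r - x) * (T x * j x) + j x * - riccati_rhs p l (T x) (s (r - x))) * `|u x| `^ p
     + s (r - x) * j x * (p * signed_pow p (u x) * du x))) => //.
- exact: csub.
- move=> x /andP[x1 x2].
  have hx : 0 < r - x < r - c by rewrite subr_gt0 x2 ltrD2l ltrN2.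
  have d1 : der (fun y => s (r - y)) x (- riccati_rhs p l (T x) (s (r - x))).
    by have := der_reflect (ds _ hx); rewrite subKr.
  have d2 := dj x; rewrite x1 x2 in d2.
  have d3 := @der_comp _ (fun y => `|y| `^ p) u x _ _ (der_normr_powR (u x) p1) (duE x).
  by apply: der_eq (derM (derM d1 (d2 isT)) d3) _; ring.
- move=> x /andP[x1 x2].
  have hx : 0 < r - x < r - c by rewrite subr_gt0 x2 ltrD2l ltrN2.
  have := ler_wpM2r (ltW (j0 x)) (riccati_tangent (u x) (du x) p1 (sp _ hx)).
  rewrite /riccati_rhs; move: (s (r - x) `^ _) (`|u x| `^ p) (`|du x| `^ p) => *.
  lra.
Qed.

(** The reflection x -> -x of [barta_right]; it changes the sign of the logarithmic derivative
    [T]. *)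
Lemma barta_left p l j T s u du c r : 1 < p -> continuous j -> (forall x, 0 < j x) ->
  (forall x, - r < x < c -> der j x (T x * j x)) -> - r <= c ->
  continuous s -> s 0 = 0 -> (forall t, 0 < t < r + c -> 0 <= s t) ->
  (forall t, 0 < t < r + c -> der s t (riccati_rhs p l (- T (t - r)) (s t))) ->
  (forall x, der u x (du x)) -> continuous du -> u c = 0 ->
  l * mass p j (- r) c u <= mass p j (- r) c du.
Proof.
move=> p1 cj j0 dj cr cs s0 sp ds duE cdu uc.
have cu := der_cont duE.
have cr' : - c <= r by rewrite lerNl.
have neg f x : f (0 - x) = f (- x) by rewrite sub0r.
have := @barta_right p l (fun x => j (0 - x)) (fun x => - T (- x)) s (fun x => u (0 - x))
  (fun x => - du (0 - x)) (- c) r p1 (continuous_reflect cj) (fun x => j0 _) _ cr' cs s0.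
have mE f : continuous f -> mass p (fun x => j (0 - x)) (- c) r (fun x => f (0 - x)) =
    mass p j (- r) c f.
  move=> cf; rewrite /mass (@integ_reflect (fun x => `|f x| `^ p * j x) (- c) r 0)//.
    by rewrite !sub0r opprK.
  by apply: cmul => //; exact: continuous_normr_powR.
have mE' : mass p (fun x => j (0 - x)) (- c) r (fun x => - du (0 - x)) = mass p j (- r) c du.
  by rewrite -(mE du cdu) /mass; apply: eq_integ => x _; rewrite normrN.
rewrite mE// mE'; apply.
- move=> x /andP[x1 x2].
  have hx : - r < 0 - x < c by rewrite sub0r ltrN2 x2 ltrNl.
  by apply: der_eq (der_reflect (dj _ hx)) _; rewrite sub0r mulNr.
- by rewrite opprK; exact: sp.
- move=> t; rewrite opprK => ht; apply: der_eq (ds t ht) _.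
  by congr riccati_rhs; congr (- T _); ring.
- by move=> x; exact: der_reflect (duE _).
- by apply: copp; exact: continuous_reflect.
- by rewrite sub0r opprK.
Qed.

(** A test function of zero moment may be replaced by f - f(c), which has no smaller mass by
    [der_mass_cst] and vanishes at the common end of the two halves. *)
Lemma Lambda_barta p l j T s1 s4 (xi : {measure set (measurableTypeR R) -> \bar R}) r c :
  1 < p -> 0 <= l -> continuous j -> (forall x, 0 < j x) -> represents xi j (- r) r ->
  (forall x, - r < x < r -> der j x (T x * j x)) -> - r <= c <= r ->
  continuous s1 -> s1 0 = 0 -> (forall t, 0 < t < r - c -> 0 <= s1 t) ->
  (forall t, 0 < t < r - c -> der s1 t (riccati_rhs p l (T (r - t)) (s1 t))) ->
  continuous s4 -> s4 0 = 0 -> (forall t, 0 < t < r + c -> 0 <= s4 t) ->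
  (forall t, 0 < t < r + c -> der s4 t (riccati_rhs p l (- T (t - r)) (s4 t))) ->
  (l%:E <= Lambda_Poi p xi)%E.
Proof.
move=> p1 l0 cj j0 xij dj /andP[c1 c2] cs1 s10 s1p ds1 cs4 s40 s4p ds4.
apply: (Lambda_lower p1 j0 xij) => f sf mf.
have cf := smooth_continuous sf.
have cdf := smooth_continuous (smooth_derive1 sf).
apply: le_trans (ler_wpM2l l0 (der_mass_cst p1 cj j0 (f c) cf mf)) _.
pose u x := f x - f c.
have du x : der u x (derive1 f x).
  by have := derB (smooth_der x sf) (der_cst (f c) x); rewrite subr0.
have uc : u c = 0 by rewrite /u subrr.
have cu := der_cont du.
have split_mass g : continuous g ->
    mass p j (- r) r g = mass p j (- r) c g + mass p j c r g.
  move=> cg; apply: integD_itv => //; apply: cmul => //; exact: continuous_normr_powR.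
rewrite -/(u) (split_mass u cu) (split_mass _ cdf) mulrDr; apply: lerD.
  apply: (@barta_left p l j T s4 u (derive1 f) c r) => //.
  by move=> x /andP[x1 x2]; apply: dj; rewrite x1 (lt_le_trans x2 c2).
apply: (@barta_right p l j T s1 u (derive1 f) c r) => //.
by move=> x /andP[x1 x2]; apply: dj; rewrite x2 (le_lt_trans c1 x1).
Qed.

End barta.

(** * The rational identity behind the comparison *)

Section interpolation_algebra.
Context {R : realType}.
Implicit Types (Y D Z k c s e E m : R).

(** The fractions with Y are the slopes of the inverse functions t1 and t4 for [h2], the one with Z
    is the reciprocal of the Riccati right side for [h1], and k Y / Z is the derivative of the
    contraction v. The difference factors through Z^2 - k^2 Y^2, which is 1 - k^2 in the
    application. *)
Lemma interpolation_identity Y D Z k c s e E m :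
  Z != 0 -> Y * E + D * m != 0 -> Y * E - D * m != 0 -> Z * E + k * D * m != 0 ->
  ((Y * c + e * D * s) / (Y * E + D * m) + (Y * c - e * D * s) / (Y * E - D * m)) / 2
  - k * Y / Z * (((Y * c - e * D * s) / (Y * E - D * m)
                  - (Y * c + e * D * s) / (Y * E + D * m)) / 2)
  - (Z * c + e * (k * D) * s) / (Z * E + k * D * m) =
  (Z ^+ 2 - k ^+ 2 * Y ^+ 2) * (c * m - e * s * E) * D ^+ 2 * m /
    (Z * (Y * E + D * m) * (Y * E - D * m) * (Z * E + k * D * m)).
Proof. by move=> Z0 L1 L4 Lz; field; rewrite Z0 L1 L4 Lz. Qed.

Lemma interpolation_ineq Y D Z k c s e E m : 0 < Y -> 0 < Z ->
  0 < Y * E + D * m -> 0 < Y * E - D * m -> Z ^+ 2 = 1 - k ^+ 2 + k ^+ 2 * Y ^+ 2 ->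
  k ^+ 2 <= 1 -> 0 <= m -> 0 < c * m - e * s * E ->
  0 < Z * E + k * D * m /\
  (Z * c + e * (k * D) * s) / (Z * E + k * D * m) <=
  ((Y * c + e * D * s) / (Y * E + D * m) + (Y * c - e * D * s) / (Y * E - D * m)) / 2
  - k * Y / Z * (((Y * c - e * D * s) / (Y * E - D * m)
                  - (Y * c + e * D * s) / (Y * E + D * m)) / 2).
Proof.
move=> Y0 Z0 L1 L4 ZE k1 m0 sig.
have E0 : 0 < E.
  have : 0 < 2 * (Y * E) by lra.
  by rewrite !pmulr_rgt0.
(* The product of the conjugate factors is (1 - k^2) E^2 plus k^2 times the product of the two given
   positive denominators, and their sum 2 Z E is positive; so each factor is positive. *)
have LzLz : 0 < (Z * E + k * D * m) * (Z * E - k * D * m).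
  have -> : (Z * E + k * D * m) * (Z * E - k * D * m) =
      (Z ^+ 2 - k ^+ 2 * Y ^+ 2) * E ^+ 2
      + k ^+ 2 * ((Y * E + D * m) * (Y * E - D * m)) by ring.
  rewrite ZE addrK.
  have [k11|k11] := eqVneq (k ^+ 2) 1.
    by rewrite k11 subrr mul0r add0r mul1r mulr_gt0.
  have k2 : 0 < 1 - k ^+ 2 by rewrite subr_gt0 lt_neqAle k11.
  apply: ltr_pwDl; first by rewrite mulr_gt0 ?exprn_gt0.
  by apply: mulr_ge0; [exact: sqr_ge0|exact: ltW (mulr_gt0 L1 L4)].
have ZE0 : 0 < Z * E by rewrite mulr_gt0.
have Lz : 0 < Z * E + k * D * m.
  rewrite ltNge; apply/negP => h; move: LzLz.
  have h' : 0 <= Z * E - k * D * m by lra.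
  by rewrite ltNge mulr_le0_ge0.
split => //; rewrite -subr_ge0 interpolation_identity ?gt_eqF//.
have n1 : 0 <= Z ^+ 2 - k ^+ 2 * Y ^+ 2 by rewrite ZE addrK subr_ge0.
apply: divr_ge0; first by do 3 (apply: mulr_ge0; last by [exact: m0|exact: sqr_ge0|exact: ltW sig]).
by rewrite !mulr_ge0 ?(ltW Z0) ?(ltW L1) ?(ltW L4) ?(ltW Lz).
Qed.

End interpolation_algebra.

(** * The oscillator c, s and its addition theorems *)

Section oscillator.
Context {R : realType}.
Variables (K e : R) (c s : R -> R).
Hypotheses (dc : forall x, der c x (- (K * e) * s x)) (ds : forall x, der s x (c x)).
Hypotheses (c0 : c 0 = 1) (s0 : s 0 = 0).
Implicit Types (x u v w h M : R).

(* For the model weights [e = 1/(N-1)] (0 if N is infinite), [osc_y h] is the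
   base of J, and [osc_d h / osc_y h] is its logarithmic derivative. *)
Definition osc_y h x := c x + h * e * s x.
Definition osc_d h x := h * c x - K * s x.

Lemma der_osc_y h x : der (osc_y h) x (e * osc_d h x).
Proof.
by apply: der_eq (derD (dc x) (derZ (h * e) (ds x))) _; rewrite /osc_d; ring.
Qed.

Lemma der_osc_d h x : der (osc_d h) x (- K * osc_y h x).
Proof.
by apply: der_eq (derB (derZ h (dc x)) (derZ K (ds x))) _; rewrite /osc_y; ring.
Qed.

Lemma osc_pythagoras x : c x ^+ 2 + K * e * s x ^+ 2 = 1.
Proof.
pose f x := c x * c x + K * e * (s x * s x).
have df y : der f y 0.
  apply: der_eq (derD (derM (dc y) (dc y)) (derZ (K * e) (derM (ds y) (ds y)))) _.
  by ring.
have cf := der_cont df.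
have f0 : f 0 = 1 by rewrite /f c0 s0 mulr0 mulr0 addr0 mulr1.
rewrite -f0 /f -!expr2; have [x0|/ltW x0] := leP 0 x.
  by apply/esym; exact: (@der0_cst _ f 0 x).
exact: (@der0_cst _ f x 0).
Qed.

(** The pair (a, b) solves the linear system of the oscillator in the time v. Applying the inverse
    fundamental matrix at v gives A and B, which are constant, hence 0; [osc_pythagoras] recovers a
    and b. *)
Lemma osc_unique (a b v w : R -> R) (r : R) : continuous a -> continuous b -> continuous v ->
  a 0 = 0 -> b 0 = 0 ->
  (forall x, - r < x < r -> der v x (w x)) ->
  (forall x, - r < x < r -> der a x (e * b x * w x)) ->
  (forall x, - r < x < r -> der b x (- K * a x * w x)) ->
  forall x, - r <= x <= r -> a x = 0 /\ b x = 0.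
Proof.
move=> ca cb cv a0 b0 dv da db x hx.
have cc := der_cont dc; have cs := der_cont ds.
pose A x := c (v x) * a x - e * (s (v x) * b x).
pose B x := K * (s (v x) * a x) + c (v x) * b x.
have cA : continuous A.
  by apply: csub; [|apply: cmul; [exact: ccst|]]; apply: cmul => //; exact: ccomp.
have cB : continuous B.
  by apply: cadd; [apply: cmul; [exact: ccst|]|]; apply: cmul => //; exact: ccomp.
have dcv y : - r < y < r -> der (fun y => c (v y)) y (- (K * e) * s (v y) * w y).
  by move=> /dv; exact: der_comp (dc _).
have dsv y : - r < y < r -> der (fun y => s (v y)) y (c (v y) * w y).
  by move=> /dv; exact: der_comp (ds _).
have dA y : - r < y < r -> der A y 0.
  move=> hy; apply: der_eq (derB (derM (dcv y hy) (da y hy))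
    (derZ e (derM (dsv y hy) (db y hy)))) _.
  by ring.
have dB y : - r < y < r -> der B y 0.
  move=> hy; apply: der_eq (derD (derZ K (derM (dsv y hy) (da y hy)))
    (derM (dcv y hy) (db y hy))) _.
  by ring.
have const f : continuous f -> (forall y, - r < y < r -> der f y 0) -> f x = f 0.
  move=> cf df; move: hx => /andP[x1 x2].
  have [x0|/ltW x0] := leP 0 x; [apply/esym|]; apply: der0_cst => // y /andP[y1 y2]; apply: df.
    by rewrite (lt_le_trans y2 x2) andbT (le_lt_trans _ y1)// oppr_le0 (le_trans x0).
  by rewrite (le_lt_trans x1 y1) (lt_le_trans y2)// -oppr_le0 (le_trans x1).
have Ax : A x = 0 by rewrite (const A)// /A a0 b0 !mulr0 subrr.
have Bx : B x = 0 by rewrite (const B)// /B a0 b0 !mulr0 addr0.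
have py := osc_pythagoras (v x).
split.
  have -> : a x = (c (v x) ^+ 2 + K * e * s (v x) ^+ 2) * a x by rewrite py mul1r.
  have -> : (c (v x) ^+ 2 + K * e * s (v x) ^+ 2) * a x =
    c (v x) * A x + e * s (v x) * B x by rewrite /A /B; ring.
  by rewrite Ax Bx !mulr0 addr0.
have -> : b x = (c (v x) ^+ 2 + K * e * s (v x) ^+ 2) * b x by rewrite py mul1r.
have -> : (c (v x) ^+ 2 + K * e * s (v x) ^+ 2) * b x =
  c (v x) * B x - K * s (v x) * A x by rewrite /A /B; ring.
by rewrite Ax Bx !mulr0 subrr.
Qed.

Lemma osc_unique_id (a b : R -> R) : a 0 = 0 -> b 0 = 0 ->
  (forall x, der a x (e * b x)) -> (forall x, der b x (- K * a x)) ->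
  forall x, a x = 0 /\ b x = 0.
Proof.
move=> a0 b0 da db x.
apply: (@osc_unique a b (fun x => x) (fun=> 1) `|x| (der_cont da) (der_cont db)) => //.
- exact: cidf.
- by move=> y _; exact: der_id.
- by move=> y _; rewrite mulr1.
- by move=> y _; rewrite mulr1.
- by rewrite -ler_norml.
Qed.

Lemma der_shift (f : R -> R) u x l : der f (u + x) l -> der (fun y => f (u + y)) x l.
Proof.
move=> df; have d : der (fun y => u + y) x 1.
  by have := derD (der_cst u x) (der_id x); rewrite add0r.
by apply: der_eq (@der_comp _ f (fun y => u + y) x _ _ df d) _; rewrite mulr1.
Qed.

(** As functions of M both sides solve the same linear system with the same values at 0. *)
Lemma osc_add h u M : osc_y h (u + M) = osc_y h u * c M + e * osc_d h u * s M /\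
  osc_d h (u + M) = osc_d h u * c M - K * osc_y h u * s M.
Proof.
have [||x|x|h1 h2] := @osc_unique_id
  (fun x => osc_y h (u + x) - (osc_y h u * c x + e * osc_d h u * s x))
  (fun x => osc_d h (u + x) - (osc_d h u * c x - K * osc_y h u * s x)) _ _ _ _ M.
- by rewrite addr0 c0 s0 mulr0 addr0 mulr1 subrr.
- by rewrite addr0 c0 s0 mulr0 subr0 mulr1 subrr.
- apply: der_eq (derB (der_shift (der_osc_y h (u + x)))
    (derD (derZ (osc_y h u) (dc x)) (derZ (e * osc_d h u) (ds x)))) _.
  by ring.
- apply: der_eq (derB (der_shift (der_osc_d h (u + x)))
    (derB (derZ (osc_d h u) (dc x)) (derZ (K * osc_y h u) (ds x)))) _.
  by ring.
by split; apply/eqP; rewrite -subr_eq0; apply/eqP.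
Qed.

Lemma osc_even x : c (- x) = c x.
Proof.
have dn (f : R -> R) l y : der f (- y) l -> der (fun y => f (- y)) y (- l).
  move=> df; have dN := derN (der_id y).
  by apply: der_eq (@der_comp _ f (fun y => - y) y _ _ df dN) _; rewrite mulrN1.
(* The factor [K] fits the system but hides the oddness of [s] when K = 0, which is why [osc_odd] is
   proved separately. *)
have [||y|y|h1 _] := @osc_unique_id (fun x => c (- x) - c x)
  (fun x => K * s (- x) + K * s x) _ _ _ _ x.
- by rewrite oppr0 subrr.
- by rewrite oppr0 s0 mulr0 addr0.
- by apply: der_eq (derB (dn _ _ _ (dc (- y))) (dc y)) _; ring.
- by apply: der_eq (derD (derZ K (dn _ _ _ (ds (- y)))) (derZ K (ds y))) _; ring.
by apply/eqP; rewrite -subr_eq0; apply/eqP.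
Qed.

Lemma osc_odd x : s (- x) = - s x.
Proof.
have df y : der (fun x => s (- x) + s x) y 0.
  have d1 := @der_comp _ s (fun y => - y) y _ _ (ds (- y)) (derN (der_id y)).
  by apply: der_eq (derD d1 (ds y)) _; rewrite osc_even; ring.
have cf := der_cont df.
have f0 : s (- 0) + s 0 = 0 by rewrite oppr0 s0 addr0.
suff : s (- x) + s x = 0 by move/eqP; rewrite addr_eq0 => /eqP.
rewrite -f0; have [x0|/ltW x0] := leP 0 x.
  by apply/esym; exact: (@der0_cst _ (fun x => s (- x) + s x)).
exact: (@der0_cst _ (fun x => s (- x) + s x)).
Qed.

Lemma osc_sub h u M : osc_y h (u - M) = osc_y h u * c M - e * osc_d h u * s M /\
  osc_d h (u - M) = osc_d h u * c M + K * osc_y h u * s M.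
Proof.
have [-> ->] := osc_add h u (- M).
by rewrite osc_even osc_odd !mulrN opprK.
Qed.

Lemma osc_sum h x : osc_y h x + osc_y h (- x) = 2 * c x.
Proof. by rewrite /osc_y osc_even osc_odd; ring. Qed.

(** v is obtained by integrating v' = k y_h2 / Z instead of inverting y_h1. The pair (Z, k d_h2)
    then satisfies the oscillator system in the time v, and at 0 it has the values of (y_h1, d_h1)
    because h1 = k h2; so [osc_unique] identifies the pairs. The contraction property is k^2 y_h2^2
    <= Z^2. *)
Lemma osc_contraction h1 h2 k r : h1 = k * h2 -> k ^+ 2 <= 1 -> 0 < r ->
  (forall x, - r <= x <= r -> 0 < osc_y h2 x) ->
  exists v Z : R -> R, [/\ continuous v /\ v 0 = 0,
    forall x, - r <= x <= r -> 0 < Z x /\ Z x ^+ 2 = 1 - k ^+ 2 + k ^+ 2 * osc_y h2 x ^+ 2,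
    forall x, - r < x < r -> der v x (k * osc_y h2 x / Z x),
    forall x, - r <= x <= r -> osc_y h1 (v x) = Z x /\ osc_d h1 (v x) = k * osc_d h2 x &
    forall x, - r <= x <= r -> `|v x| <= `|x|].
Proof.
move=> h12 k1 r0 ypos; have r_ge0 := ltW r0.
have cy := der_cont (der_osc_y h2); have cd := der_cont (der_osc_d h2).
pose cl x := Num.max (- r) (Num.min r x).
have ccl : continuous cl by apply: cmax; [exact: ccst|apply: cmin; [exact: ccst|exact: cidf]].
have clin x : - r <= cl x <= r.
  by rewrite /cl le_max lexx/= ge_max ge_min lexx andbT (le_trans _ r_ge0)// oppr_le0.
have clK x : - r <= x <= r -> cl x = x by move=> /andP[x1 x2]; rewrite /cl min_r// max_r.
(* Freezing the base outside [-r, r] keeps it positive there, so that Z > 0 and v are defined on the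
   whole line. *)
pose y x := osc_y h2 (cl x).
have y0 x : 0 < y x by exact: ypos.
have cyc : continuous y by exact: ccomp.
pose q x := 1 - k ^+ 2 + k ^+ 2 * y x ^+ 2.
have q0 x : 0 < q x.
  rewrite /q; have [->|k11] := eqVneq (k ^+ 2) 1.
    by rewrite subrr add0r mul1r exprn_gt0.
  have k2 : 0 < 1 - k ^+ 2 by rewrite subr_gt0 lt_neqAle k11.
  by rewrite ltr_pwDl// mulr_ge0 ?sqr_ge0.
have cq : continuous q.
  apply: cadd; first exact: ccst.
  apply: cmul; first exact: ccst.
  by rewrite (_ : (fun x => _) = fun x => y x * y x);
    [exact: cmul|apply/funext => x; rewrite expr2].
pose Z x := Num.sqrt (q x).
have Z0 x : 0 < Z x by rewrite sqrtr_gt0.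
have cZ : continuous Z by apply: (@ccomp _ Num.sqrt) => //; exact: sqrt_continuous.
have Z2 x : Z x ^+ 2 = q x by rewrite sqr_sqrtr// ltW.
have cw : continuous (fun x => k * y x / Z x).
  apply: cmul; first by apply: cmul => //; exact: ccst.
  by apply: cinv => // x; rewrite gt_eqF.
have [v [v0 cv dv]] := prim0 cw.
have dv' x : - r < x < r -> der v x (k * osc_y h2 x / Z x).
  move=> /andP[x1 x2]; have := dv x; rewrite /y clK//.
  by rewrite !ltW.
have Zr x : - r <= x <= r -> Z x ^+ 2 = 1 - k ^+ 2 + k ^+ 2 * osc_y h2 x ^+ 2.
  by move=> hx; rewrite Z2 /q /y clK.
have dZ x : - r < x < r -> der Z x (e * (k * osc_d h2 x) * (k * osc_y h2 x / Z x)).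
  move=> hx; have hx' : - r <= x <= r by case/andP: hx => *; rewrite !ltW.
  pose q' x := 1 - k ^+ 2 + k ^+ 2 * (osc_y h2 x * osc_y h2 x).
  have dq' : der q' x (0 + k ^+ 2 * (osc_y h2 x * (e * osc_d h2 x) + osc_y h2 x * (e * osc_d h2 x))).
    by apply: derD; [exact: der_cst|apply: derZ; apply: derM; exact: der_osc_y].
  have dq : der q x (0 + k ^+ 2 * (osc_y h2 x * (e * osc_d h2 x) + osc_y h2 x * (e * osc_d h2 x))).
    apply: der_near dq'; apply: filterS (near_oo hx) => z /andP[z1 z2].
    by rewrite /q /q' /y clK ?expr2// !ltW.
  apply: der_eq (@der_comp _ Num.sqrt q x _ _ (is_derive1_sqrt (q0 x)) dq) _.
  have ZN : Num.sqrt (q x) != 0 by rewrite gt_eqF// Z0.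
  by rewrite /Z; field.
have osc := @osc_unique (fun x => osc_y h1 (v x) - Z x) (fun x => osc_d h1 (v x) - k * osc_d h2 x)
  v (fun x => k * osc_y h2 x / Z x) r.
exists v, Z; split => //.
- by move=> x hx; rewrite Z0 Zr.
- move=> x hx; have [||||||||h3 h4] := osc _ _ _ _ _ _ _ _ x hx.
  + apply: csub => //; apply: ccomp => //; exact: der_cont (der_osc_y h1).
  + apply: csub; first by apply: ccomp => //; exact: der_cont (der_osc_d h1).
    by apply: cmul => //; exact: ccst.
  + by [].
  + have Z00 : Z 0 = 1.
      rewrite /Z /q /y clK; last by rewrite r_ge0 oppr_le0 r_ge0.
      by rewrite /osc_y c0 s0 mulr0 addr0 expr1n mulr1 subrK sqrtr1.
    by rewrite v0 Z00 /osc_y c0 s0 mulr0 addr0 subrr.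
  + by rewrite v0 /osc_d c0 s0 !mulr0 !subr0 !mulr1 h12 subrr.
  + exact: dv'.
  + move=> z hz; apply: der_eq (derB (@der_comp _ (osc_y h1) v z _ _ (der_osc_y h1 _) (dv' z hz)) (dZ z hz)) _.
    by ring.
  + move=> z hz; apply: der_eq (derB (@der_comp _ (osc_d h1) v z _ _ (der_osc_d h1 _) (dv' z hz)) (derZ k (der_osc_d h2 z))) _.
    have ZN : Z z != 0 by rewrite gt_eqF.
    by field.
  by split; apply/eqP; rewrite -subr_eq0; apply/eqP.
- move=> x hx.
  have wle z : `|k * y z / Z z| <= 1.
    rewrite normrM normfV (gtr0_norm (Z0 z)) ler_pdivrMr// mul1r.
    rewrite -ler_sqr ?nnegrE ?(ltW (Z0 z))// real_normK ?num_real// Z2 /q exprMn.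
    by rewrite lerDr subr_ge0.
  have [x0|/ltW x0] := leP 0 x.
    rewrite (ger0_norm x0); have := @der_norm_le _ v _ 0 x 1 x0 cv (fun z _ => dv z) (fun z _ => wle z).
    by rewrite v0 !subr0 mul1r.
  have := @der_norm_le _ v _ x 0 1 x0 cv (fun z _ => dv z) (fun z _ => wle z).
  by rewrite v0 sub0r normrN mul1r sub0r (ler0_norm x0).
Qed.

End oscillator.

(** * Interpolation between two slopes *)

Section interpolation.
Context {R : realType}.
Variables (K e : R) (c s : R -> R).
Hypotheses (dc : forall x, der c x (- (K * e) * s x)) (ds : forall x, der s x (c x)).
Hypotheses (c0 : c 0 = 1) (s0 : s 0 = 0) (e0 : 0 <= e).
Implicit Types (x u v w h M t l r p sg : R).

Local Notation y := (osc_y e c s).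
Local Notation d := (osc_d K c s).

Definition osc_T h x := d h x / y h x.

(** K y^2 + e d^2 is constant, equal to K + e h^2. So [osc_T] is monotone in a direction that
    depends on K, e and h only, as [riccati_curve] requires. *)
Lemma der_osc_T h x : y h x != 0 ->
  der (osc_T h) x (- (K + e * h ^+ 2) * (y h x) ^- 2).
Proof.
move=> y0; apply: der_eq (derM (der_osc_d dc ds h x) (derV y0 (der_osc_y dc ds h x))) _.
have e1 : K * y h x ^+ 2 + e * d h x ^+ 2 = K + e * h ^+ 2.
  rewrite -[RHS]mulr1 -(osc_pythagoras dc ds c0 s0 x) /osc_y /osc_d; ring.
rewrite -e1; field; exact: y0.
Qed.

(** y(x) + y(-x) = 2 c(x), and the interval is symmetric. *)
Lemma osc_c_gt0 h r x : (forall x, - r <= x <= r -> 0 < y h x) -> - r <= x <= r -> 0 < c x.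
Proof.
move=> hy /andP[x1 x2]; have := osc_sum dc ds c0 s0 h x.
have h1 : 0 < y h x by apply: hy; rewrite x1.
have h2 : 0 < y h (- x) by apply: hy; rewrite lerN2 x2 lerNl.
by move: h1 h2 => *; lra.
Qed.

Lemma osc_s_ge0 h r x : (forall x, - r <= x <= r -> 0 < y h x) -> 0 <= x <= r -> 0 <= s x.
Proof.
move=> hy /andP[x0 xr]; rewrite -s0; apply: (@der_ge0_le _ s c) => //.
  exact: der_cont ds.
move=> z /andP[z0 zx]; apply/ltW/(osc_c_gt0 hy).
by rewrite (le_trans (ltW zx) xr) andbT (le_trans _ (ltW z0))// oppr_le0 (le_trans x0).
Qed.

Lemma riccati_rhs_quotient p l Y D sg : Y != 0 ->
  riccati_rhs p l (D / Y) sg =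
  ((l + (p - 1) * sg `^ (p / (p - 1))) * Y + sg * D) / Y.
Proof. by move=> Y0; rewrite /riccati_rhs; field. Qed.

(** At a common level r - t1 and t4 - r are u + N and u - N with N = r - m, while r - t2 and t3 - r
    are v(u) + N and v(u) - N. The addition theorems express all four Riccati right sides by values
    at u and N, and [interpolation_ineq] compares them. *)
Lemma interpolate p l r B k h1 h2 (t1 t4 : R -> R) : 1 < p -> 0 < l -> 0 < r ->
  h1 = k * h2 -> k ^+ 2 <= 1 ->
  (forall x, - r <= x <= r -> 0 < y h1 x) -> (forall x, - r <= x <= r -> 0 < y h2 x) ->
  continuous t1 -> continuous t4 -> t1 0 = 0 -> t4 0 = 0 ->
  (forall sg, 0 < sg < B -> [/\ 0 < t1 sg, 0 < t4 sg & t1 sg + t4 sg <= 2 * r]) ->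
  (forall sg, 0 < sg < B -> 0 < riccati_rhs p l (osc_T h2 (r - t1 sg)) sg /\
    der t1 sg (riccati_rhs p l (osc_T h2 (r - t1 sg)) sg)^-1) ->
  (forall sg, 0 < sg < B -> 0 < riccati_rhs p l (- osc_T h2 (t4 sg - r)) sg /\
    der t4 sg (riccati_rhs p l (- osc_T h2 (t4 sg - r)) sg)^-1) ->
  exists t2 t3 d2 d3 : R -> R, [/\ [/\ continuous t2, continuous t3, t2 0 = 0 & t3 0 = 0],
    forall sg, t2 sg + t3 sg = t1 sg + t4 sg,
    forall sg, 0 < sg < B -> [/\ der t2 sg (d2 sg), 0 < t2 sg < 2 * r,
      0 < riccati_rhs p l (osc_T h1 (r - t2 sg)) sg &
      (riccati_rhs p l (osc_T h1 (r - t2 sg)) sg)^-1 <= d2 sg] &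
    forall sg, 0 < sg < B -> [/\ der t3 sg (d3 sg), 0 < t3 sg < 2 * r,
      0 < riccati_rhs p l (- osc_T h1 (t3 sg - r)) sg &
      (riccati_rhs p l (- osc_T h1 (t3 sg - r)) sg)^-1 <= d3 sg]].
Proof.
move=> p1 l0 r0 h12 k1 hy1 hy2 ct1 ct4 t10 t40 tin dt1 dt4.
have p10 : 0 < p - 1 by rewrite subr_gt0.
have [v [Z [[cv v0] hZ dv hv vle]]] := osc_contraction dc ds c0 s0 h12 k1 r0 hy2.
pose u sg := (t4 sg - t1 sg) / 2.
pose m sg := (t1 sg + t4 sg) / 2.
have cu : continuous u by apply: cmul; [exact: csub|exact: ccst].
have cm : continuous m by apply: cmul; [exact: cadd|exact: ccst].
have cvu : continuous (fun sg => v (u sg)) by exact: ccomp.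
pose g1 sg := (riccati_rhs p l (osc_T h2 (r - t1 sg)) sg)^-1.
pose g4 sg := (riccati_rhs p l (- osc_T h2 (t4 sg - r)) sg)^-1.
pose w sg := k * y h2 (u sg) / Z (u sg).
exists (fun sg => m sg - v (u sg)), (fun sg => m sg + v (u sg)).
exists (fun sg => (g1 sg + g4 sg) / 2 - w sg * ((g4 sg - g1 sg) / 2)).
exists (fun sg => (g1 sg + g4 sg) / 2 + w sg * ((g4 sg - g1 sg) / 2)).
have u0 : u 0 = 0 by rewrite /u t10 t40 subrr mul0r.
have m0 : m 0 = 0 by rewrite /m t10 t40 addr0 mul0r.
have main sg : 0 < sg < B ->
    [/\ - r < u sg < r, `|v (u sg)| < m sg, m sg + `|v (u sg)| < 2 * r,
        der (fun sg => v (u sg)) sg (w sg * ((g4 sg - g1 sg) / 2)) &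
        der m sg ((g1 sg + g4 sg) / 2)].
  move=> hsg; have [a1 a4 a14] := tin sg hsg.
  have uu : - r < u sg < r by rewrite /u; apply/andP; split; lra.
  have uu' : - r <= u sg <= r by case/andP: uu => *; rewrite !ltW.
  have um : `|u sg| < m sg by rewrite ltr_norml /u /m; apply/andP; split; lra.
  have vm : `|v (u sg)| < m sg by exact: le_lt_trans (vle _ uu') um.
  split => //.
  - have : m sg <= r by rewrite /m; lra.
    by move: vm => vm' mr; lra.
  - have du : der u sg ((g4 sg - g1 sg) / 2).
      have := derM (derB (dt4 sg hsg).2 (dt1 sg hsg).2) (der_cst 2^-1 sg).
      by rewrite mulr0 add0r mulrC.
    exact: der_comp (dv _ uu) du.
  - have := derM (derD (dt1 sg hsg).2 (dt4 sg hsg).2) (der_cst 2^-1 sg).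
    by rewrite mulr0 add0r mulrC.
have alg sg : 0 < sg < B ->
    [/\ 0 < riccati_rhs p l (osc_T h1 (r - (m sg - v (u sg)))) sg,
      (riccati_rhs p l (osc_T h1 (r - (m sg - v (u sg)))) sg)^-1 <=
        (g1 sg + g4 sg) / 2 - w sg * ((g4 sg - g1 sg) / 2),
      0 < riccati_rhs p l (- osc_T h1 (m sg + v (u sg) - r)) sg &
      (riccati_rhs p l (- osc_T h1 (m sg + v (u sg) - r)) sg)^-1 <=
        (g1 sg + g4 sg) / 2 + w sg * ((g4 sg - g1 sg) / 2)].
  move=> hsg; have [uu vm1 vm2 _ _] := main sg hsg; have [a1 a4 a14] := tin sg hsg.
  have uu' : - r <= u sg <= r by case/andP: uu => *; rewrite !ltW.
  have [sg0 _] := andP hsg.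
  have [L1 _] := dt1 sg hsg; have [L4 _] := dt4 sg hsg.
  have [Z0 ZE] := hZ _ uu'; have [y1E d1E] := hv _ uu'.
  set N := r - m sg.
  have N0 : 0 <= N <= r by rewrite /N /m; apply/andP; split; lra.
  have x1E : r - t1 sg = u sg + N by rewrite /N /u /m; field.
  have x4E : t4 sg - r = u sg - N by rewrite /N /u /m; field.
  have x2E : r - (m sg - v (u sg)) = v (u sg) + N by rewrite /N; ring.
  have x3E : m sg + v (u sg) - r = v (u sg) - N by rewrite /N; ring.
  have hx1 : - r <= u sg + N <= r by rewrite -x1E; apply/andP; split; lra.
  have hx4 : - r <= u sg - N <= r by rewrite -x4E; apply/andP; split; lra.
  have hx2 : - r <= v (u sg) + N <= r.
    rewrite -x2E; move: vm1 vm2; rewrite ltr_norml => /andP[? ?].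
    have := ler_norm (v (u sg)); have := ler_norm (- v (u sg)); rewrite normrN => *.
    by apply/andP; split; lra.
  have hx3 : - r <= v (u sg) - N <= r.
    rewrite -x3E; move: vm1 vm2; rewrite ltr_norml => /andP[? ?].
    have := ler_norm (v (u sg)); have := ler_norm (- v (u sg)); rewrite normrN => *.
    by apply/andP; split; lra.
  have yx1 := hy2 _ hx1; have yx4 := hy2 _ hx4; have yx2 := hy1 _ hx2; have yx3 := hy1 _ hx3.
  have Y0 := hy2 _ uu'.
  have cN : 0 < c N.
    by apply: (osc_c_gt0 hy2); case/andP: N0 => *; apply/andP; split; lra.
  have sN : 0 <= s N := osc_s_ge0 hy2 N0.
  have py := osc_pythagoras dc ds c0 s0 N.
  set A := l + (p - 1) * sg `^ (p / (p - 1)).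
  have A0 : 0 < A by rewrite ltr_pwDl// mulr_ge0 ?powR_ge0 ?(ltW p10).
  (* [E] and [mm] are the coefficients of y(u) and d(u) in the numerator A y + sg d of the Riccati
     right side taken at u + N. *)
  pose E := A * c N - K * sg * s N.
  pose mm := sg * c N + e * A * s N.
  have mm0 : 0 <= mm by rewrite addr_ge0 ?mulr_ge0 ?(ltW sg0) ?(ltW cN) ?(ltW A0).
  have sgE : c N * mm - e * s N * E = sg.
    by rewrite -[RHS]mulr1 -py /mm /E; ring.
  have [yA1 dA1] := osc_add dc ds c0 s0 h2 (u sg) N.
  have [yA4 dA4] := osc_sub dc ds c0 s0 h2 (u sg) N.
  have [yA2 dA2] := osc_add dc ds c0 s0 h1 (v (u sg)) N.
  have [yA3 dA3] := osc_sub dc ds c0 s0 h1 (v (u sg)) N.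
  have R1 : riccati_rhs p l (osc_T h2 (r - t1 sg)) sg =
      (y h2 (u sg) * E + d h2 (u sg) * mm) / y h2 (u sg + N).
    rewrite x1E /osc_T riccati_rhs_quotient ?gt_eqF// -/A; congr (_ / _).
    by rewrite yA1 dA1 /E /mm; ring.
  have R4 : riccati_rhs p l (- osc_T h2 (t4 sg - r)) sg =
      (y h2 (u sg) * E - d h2 (u sg) * mm) / y h2 (u sg - N).
    rewrite x4E /osc_T -mulNr riccati_rhs_quotient ?gt_eqF// -/A; congr (_ / _).
    by rewrite yA4 dA4 /E /mm; ring.
  have R2 : riccati_rhs p l (osc_T h1 (r - (m sg - v (u sg)))) sg =
      (Z (u sg) * E + k * d h2 (u sg) * mm) / y h1 (v (u sg) + N).
    rewrite x2E /osc_T riccati_rhs_quotient ?gt_eqF// -/A; congr (_ / _).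
    by rewrite yA2 dA2 y1E d1E /E /mm; ring.
  have R3 : riccati_rhs p l (- osc_T h1 (m sg + v (u sg) - r)) sg =
      (Z (u sg) * E + k * (- d h2 (u sg)) * mm) / y h1 (v (u sg) - N).
    rewrite x3E /osc_T -mulNr riccati_rhs_quotient ?gt_eqF// -/A; congr (_ / _).
    by rewrite yA3 dA3 y1E d1E /E /mm; ring.
  have L1' : 0 < y h2 (u sg) * E + d h2 (u sg) * mm.
    by move: L1; rewrite R1 pmulr_lgt0 ?invr_gt0.
  have L4' : 0 < y h2 (u sg) * E - d h2 (u sg) * mm.
    by move: L4; rewrite R4 pmulr_lgt0 ?invr_gt0.
  have sgp : 0 < c N * mm - e * s N * E by rewrite sgE.
  have [P2 Q2] := interpolation_ineq Y0 Z0 L1' L4' ZE k1 mm0 sgp.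
  (* The curve t3 is the case of -D, which exchanges the roles of t1 and t4. *)
  have L1'' : 0 < y h2 (u sg) * E + (- d h2 (u sg)) * mm by rewrite mulNr.
  have L4'' : 0 < y h2 (u sg) * E - (- d h2 (u sg)) * mm by rewrite mulNr opprK.
  have [P3 Q3] := interpolation_ineq Y0 Z0 L1'' L4'' ZE k1 mm0 sgp.
  have y2E : y h1 (v (u sg) + N) = Z (u sg) * c N + e * (k * d h2 (u sg)) * s N.
    by rewrite yA2 y1E d1E.
  have y3E : y h1 (v (u sg) - N) = Z (u sg) * c N + e * (k * - d h2 (u sg)) * s N.
    by rewrite yA3 y1E d1E; ring.
  have g1E : g1 sg = (y h2 (u sg) * c N + e * d h2 (u sg) * s N) /
      (y h2 (u sg) * E + d h2 (u sg) * mm) by rewrite /g1 R1 invf_div yA1.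
  have g4E : g4 sg = (y h2 (u sg) * c N - e * d h2 (u sg) * s N) /
      (y h2 (u sg) * E - d h2 (u sg) * mm) by rewrite /g4 R4 invf_div yA4.
  rewrite R2 R3 !invf_div; split.
  - by rewrite divr_gt0.
  - by rewrite y2E /w g1E g4E.
  - by rewrite divr_gt0.
  - rewrite y3E; apply: le_trans Q3 _; rewrite /w g1E g4E !(mulrN, mulNr) !opprK.
    by rewrite le_eqVlt; apply/orP; left; apply/eqP; ring.
split.
- split; [exact: csub|exact: cadd| |].
  + by rewrite u0 v0 m0 subr0.
  + by rewrite u0 v0 m0 addr0.
- by move=> sg; rewrite /m; field.
- move=> sg hsg; have [_ vm1 vm2 dvu dm] := main sg hsg; have [q1 q2 _ _] := alg sg hsg.
  split => //; first exact: derB.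
  have := ler_norm (v (u sg)); have := ler_norm (- v (u sg)); rewrite normrN => *.
  by apply/andP; split; lra.
- move=> sg hsg; have [_ vm1 vm2 dvu dm] := main sg hsg; have [_ _ q1 q2] := alg sg hsg.
  split => //; first exact: derD.
  have := ler_norm (v (u sg)); have := ler_norm (- v (u sg)); rewrite normrN => *.
  by apply/andP; split; lra.
Qed.

End interpolation.

(** * Inverse functions of Riccati solutions *)

Section riccati_curve.
Context {R : realType}.
Implicit Types (x t l p q b : R).

Lemma first_hit (f : R -> R) b d : continuous f -> f 0 < b ->
  (exists2 t, 0 <= t <= d & b <= f t) ->
  exists tau : R, [/\ 0 < tau <= d, f tau = b & forall t, 0 <= t < tau -> f t < b].
Proof.
move=> cf f0 [t1 /andP[t10 t1d] ft1].
pose S := [set t | 0 <= t <= t1 /\ forall x, 0 <= x <= t -> f x < b].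
have S0 : S 0.
  by split; [rewrite lexx|move=> x; rewrite -eq_le => /eqP <-].
have hS : has_sup S by split; [exists 0|exists t1 => t [/andP[]]].
set tau := sup S.
have tau0 : 0 <= tau by apply: ub_le_sup => //; case: hS.
have taud : tau <= t1 by apply: ge_sup; [exists 0|move=> t [/andP[]]].
have below t : 0 <= t < tau -> f t < b.
  move=> /andP[t0 tt]; have tt' : 0 < tau - t by rewrite subr_gt0.
  have [z [_ zS]] := sup_adherent tt' hS; rewrite -/tau subKr => tz.
  by apply: zS; rewrite t0 ltW.
have ftau : f tau = b.
  apply/eqP; case: ltgtP => // h.
    have tau1 : tau < t1.
      rewrite lt_neqAle taud andbT; apply/eqP => e.
      by move: h; rewrite e ltNge ft1.
    have [d1 d10 hd1] := near_lt (cf tau) h.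
    pose z := Num.min t1 (tau + d1 / 2).
    have tz : tau < z by rewrite lt_min tau1 ltrDl divr_gt0.
    have Sz : S z.
      split; first by rewrite (le_trans tau0 (ltW tz)) ge_min lexx.
      move=> x /andP[x0 xz]; have [xt|xt] := ltP x tau; first by apply: below; rewrite x0.
      apply: hd1; rewrite /= ltr_norml.
      have : x <= tau + d1 / 2 by rewrite (le_trans xz)// ge_min lexx orbT.
      by have d10' : 0 < d1 := d10; move=> ?; apply/andP; split; lra.
    have : z <= tau by apply: ub_le_sup => //; case: hS.
    by rewrite leNgt tz.
  have tau00 : 0 < tau.
    rewrite lt_neqAle tau0 andbT; apply/eqP => e.
    by move: h; rewrite -e ltNge ltW.
  have [d1 d10 hd1] := near_gt (cf tau) h.
  pose z := Num.max 0 (tau - d1 / 2).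
  have zt : z < tau by rewrite gt_max tau00 gtrBl divr_gt0.
  have z0 : 0 <= z by rewrite le_max lexx.
  have : b < f z.
    apply: hd1; rewrite /= ltr_norml.
    have : tau - d1 / 2 <= z by rewrite le_max lexx orbT.
    by have d10' : 0 < d1 := d10; move=> ?; apply/andP; split; lra.
  by rewrite ltNge ltW// below// z0.
exists tau; split => //; rewrite (le_trans taud t1d) andbT lt_neqAle tau0 andbT.
by apply/eqP => e; move: f0; rewrite e ftau ltxx.
Qed.

(** The point is f' > 0. The right side E along f satisfies E' = U' f + a E, so Q = E exp(-A) is
    monotone in the direction of U. If U increases, E stays positive as it is at 0. If U decreases
    and E <= 0 once, this remains so, and f could not climb to b. *)
Lemma riccati_curve p l b tau (U dU f : R -> R) : 1 < p -> 0 < l -> 0 < b -> 0 < tau ->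
  continuous U -> (forall t, 0 < t < tau -> der U t (dU t)) ->
  ((forall t, 0 < t < tau -> 0 <= dU t) \/ (forall t, 0 < t < tau -> dU t <= 0)) ->
  continuous f -> f 0 = 0 -> (forall t, 0 < t < tau -> 0 < f t < b) -> f tau = b ->
  (forall t, 0 < t < tau -> der f t (riccati_rhs p l (U t) (f t))) ->
  exists g : R -> R, [/\ continuous g, g 0 = 0, g b = tau &
    forall s, 0 < s < b -> [/\ 0 < g s < tau, 0 < riccati_rhs p l (U (g s)) s &
      der g s (riccati_rhs p l (U (g s)) s)^-1]].
Proof.
move=> p1 l0 b0 tau0 cU dUE dUs cf f0 fb ftau df.
have p10 : 0 < p - 1 by rewrite subr_gt0.
have p10' : p - 1 != 0 by rewrite gt_eqF.
pose q := p / (p - 1).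
have q1 : 1 < q by rewrite /q ltr_pdivlMr// mul1r gtrBl.
have q0 : 0 < q by rewrite (lt_trans _ q1).
have q10 : 0 < q - 1 by rewrite subr_gt0.
pose E t := l + U t * f t + (p - 1) * `|f t| `^ q.
have cE : continuous E.
  apply: cadd; last first.
    apply: cmul; first exact: ccst.
    by apply: (@ccomp _ (fun x => `|x| `^ q)) => //; exact: normr_powR_continuous.
  by apply: cadd; [exact: ccst|exact: cmul].
have EE t : 0 < t < tau -> E t = riccati_rhs p l (U t) (f t).
  by move=> /fb/andP[ft _]; rewrite /E gtr0_norm.
pose a t := U t + p * `|f t| `^ (q - 1).
have ca : continuous a.
  apply: cadd => //; apply: cmul; first exact: ccst.
  by apply: (@ccomp _ (fun x => `|x| `^ (q - 1))) => //; exact: normr_powR_continuous.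
have [A dA] := primitive ca.
have cA := der_cont dA.
have dE t : 0 < t < tau -> der E t (dU t * f t + a t * E t).
  move=> ht; have /andP[ft _] := fb t ht.
  have d1 := @der_comp _ (fun y => `|y| `^ q) f t _ _ (der_normr_powR (f t) q1) (df t ht).
  apply: der_eq (derD (derD (der_cst l t) (derM (dUE t ht) (df t ht))) (derZ (p - 1) d1)) _.
  rewrite -(EE t ht) /a ge0_signed_pow ?(ltW ft)// gtr0_norm//.
  have pq : (p - 1) * q = p by rewrite /q mulrC divfK.
  have -> X Y : (p - 1) * (q * X * Y) = p * X * Y.
    by rewrite -(mulrA q X Y) (mulrA (p - 1) q) pq mulrA.
  by ring.
pose Q t := E t * expR (- A t).
have dQ t : 0 < t < tau -> der Q t (dU t * f t * expR (- A t)).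
  move=> ht; apply: der_eq (derM (dE t ht) (der_expR (derN (dA t)))) _.
  by ring.
have cQ : continuous Q by apply: cmul => //; apply: ccomp; [exact: continuous_expR|exact: copp].
have E0 : 0 < E 0.
  by rewrite /E f0 mulr0 addr0 normr0 powR0 ?gt_eqF// mulr0 addr0.
have QE t : (0 < Q t) = (0 < E t) by rewrite /Q pmulr_lgt0// expR_gt0.
have Epos t : 0 < t < tau -> 0 < E t.
  move=> /andP[t0 tt]; case: dUs => sgn.
    rewrite -QE; apply: (@lt_le_trans _ _ (Q 0)); first by rewrite QE.
    apply: (der_ge0_le (ltW t0) cQ (fun z hz => dQ z _)) => z /andP[z0 zt].
      by rewrite z0 (lt_trans zt tt).
    have hz : 0 < z < tau by rewrite z0 (lt_trans zt tt).
    have /andP[fz _] := fb z hz.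
    by rewrite mulr_ge0 ?expR_ge0// mulr_ge0 ?sgn// ltW.
  rewrite ltNge; apply/negP => Et.
  have Eneg z : t <= z -> z < tau -> E z <= 0.
    move=> tz zt; rewrite leNgt -QE; apply/negP => Qz.
    have : Q z <= Q t.
      rewrite -lerN2; apply: (@der_ge0_le _ (fun x => - Q x)
        (fun x => - (dU x * f x * expR (- A x)))) => //; first exact: copp.
        by move=> x /andP[x1 x2]; apply/derN/dQ; rewrite (lt_trans t0 x1) (lt_trans x2 zt).
      move=> x /andP[x1 x2]; have hx : 0 < x < tau by rewrite (lt_trans t0 x1) (lt_trans x2 zt).
      have /andP[fx _] := fb x hx.
      by rewrite oppr_ge0 mulr_le0_ge0 ?expR_ge0// mulr_le0_ge0 ?sgn// ltW.
    by move=> /(lt_le_trans Qz); rewrite QE ltNge Et.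
  have : f tau <= f t.
    rewrite -lerN2; apply: (@der_ge0_le _ (fun x => - f x) (fun x => - E x)) => //.
    - exact: ltW.
    - exact: copp.
    - by move=> x /andP[x1 x2]; rewrite EE ?(lt_trans t0 x1)//; apply/derN/df; rewrite (lt_trans t0 x1).
    - by move=> x /andP[x1 x2]; rewrite oppr_ge0 Eneg// ltW.
  have ht : 0 < t < tau by rewrite t0.
  by have /andP[_ ftb] := fb t ht; rewrite ftau leNgt ftb.
have inc x z : 0 <= x -> x < z -> z <= tau -> f x < f z.
  move=> x0 xz zt; apply: (@der_gt0_lt _ f E) => // w /andP[w1 w2];
    have hw : 0 < w < tau by rewrite (le_lt_trans x0 w1) (lt_le_trans w2 zt).
    by rewrite EE//; exact: df.
  exact: Epos.
have [g [cg gf fg gin dg]] := increasing_inverse_itv (ltW tau0) cf inc.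
rewrite f0 ftau in fg gin.
exists g; split => //.
- by rewrite -{1}f0 gf// lexx ltW.
- by rewrite -ftau gf// lexx ltW.
- move=> s hs; have hg := gin s hs.
  have [_ fgs] : 0 <= g s <= tau /\ f (g s) = s by apply: fg; case/andP: hs => *; rewrite !ltW.
  have Eg := Epos _ hg; rewrite EE// fgs in Eg.
  split => //.
  have := dg (g s) _ hg (df _ hg); rewrite fgs => h; apply: h.
  by rewrite gt_eqF.
Qed.

End riccati_curve.

(** * Test functions on one side of the interval *)

Section half_interval_test_function.
Context {R : realType}.
Implicit Types (x t : R).
Variables (p l M r2 : R) (j U : R -> R).
Hypotheses (p1 : 1 < p) (l0 : 0 < l) (M0 : 0 < M).
Hypotheses (cj : continuous j) (j0 : forall x, 0 < j x).
Hypotheses (dj : forall t, 0 < t < r2 -> der j t (- U t * j t)).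
Hypotheses (UM : forall t, 0 < t < r2 -> `|U t| <= M).

Local Notation q := (p / (p - 1)).

Let p0 : 0 < p. Proof. by rewrite (lt_trans _ p1). Qed.
Let p10 : 0 < p - 1. Proof. by rewrite subr_gt0. Qed.
Let pn : p - 1 != 0. Proof. by rewrite gt_eqF. Qed.
Let q1 : 1 < q. Proof. by rewrite ltr_pdivlMr// mul1r gtrBl. Qed.
Let q0 : 0 < q. Proof. by rewrite (lt_trans _ q1). Qed.
Let q10 : 0 < q - 1. Proof. by rewrite subr_gt0. Qed.

Let qp : (q - 1) * p = q. Proof. by field. Qed.
Let qp1 : (p - 1) * (q - 1) = 1. Proof. by field. Qed.

(** From this level on l + M <= x^(q-1), so the power dominates and the Riccati right side is at
    most p x^q. *)
Definition level0 := Num.max 1 ((l + M) `^ (p - 1)).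

Let level0_ge1 : 1 <= level0. Proof. by rewrite le_max lexx. Qed.
Let level0_gt0 : 0 < level0. Proof. exact: lt_le_trans level0_ge1. Qed.

Let mul_powRB1 x : 0 <= x -> x * x `^ (q - 1) = x `^ q.
Proof. by move=> x0; rewrite mulr_powRB1. Qed.

Let rhs_large u x : `|u| <= M -> level0 <= x -> riccati_rhs p l u x <= p * x `^ q.
Proof.
move=> uM hx; have lM : 0 < l + M by rewrite addr_gt0.
have x1 : 1 <= x by exact: le_trans hx.
have x0 : 0 < x by exact: lt_le_trans x1.
have h1 : l + M <= x `^ (q - 1).
  have : (l + M) `^ (p - 1) <= x by apply: le_trans hx; rewrite le_max lexx orbT.
  move=> h; have : ((l + M) `^ (p - 1)) `^ (q - 1) <= x `^ (q - 1).
    by apply: ge0_ler_powR => //; rewrite ?nnegrE ?powR_ge0 ?(ltW q10) ?(ltW x0).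
  by rewrite -powRrM qp1 powRr1// ltW.
have h2 : x * (l + M) <= x `^ q.
  by rewrite -mul_powRB1 ?(ltW x0)// ler_pM2l.
have h3 : l <= x * l by rewrite ler_peMl// ltW.
have h4 : u * x <= M * x by rewrite ler_pM2r// (le_trans (ler_norm _) uM).
rewrite /riccati_rhs; lra.
Qed.

Let rhs_small u x : `|u| <= M -> 0 <= x <= 1 -> riccati_rhs p l u x <= l + M + (p - 1).
Proof.
move=> uM /andP[x0 x1].
have h1 : u * x <= M.
  apply: le_trans (ler_norm _) _; rewrite normrM -[M]mulr1 (ger0_norm x0).
  by apply: ler_pM.
have h2 : x `^ q <= 1.
  have : x `^ q <= 1 `^ q by apply: ge0_ler_powR; rewrite ?nnegrE ?(ltW q0) ?ler01.
  by rewrite powR1.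
have h3 : (p - 1) * x `^ q <= (p - 1) * 1 by rewrite ler_pM2l.
rewrite /riccati_rhs; lra.
Qed.

Section curve.
Variables (b : R) (g dg : R -> R).
Hypotheses (bl : level0 <= b) (cg : continuous g) (g0 : g 0 = 0).
Hypotheses (gin : forall s, 0 < s < b -> 0 < g s < r2).
Hypotheses (dgE : forall s, 0 < s < b -> der g s (dg s)).
Hypotheses (rpos : forall s, 0 < s < b -> 0 < riccati_rhs p l (U (g s)) s).
Hypotheses (dg_ge : forall s, 0 < s < b -> (riccati_rhs p l (U (g s)) s)^-1 <= dg s).

Let b0 : 0 < b. Proof. exact: lt_le_trans bl. Qed.
Let b1 : 1 <= b. Proof. exact: le_trans bl. Qed.

Let dg0 s : 0 < s < b -> 0 < dg s.
Proof. by move=> hs; apply: lt_le_trans (dg_ge hs); rewrite invr_gt0 rpos. Qed.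

(** While the profile is at most 1 it grows at rate at most 1/t0, so it stays at most 1 up to time
    [t0], whatever [b] is. *)
Let t0 : R := (l + M + (p - 1))^-1.

Let t0_gt0 : 0 < t0. Proof. by rewrite invr_gt0 addr_gt0 ?p10// addr_gt0. Qed.

Lemma curve_profile : exists sc : R -> R, let tau := g b in
  [/\ [/\ 0 < tau, continuous sc, forall t, 0 <= sc t & forall t, t <= 0 -> sc t = 0],
    (forall t, 0 < t < tau -> exists2 ds : R, der sc t ds & ds <= riccati_rhs p l (U t) (sc t)),
    (forall t, 0 < t < tau -> 0 < sc t < b /\ 0 < t < r2),
    (exists2 z, 0 <= z <= tau /\ sc z = level0 & forall t, z < t < tau -> level0 <= sc t) /\
      sc tau = b &
    t0 <= tau /\ forall t, 0 <= t <= t0 -> sc t <= 1].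
Proof.
have inc x y : 0 <= x -> x < y -> y <= b -> g x < g y.
  move=> x0 xy yb; apply: (@der_gt0_lt _ g dg) => // z /andP[z1 z2].
    by apply: dgE; rewrite (le_lt_trans x0 z1) (lt_le_trans z2 yb).
  by apply: dg0; rewrite (le_lt_trans x0 z1) (lt_le_trans z2 yb).
have [s [cs sg gs sin ds]] := increasing_inverse_itv (ltW b0) cg inc.
rewrite g0 in gs sin; set tau := g b.
have tau0 : 0 < tau by rewrite -g0; exact: inc.
pose cl t := Num.max 0 (Num.min tau t).
have ccl : continuous cl by apply: cmax; [exact: ccst|apply: cmin; [exact: ccst|exact: cidf]].
have clin t : 0 <= cl t <= tau by rewrite /cl le_max lexx/= ge_max (ltW tau0) ge_min lexx.
have clK t : 0 <= t <= tau -> cl t = t by move=> /andP[? ?]; rewrite /cl min_r// max_r.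
have clK0 t : t <= 0 -> cl t = 0.
  by move=> h; rewrite /cl min_r ?(le_trans h (ltW tau0))// max_l.
pose sc t := s (cl t).
have csc : continuous sc by exact: ccomp.
have sc0 t : 0 <= sc t by have [/andP[]] := gs _ (clin t).
have scb t : sc t <= b by have [/andP[]] := gs _ (clin t).
have s00 : s 0 = 0 by rewrite -{1}g0 sg// lexx ltW.
have stau : s tau = b by rewrite sg// lexx ltW.
have scin t : 0 < t < tau -> 0 < sc t < b.
  move=> ht; rewrite /sc clK; first exact: sin.
  by case/andP: ht => *; rewrite !ltW.
have gsc t : 0 < t < tau -> g (sc t) = t.
  move=> /andP[h1 h2]; have ht : 0 <= t <= tau by rewrite !ltW.
  by rewrite /sc clK//; have [_] := gs t ht.
have dsc t : 0 < t < tau -> exists2 ds : R, der sc t ds & 0 < ds <= riccati_rhs p l (U t) (sc t).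
  move=> ht; have hs := scin t ht.
  exists (dg (sc t))^-1.
    have d1 := ds (sc t) _ hs (dgE hs); rewrite gsc// in d1.
    have {}d1 := d1 (lt0r_neq0 (dg0 hs)).
    apply: der_near d1; apply: filterS (near_oo ht) => z /andP[z1 z2].
    by rewrite /sc clK// !ltW.
  rewrite invr_gt0 dg0//=.
  have := rpos hs; rewrite gsc// => rp.
  by have := dg_ge hs; rewrite gsc// => h; rewrite -[leRHS]invrK lef_pV2 ?posrE ?invr_gt0 ?dg0.
have mono x y : 0 <= x -> x <= y -> y <= tau -> sc x <= sc y.
  move=> x0 xy yt; rewrite leNgt; apply/negP => h.
  have hx : 0 <= x <= tau by rewrite x0 (le_trans xy).
  have hy : 0 <= y <= tau by rewrite yt (le_trans x0).
  have := inc (sc y) (sc x) (sc0 y) h (scb x).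
  by rewrite /sc !clK// (gs x hx).2 (gs y hy).2 ltNge xy.
have sct : sc tau = b by rewrite /sc clK// lexx ltW.
have sct0 : sc 0 = 0 by rewrite /sc clK0.
have level v : 0 <= v <= b -> exists2 z, 0 <= z <= tau & sc z = v.
  by move=> hv; apply: intermediate_value => //; [exact: ltW|left; rewrite sct sct0].
exists sc; split.
- by split => // t h; rewrite /sc clK0.
- by move=> t /dsc[d' h /andP[_ h']]; exists d'.
- by move=> t ht; split; [exact: scin|rewrite -(gsc t ht); apply: gin; exact: scin].
- split => //; have [|z hz sz] := level level0; first by rewrite (ltW level0_gt0).
  exists z; first by split.
  move=> t /andP[zt tt]; rewrite -sz; apply: mono; [by case/andP: hz|exact: ltW|exact: ltW].
have [|z /andP[z0 zt] sz] := level 1; first by rewrite ler01.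
have tz : t0 <= z.
  have h : sc z - sc 0 <= (0 + (l + M + (p - 1)) * z) - (0 + (l + M + (p - 1)) * 0).
    have /choice[d' hd'] : forall t, exists ds : R, 0 < t < tau ->
        der sc t ds /\ ds <= riccati_rhs p l (U t) (sc t).
      move=> t; have [/dsc[d' h /andP[_ h']]|h] := boolP (0 < t < tau); first by exists d'.
      by exists 0.
    have hz y : 0 < y < z -> 0 < y < tau by move=> /andP[-> y2]; rewrite (lt_le_trans y2 zt).
    apply: (@der_le_le _ sc d' (fun y => 0 + (l + M + (p - 1)) * y) (fun=> l + M + (p - 1)) 0 z z0 csc).
    + exact: der_cont (fun y => der_affine y _ 0).
    + by move=> y /hz/hd'[].
    + by move=> y _; exact: der_affine.
    + move=> y hy; have hy' := hz y hy; have [_ h] := hd' y hy'.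
      apply: le_trans h _; apply: rhs_small.
        apply: UM; rewrite -(gsc y hy'); apply: gin; exact: scin.
      rewrite sc0 -sz mono//; first by case/andP: hy => /ltW.
      by case/andP: hy => _ /ltW.
  move: h; rewrite sz sct0 mulr0 !add0r !subr0 => h.
  have kk : 0 < l + M + (p - 1) by rewrite -invr_gt0; exact: t0_gt0.
  by rewrite /t0 -[X in X <= _]mul1r (ler_pdivrMr _ _ kk) mulrC.
split; first exact: le_trans zt.
by move=> t /andP[h1 h2]; rewrite -sz mono// (le_trans h2).
Qed.

Let gb : g b <= r2.
Proof.
rewrite leNgt; apply/negP => h; have [d d0 hd] := near_gt (@cg b) h.
pose z := Num.max (b / 2) (b - d / 2).
have zb : z < b by rewrite gt_max; have d0' : 0 < d := d0; have b0' := b0; apply/andP; split; lra.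
have z0 : 0 < z by rewrite lt_max divr_gt0.
have : r2 < g z.
  apply: hd; rewrite /= ltr_norml.
  have : b - d / 2 <= z by rewrite le_max lexx orbT.
  by have d0' : 0 < d := d0; move=> ?; apply/andP; split; lra.
have hz : 0 < z < b by rewrite z0.
by have /andP[_ /ltW] := gin hz; rewrite leNgt => /negP.
Qed.

(** If the profile solved the Riccati equation, f = exp(-A) with A' = sc^(1/(p-1)) would satisfy the
    Neumann equation. But f is positive at [tau], so it is replaced by F = (f - fB)^2 / f with fB =
    f(tau): F and F' vanish at [tau], |F'| <= |f'|, and F >= f - 2 fB. Here X is the mass of f, and
    the exponential in the last bound majorises fB. *)
Lemma curve_test : exists F G : R -> R, let tau := g b in
  [/\ [/\ 0 < tau, continuous G, forall t, der F t (G t) & 0 < F 0],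
    (forall t, tau <= t -> F t = 0 /\ G t = 0), (forall t, t <= 0 -> G t = 0),
    (forall t, 0 <= F t) &
    exists X : R, [/\ expR (- (p * t0)) * integ j 0 t0 <= X,
      integ (fun t => `|G t| `^ p * j t) 0 tau <= l * X &
      X - 2 * p * expR ((ln level0 - ln b) / p) * integ j 0 r2 <=
        integ (fun t => `|F t| `^ p * j t) 0 tau]].
Proof.
have [sc [[tau0 csc sc0 scneg] dsc scin [[z [hz scz] zlev] sctau] [t0tau sc1]]] := curve_profile.
set tau := g b in tau0 dsc scin hz scz zlev sctau t0tau *.
pose S t := `|sc t| `^ (q - 1).
have cS : continuous S.
  by apply: (@ccomp _ (fun x => `|x| `^ (q - 1))) => //; exact: normr_powR_continuous.
have S0 t : 0 <= S t by exact: powR_ge0.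
have SE t : sc t * S t = sc t `^ q by rewrite /S ger0_norm// mul_powRB1.
have [A [A0 cA dA]] := prim0 cS.
have Amono x y : x <= y -> A x <= A y by move=> xy; exact: (@der_ge0_le _ A S).
have Aneg t : t <= 0 -> A t = 0.
  move=> h; rewrite -A0; apply: der0_cst => // x /andP[_ x0].
  by have := dA x; rewrite /S scneg ?ltW// normr0 powR0// gt_eqF.
have Apos t : 0 <= A t.
  by have [h|/ltW h] := leP t 0; [rewrite Aneg|rewrite -A0 Amono].
pose f t := expR (- A t).
have f0 t : 0 < f t by exact: expR_gt0.
have f1 t : f t <= 1 by rewrite -expR0 ler_expR oppr_le0.
have df t : der f t (- S t * f t).
  by apply: der_eq (der_expR (derN (dA t))) _; rewrite mulrC.
have cf := der_cont df.
pose fB := f tau.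
have fB0 : 0 < fB by exact: f0.
have ffB t : t <= tau -> fB <= f t by move=> h; rewrite ler_expR lerN2 Amono.
pose cl t := Num.min tau t.
have ccl : continuous cl by apply: cmin; [exact: ccst|exact: cidf].
have clK t : t <= tau -> cl t = t by move=> h; rewrite /cl min_r.
have clK' t : tau <= t -> cl t = tau by move=> h; rewrite /cl min_l.
(* Chosen so that -S H is the derivative of (f - fB)^2 / f up to [tau] and 0 from there on. *)
pose H t := f (cl t) - fB ^+ 2 * (f (cl t))^-1.
have cH : continuous H.
  apply: csub; first exact: ccomp.
  by apply: cmul; [exact: ccst|apply: cinv; [exact: ccomp|move=> x; rewrite gt_eqF]].
have H01 t : 0 <= H t <= f (cl t).
  have h : fB <= f (cl t) by apply: ffB; rewrite /cl ge_min lexx.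
  rewrite /H subr_ge0 ler_pdivrMr// expr2 ler_pM ?(ltW fB0)//= gerBl.
  by rewrite divr_ge0 ?sqr_ge0// ltW.
pose G t := - S t * H t.
have cG : continuous G by apply: cmul => //; exact: copp.
have [F1 dF1] := primitive cG.
pose F t := F1 t - F1 tau.
have dF t : der F t (G t).
  by have := derB (dF1 t) (der_cst (F1 tau) t); rewrite subr0.
have cF := der_cont dF.
have Ftau : F tau = 0 by rewrite /F subrr.
have G_right t : tau <= t -> G t = 0.
  move=> h; rewrite /G /H clK'// -/fB expr2 mulfK ?subrr ?mulr0//.
  by rewrite gt_eqF.
have G_left t : t <= 0 -> G t = 0.
  by move=> h; rewrite /G /S scneg// normr0 powR0 ?oppr0 ?mul0r// gt_eqF.
have F_right t : tau <= t -> F t = 0.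
  move=> h; rewrite -Ftau; apply/esym; apply: der0_cst => // x /andP[x1 _].
  by rewrite -(G_right x)// ltW.
pose F2 t := f t + fB ^+ 2 * (f t)^-1 - 2 * fB.
have dF2 t : t < tau -> der F2 t (G t).
  move=> h; have fn : f t != 0 by rewrite gt_eqF.
  apply: der_eq (derB (derD (df t) (derZ (fB ^+ 2) (derV fn (df t)))) (der_cst (2 * fB) t)) _.
  by rewrite /G /H clK ?(ltW h)//; field.
have cF2 : continuous F2.
  apply: csub; last exact: ccst; apply: cadd => //.
  by apply: cmul; [exact: ccst|apply: cinv => // x; rewrite gt_eqF].
have F2tau : F2 tau = 0.
  by rewrite /F2 -/fB; field; rewrite gt_eqF.
have FE t : t <= tau -> F t = F2 t.
  move=> h; have cD : continuous (fun x => F x - F2 x) by exact: csub.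
  have := @der0_cst _ (fun x => F x - F2 x) t tau h cD; rewrite Ftau F2tau subrr => e.
  apply/eqP; rewrite -subr_eq0; apply/eqP; apply: e => x /andP[_ x2].
  by rewrite -[0](subrr (G x)); apply: derB => //; exact: dF2.
have F2E t : F2 t = (f t - fB) ^+ 2 / f t by rewrite /F2; field; rewrite gt_eqF.
have F_ge0 t : 0 <= F t.
  have [h|/ltW h] := leP t tau; last by rewrite F_right.
  by rewrite FE// F2E divr_ge0 ?sqr_ge0// ltW.
have f00 : f 0 = 1 by rewrite /f A0 oppr0 expR0.
have scp t : 0 < t < tau -> 0 < sc t by move=> /scin[/andP[]].
have Atau : 0 < A tau.
  rewrite -A0; apply: (@der_gt0_lt _ A S) => // t /scp h.
  by rewrite /S powR_gt0// gtr0_norm.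
have fB1 : fB < 1 by rewrite -expR0 ltr_expR oppr_lt0.
have F0 : 0 < F 0.
  by rewrite FE ?(ltW tau0)// F2E f00 divr1 exprn_even_gt0//= subr_eq0 gt_eqF.
(* From [level0] on the profile satisfies sc' <= p sc^q, that is (ln sc)' / p <= A'; integrating
   from [z] to [tau] gives a bound that grows with b. *)
have AB : (ln b - ln level0) / p <= A tau.
  pose m t := Num.max level0 (sc t).
  have cm : continuous m by apply: cmax => //; exact: ccst.
  have m0 t : 0 < m t by rewrite lt_max level0_gt0.
  pose L t := ln (m t) / p.
  have cL : continuous L.
    apply: cmul; last exact: ccst.
    move=> t; apply: (@continuous_comp R R R m (fun x => ln x)); first exact: cm.
    exact: der_continuous (is_derive1_ln (m0 t)).
  have hzt t : z < t < tau -> 0 < t < tau.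
    by move=> /andP[h1 h2]; rewrite h2 andbT (le_lt_trans _ h1)//; case/andP: hz.
  have /choice[ds hds] : forall t, exists d : R, z < t < tau ->
      der sc t d /\ d <= riccati_rhs p l (U t) (sc t).
    move=> t; have [h|h] := boolP (z < t < tau); last by exists 0.
    by have [d h1 h2] := dsc t (hzt t h); exists d.
  have zt : z <= tau by case/andP: hz.
  have := @der_le_le _ L (fun t => (sc t)^-1 * ds t / p) A S z tau zt cL cA.
  have -> : L tau = ln b / p.
    by rewrite /L /m sctau max_r.
  have -> : L z = ln level0 / p by rewrite /L /m scz max_r.
  rewrite -mulrBl => h; apply: (@le_trans _ _ (A tau - A z)); last first.
    by rewrite gerBl Apos.
  apply: h.
  - move=> t ht; have [d1 _] := hds t ht; have sp := scp t (hzt t ht).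
    have d2 := @der_comp _ (@ln R) sc t _ _ (is_derive1_ln sp) d1.
    have d3 := derM d2 (der_cst p^-1 t); rewrite mulr0 add0r mulrC in d3.
    apply: der_near d3; apply: filterS (near_oo ht) => x /zlev h.
    by rewrite /L /m max_r.
  - by move=> t _.
  - move=> t ht; have [_ d1] := hds t ht; have sp := scp t (hzt t ht).
    have [_ tr] := scin t (hzt t ht).
    have d2 : ds t <= p * sc t `^ q by apply: le_trans d1 _; exact: rhs_large (UM tr) (zlev t ht).
    rewrite ler_pdivrMr// ler_pdivrMl//.
    have -> : sc t * (S t * p) = p * (sc t * S t) by ring.
    by rewrite SE.
pose fp t := expR (- (p * A t)).
have fpE t : f t `^ p = fp t by rewrite /f /fp -expRM mulrC mulrN.
have cfp : continuous fp.
  by apply: (@ccomp _ expR); [exact: continuous_expR|apply: copp; apply: cmul => //; exact: ccst].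
have fp0 t : 0 < fp t by exact: expR_gt0.
have cfj : continuous (fun t => fp t * j t) by exact: cmul.
have cscq : continuous (fun t => `|sc t| `^ q).
  by apply: (@ccomp _ (fun x => `|x| `^ q)) => //; exact: normr_powR_continuous.
have cscj : continuous (fun t => `|sc t| `^ q * (fp t * j t)) by exact: cmul.
have clfj : continuous (fun t => l * (fp t * j t)) by apply: cmul => //; exact: ccst.
have tau_ge0 := ltW tau0.
have cFj : continuous (fun t => `|F t| `^ p * j t).
  by apply: cmul => //; exact: continuous_normr_powR.
exists F, G; split => //.
- by move=> t h; rewrite F_right// G_right.
exists (integ (fun t => fp t * j t) 0 tau); split.
(* Up to [t0] the profile is at most 1, hence A(t) <= t <= t0. *)
- rewrite (integD_itv cfj (ltW t0_gt0) t0tau).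
  rewrite -[leLHS]addr0; apply: lerD; last first.
    by apply: integ_ge0 => t _; rewrite mulr_ge0// ltW.
  rewrite -integZ//; apply: integ_le => //.
    by apply: cmul => //; exact: ccst.
  move=> t /andP[h1 h2]; rewrite ler_wpM2r ?(ltW (j0 t))// ler_expR lerN2 ler_pM2l//.
  apply: (le_trans _ h2); rewrite -[A t]subr0 -A0 -[t in leRHS]subr0.
  have := @der_le_le _ A S (fun x => 0 + 1 * x) (fun=> 1) 0 t h1 cA.
  rewrite !add0r !mul1r subr0; apply.
  + exact: der_cont (fun y => der_affine y 1 0).
  + by [].
  + by move=> y _; exact: der_affine.
  + move=> y /andP[y0 yt]; have h : sc y <= 1.
      by apply: sc1; rewrite (ltW y0) (le_trans (ltW yt) h2).
    have -> : 1 = 1 `^ (q - 1) :> R by rewrite powR1.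
    by apply: ge0_ler_powR; rewrite ?nnegrE ?(ltW q10) ?ler01 ?ger0_norm.
- apply: (@le_trans _ _ (integ (fun t => `|sc t| `^ q * (fp t * j t)) 0 tau)).
    apply: integ_le => //; first by apply: cmul => //; exact: continuous_normr_powR.
    move=> t /andP[h1 h2]; rewrite mulrA ler_wpM2r ?(ltW (j0 t))//.
    have /andP[H0 H1] := H01 t; rewrite clK// in H1.
    rewrite /G normrM normrN (ger0_norm (S0 t)) (ger0_norm H0) powRM// /S -powRrM qp.
    rewrite ler_wpM2l ?powR_ge0// -fpE.
    by apply: ge0_ler_powR; rewrite ?nnegrE ?(ltW p0) ?(ltW (f0 t)).
  rewrite -subr_ge0 -integZ// -integB//.
  (* The Barta product for f: Y' <= (l - sc^q) f^p j with Y(0) = 0 and Y(tau) >= 0, so the energy of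
     f is at most l X. *)
  pose Y t := j t * sc t * fp t.
  have cY : continuous Y by apply: cmul => //; exact: cmul.
  have Y0 : Y 0 = 0 by rewrite /Y scneg// mulr0 mul0r.
  have Yt : 0 <= Y tau by rewrite /Y !mulr_ge0 ?(ltW (j0 _)) ?(ltW (fp0 _)).
  have /choice[ds hds] : forall t, exists d : R, 0 < t < tau ->
      der sc t d /\ d <= riccati_rhs p l (U t) (sc t).
    move=> t; have [h|h] := boolP (0 < t < tau); last by exists 0.
    by have [d h1 h2] := dsc t h; exists d.
  have cphi : continuous (fun t => l * (fp t * j t) - `|sc t| `^ q * (fp t * j t)) by exact: csub.
  apply: le_trans Yt _; have := @integ_der_le _ 0 tau tau_ge0 _ Y (fun t =>
    (j t * ds t + sc t * (- U t * j t)) * fp t + j t * sc t * (fp t * - (p * S t))) cphi cY.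
  rewrite Y0 subr0; apply.
  + move=> t ht; have [d1 _] := hds t ht; have [_ tr] := scin t ht.
    apply: der_eq (derM (derM (dj tr) d1) (der_expR (derN (derZ p (dA t))))) _.
    by rewrite /fp; ring.
  + move=> t ht; have [_ d1] := hds t ht.
    have e : sc t * S t = `|sc t| `^ q by rewrite SE ger0_norm.
    have jf0 : 0 <= j t * fp t by rewrite mulr_ge0 ?(ltW (j0 _)) ?(ltW (fp0 _)).
    have := ler_wpM2l jf0 d1; rewrite /riccati_rhs -SE => h.
    have -> : j t * sc t * (fp t * - (p * S t)) = - (j t * fp t) * (p * (sc t * S t)) by ring.
    by rewrite -e; move: (sc t * S t) h => Q h; lra.
- have WW : integ j 0 tau <= integ j 0 r2.
    rewrite (integD_itv cj tau_ge0 gb) lerDl; apply: integ_ge0 => t _; exact: ltW.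
  have fBle : fB <= expR ((ln level0 - ln b) / p).
    rewrite ler_expR lerNl; apply: le_trans AB.
    by rewrite -mulNr opprB.
  apply: (@le_trans _ _ (integ (fun t => fp t * j t) 0 tau - 2 * p * fB * integ j 0 tau)).
    rewrite lerB//; apply: ler_pM => //.
    + by rewrite !mulr_ge0 ?(ltW p0) ?(ltW fB0).
    + by apply: integ_ge0 => t _; exact: ltW.
    + by rewrite ler_pM2l// mulr_gt0.
  rewrite -integZ// -integB//; last by apply: cmul => //; exact: ccst.
  apply: integ_le => //.
    by apply: csub => //; apply: cmul => //; exact: ccst.
  move=> t /andP[h1 h2]; rewrite -mulrBl ler_wpM2r ?(ltW (j0 t))//.
  have lip := @normr_powR_lipschitz R p 1 (f t) (F t) p1.
  rewrite (ger0_norm (ltW (f0 t))) fpE powR1 mulr1 in lip.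
  rewrite lerBlDr -lerBlDl; apply: le_trans (lip (f1 t)) _.
  rewrite (mulrC 2) -mulrA ler_pM2l// FE// /F2.
  have fBf := ffB t h2.
  have k1 : fB ^+ 2 / f t <= fB by rewrite ler_pdivrMr// expr2 ler_pM2l.
  have k2 : 0 <= fB ^+ 2 / f t by rewrite divr_ge0 ?sqr_ge0// ltW.
  by rewrite ler_norml; apply/andP; split; lra.
Qed.

End curve.

(** The threshold [b0] must not depend on the curve, because the curves to which it is applied
    depend on b. This is possible since the lower bound for X in [curve_test] depends on neither. *)
Lemma half_test l' : l < l' -> 0 < r2 -> exists b0 : R, 0 < b0 /\
  forall b, b0 <= b -> forall g dg : R -> R, continuous g -> g 0 = 0 ->
  (forall s, 0 < s < b -> [/\ der g s (dg s), 0 < g s < r2,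
     0 < riccati_rhs p l (U (g s)) s & (riccati_rhs p l (U (g s)) s)^-1 <= dg s]) ->
  exists F G : R -> R, let tau := g b in
  [/\ [/\ 0 < tau, continuous G & forall t, der F t (G t)],
    (forall t, tau <= t -> F t = 0 /\ G t = 0), (forall t, 0 <= F t),
    (exists2 x, 0 < x < tau & 0 < F x) &
    forall b', tau <= b' ->
      integ (fun t => `|G t| `^ p * j t) 0 b' <=
      l' * integ (fun t => `|F t| `^ p * j t) 0 b'].
Proof.
move=> ll' r20.
pose t0 : R := (l + M + (p - 1))^-1.
have t00 : 0 < t0 by rewrite invr_gt0 addr_gt0 ?p10// addr_gt0.
have l'0 : 0 < l' by exact: lt_trans ll'.
have [W [W0 WE]] : exists W : R, 0 <= W /\ integ j 0 r2 = W.
  by exists (integ j 0 r2); split => //; apply: integ_ge0 => t _; exact: ltW.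
have [m [m0 mE]] : exists m : R, 0 < m /\ expR (- (p * t0)) * integ j 0 t0 = m.
  eexists; split; last reflexivity; rewrite mulr_gt0 ?expR_gt0//.
  have ht : 0 < t0 / 2 < t0.
    by rewrite divr_gt0//= gtr_pMr// invf_lt1// ltr1n.
  by apply: (integ_gt0 (ltW t00) cj _ ht) => // t _; exact: ltW.
have D0 : 0 < l' * (2 * p * W) + 1.
  by rewrite ltr_wpDl// !mulr_ge0 ?(ltW l'0) ?(ltW p0).
have [eta [eta0 eta1 etaE]] : exists eta : R, [/\ 0 < eta, eta <= 1 &
    eta * (l' * (2 * p * W) + 1) <= (l' - l) * m].
  exists (Num.min 1 ((l' - l) * m / (l' * (2 * p * W) + 1))); split.
  - by rewrite lt_min ltr01 divr_gt0// mulr_gt0// subr_gt0.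
  - by rewrite ge_min lexx.
  - by rewrite -ler_pdivlMr// ge_min lexx orbT.
(* Chosen so that (level0 / b)^(1/p) <= eta for all b >= b0. *)
pose b0 := level0 * expR (- (p * ln eta)).
have lb0 : level0 <= b0.
  rewrite -[level0]mulr1 ler_pM2l// -expR0 ler_expR oppr_ge0.
  by rewrite pmulr_rle0// ln_le0.
have b00 : 0 < b0 by exact: lt_le_trans lb0.
have lnb0 : ln b0 = ln level0 - p * ln eta.
  by rewrite lnM ?posrE ?expR_gt0// expRK.
exists b0; split => // b bb g dg cg g0 hg.
have bpos : 0 < b by exact: lt_le_trans bb.
have hin s : 0 < s < b -> 0 < g s < r2 by move=> /hg[].
have hd s : 0 < s < b -> der g s (dg s) by move=> /hg[].
have hr s : 0 < s < b -> 0 < riccati_rhs p l (U (g s)) s by move=> /hg[].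
have hge s : 0 < s < b -> (riccati_rhs p l (U (g s)) s)^-1 <= dg s by move=> /hg[].
have [F [G [[tau0 cG dF F0] FG0 Gneg F_ge0 [X [mX GX XF]]]]] :=
  curve_test (le_trans lb0 bb) cg g0 hin hd hr hge.
set tau := g b in tau0 FG0 GX XF *.
have cF := der_cont dF.
exists F, G; split => //.
  have [d d0 hd'] := near_gt (cF 0) F0.
  have d0' : 0 < d := d0.
  exists (Num.min (d / 2) (tau / 2)).
    rewrite lt_min !divr_gt0//= gt_min; apply/orP; right.
    by rewrite gtr_pMr// invf_lt1// ltr1n.
  apply: hd'; rewrite /= sub0r normrN ger0_norm; last by rewrite le_min !divr_ge0// ltW.
  by rewrite gt_min gtr_pMr// invf_lt1// ltr1n.
have eq0 (f : R -> R) b' : continuous f -> tau <= b' -> (forall t, tau <= t -> f t = 0) ->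
    integ (fun t => `|f t| `^ p * j t) 0 b' = integ (fun t => `|f t| `^ p * j t) 0 tau.
  move=> cf tb fz; rewrite (@integD_itv _ _ 0 tau b') ?(ltW tau0)//; last first.
    by apply: cmul => //; exact: continuous_normr_powR.
  rewrite (@integ_eq0 _ _ tau b')// ?addr0// => t /andP[h _].
  by rewrite fz// normr0 powR0 ?mul0r// gt_eqF.
move=> b' tb; rewrite (eq0 G)//; last by move=> t /FG0[].
rewrite (eq0 F)//; last by move=> t /FG0[].
apply: le_trans GX _; apply: (@le_trans _ _ (l' * (X - 2 * p * eta * W))); last first.
  rewrite ler_pM2l//; apply: le_trans XF; rewrite WE lerB// ler_wpM2r//.
  rewrite ler_pM2l ?mulr_gt0// -[leRHS]lnK ?posrE// ler_expR ler_pdivrMr//.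
  have : ln b0 <= ln b by rewrite ler_ln ?posrE.
  by rewrite lnb0; lra.
rewrite mE in mX.
have h1 : (l' - l) * m <= (l' - l) * X by rewrite ler_pM2l// subr_gt0.
have h2 : l' * (2 * p * eta * W) = eta * (l' * (2 * p * W)) by ring.
by rewrite mulrBr h2; move: (l' * (2 * p * W)) etaE => v etaE; lra.
Qed.

End half_interval_test_function.

(** * Gluing two one-sided test functions *)

Section slope_monotonicity.
Context {R : realType}.
Implicit Types (f g F G j : R -> R) (p l x t r : R).

Lemma integ_shift f a b r : a <= b -> continuous f ->
  integ (fun x => f (r + x)) a b = integ f (r + a) (r + b).
Proof.
move=> ab cf; have [F dF] := primitive cf; have cF := der_cont dF.
have rab : r + a <= r + b by rewrite lerD2l.
rewrite (integ_prim rab cf cF)//.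
have dG x : der (fun y => F (r + y)) x (f (r + x)) by exact: der_shift.
have cfr : continuous (fun x => f (r + x)).
  by apply: ccomp => //; apply: cadd; [exact: ccst|exact: cidf].
by rewrite (integ_prim ab cfr (der_cont dG)).
Qed.

(** Stated for arbitrary integrands, since moment, mass and energy are all split by it. *)
Lemma integ_glue j (phi phi2 phi3 : R -> R) r z c2 c3 : - r <= z -> z <= r ->
  continuous j -> continuous phi -> continuous phi2 -> continuous phi3 ->
  (forall x, z <= x -> phi x = c2 * phi2 (r - x)) ->
  (forall x, x <= z -> phi x = c3 * phi3 (r + x)) ->
  integ (fun x => phi x * j x) (- r) r =
    c3 * integ (fun t => phi3 t * j (t - r)) 0 (r + z) +
    c2 * integ (fun t => phi2 t * j (r - t)) 0 (r - z).
Proof.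
move=> rz zr cj cphi cphi2 cphi3 e2 e3.
have cjr : continuous (fun t => j (r - t)) by exact: continuous_reflect.
have cjl : continuous (fun t => j (t - r)).
  by apply: (@ccomp _ j) => //; apply: csub; [exact: cidf|exact: ccst].
have c2r : continuous (fun t => phi2 t * j (r - t)) by exact: cmul.
have c3l : continuous (fun t => phi3 t * j (t - r)) by exact: cmul.
rewrite (integD_itv (cmul cphi cj) rz zr); congr (_ + _).
  have := integ_shift r rz c3l; rewrite subrr => <-.
  rewrite -integZ//; last first.
    apply: (@ccomp _ (fun t => phi3 t * j (t - r)) (fun x => r + x)) => //.
    by apply: cadd; [exact: ccst|exact: cidf].
  by apply: eq_integ => x /andP[_ h]; rewrite e3// (addrC r) addrK mulrA.
have := integ_reflect r zr c2r; rewrite subrr => <-.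
rewrite -integZ//; last exact: (@continuous_reflect _ (fun t => phi2 t * j (r - t)) r c2r).
by apply: eq_integ => x /andP[h _]; rewrite e2// subKr mulrA.
Qed.

(** F2 and F3, measured from the right and the left end, vanish together with their derivatives
    before they meet. So a combination of them is C^1, and its moment, mass and energy are sums over
    the two sides of [z]. *)
Lemma Lambda_glue p j (xi : {measure set (measurableTypeR R) -> \bar R}) r l
    (F2 G2 F3 G3 P : R -> R) (tau2 tau3 : R) :
  1 < p -> continuous j -> (forall x, 0 < j x) -> 0 < r -> represents xi j (- r) r ->
  smooth_step P ->
  0 < tau2 -> 0 < tau3 -> tau2 + tau3 <= 2 * r ->
  continuous G2 -> (forall t, der F2 t (G2 t)) ->
  (forall t, tau2 <= t -> F2 t = 0 /\ G2 t = 0) -> (forall t, 0 <= F2 t) ->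
  (exists2 x, 0 < x < tau2 & 0 < F2 x) ->
  continuous G3 -> (forall t, der F3 t (G3 t)) ->
  (forall t, tau3 <= t -> F3 t = 0 /\ G3 t = 0) -> (forall t, 0 <= F3 t) ->
  (exists2 x, 0 < x < tau3 & 0 < F3 x) ->
  (forall b, tau2 <= b -> integ (fun t => `|G2 t| `^ p * j (r - t)) 0 b <=
    l * integ (fun t => `|F2 t| `^ p * j (r - t)) 0 b) ->
  (forall b, tau3 <= b -> integ (fun t => `|G3 t| `^ p * j (t - r)) 0 b <=
    l * integ (fun t => `|F3 t| `^ p * j (t - r)) 0 b) ->
  (Lambda_Poi p xi <= l%:E)%E.
Proof.
move=> p1 cj j0 r0 xij hP tau20 tau30 tau23 cG2 dF2 FG2 F2p F2x cG3 dF3 FG3 F3p F3x le2 le3.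
have p0 : 0 < p by rewrite (lt_trans _ p1).
have p10 : 0 < p - 1 by rewrite subr_gt0.
have cF2 := der_cont dF2; have cF3 := der_cont dF3.
(* The piece from the right end lives on [z, r], the one from the left end on [-r, z] because tau3
   <= r + z. *)
have [z z2] : exists z : R, r - z = tau2 by exists (r - tau2); rewrite subKr.
have [b3 b3z] : exists b : R, r + z = b by exists (r + z).
have b3E : tau3 <= b3 by move: tau23; rewrite -b3z -z2 => h; lra.
have rz : - r <= z by rewrite -subr_ge0 opprK addrC b3z (le_trans (ltW tau30)).
have zr : z <= r by rewrite -subr_ge0 z2 ltW.
have b30 : 0 < b3 by exact: lt_le_trans b3E.
have cjr : continuous (fun t => j (r - t)) by exact: continuous_reflect.
have cjl : continuous (fun t => j (t - r)).
  by apply: ccomp => //; apply: csub; [exact: cidf|exact: ccst].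
have csF f : continuous f -> continuous (fun t => signed_pow p (f t)).
  by move=> cf; exact: continuous_signed_pow.
have caF f : continuous f -> continuous (fun t => `|f t| `^ p).
  by move=> cf; exact: continuous_normr_powR.
have sp_gt0 x : 0 < x -> 0 < signed_pow p x.
  by move=> x0; rewrite ge0_signed_pow ?powR_gt0// ltW.
have [mr mrE mr0] : exists2 m : R, integ (fun t => signed_pow p (F2 t) * j (r - t)) 0 tau2 = m & 0 < m.
  eexists; first reflexivity; have [x hx Fx] := F2x.
  apply: (@integ_gt0 _ 0 tau2 (ltW tau20) _ x) => //; first by apply: cmul => //; exact: csF.
    by move=> t _; rewrite mulr_ge0 ?signed_pow_ge0 ?(ltW (j0 _)).
  by rewrite mulr_gt0 ?sp_gt0.
have [ml mlE ml0] : exists2 m : R, integ (fun t => signed_pow p (F3 t) * j (t - r)) 0 b3 = m & 0 < m.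
  eexists; first reflexivity; have [x /andP[x1 x2] Fx] := F3x.
  apply: (@integ_gt0 _ 0 b3 (ltW b30) _ x) => //; first by apply: cmul => //; exact: csF.
    by move=> t _; rewrite mulr_ge0 ?signed_pow_ge0 ?(ltW (j0 _)).
    by rewrite x1 (lt_le_trans x2).
  by rewrite mulr_gt0 ?sp_gt0.
have root m : 0 < m -> exists2 c : R, c `^ (p - 1) = m & 0 < c.
  move=> m0; exists (m `^ (p - 1)^-1); last by rewrite powR_gt0.
  by rewrite -powRrM mulVf ?gt_eqF// powRr1// ltW.
(* With these factors the two half moments cancel. *)
have [al alE al0] := root ml ml0; have [be beE be0] := root mr mr0.
pose H x := al * F2 (r - x) - be * F3 (r + x).
pose G x := - (al * G2 (r - x)) - be * G3 (r + x).
have cadd_r f : continuous f -> continuous (fun x => f (r + x)).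
  by move=> cf; apply: ccomp => //; apply: cadd; [exact: ccst|exact: cidf].
have dH x : der H x (G x).
  apply: derB; last by apply: derZ; exact: der_shift.
  by rewrite -mulrN; apply: derZ; exact: der_reflect.
have cH := der_cont dH.
have cG : continuous G.
  apply: csub; first by apply: copp; apply: cmul; [exact: ccst|exact: continuous_reflect].
  by apply: cmul; [exact: ccst|exact: cadd_r].
have Hright x : z <= x -> H x = al * F2 (r - x) /\ G x = - (al * G2 (r - x)).
  move=> h; have h3 : tau3 <= r + x by rewrite (le_trans b3E)// -b3z lerD2l.
  have [e1 e2] := FG3 _ h3; rewrite /H /G e1 e2 mulr0 !subr0.
  by split; reflexivity.
have Hleft x : x <= z -> H x = - (be * F3 (r + x)) /\ G x = - (be * G3 (r + x)).
  move=> h; have h2 : tau2 <= r - x by rewrite -z2 lerD2l lerN2.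
  have [e1 e2] := FG2 _ h2; rewrite /H /G e1 e2 mulr0 oppr0 !add0r.
  by split; reflexivity.
have cmj f : continuous f -> continuous (fun x => `|f x| `^ p * j x).
  by move=> cf; apply: cmul => //; exact: caF.
have pow_mul c x : 0 < c -> `|- (c * x)| `^ p = c `^ p * `|x| `^ p.
  by move=> cc; rewrite normrN normrM (gtr0_norm cc) powRM// ltW.
have glue := @integ_glue j _ _ _ r z _ _ rz zr cj; rewrite b3z z2 in glue.
have momH : moment p j (- r) r H = 0.
  rewrite /moment (glue _ _ _ (al `^ (p - 1)) (- be `^ (p - 1)) (csF _ cH) (csF _ cF2) (csF _ cF3)).
  - by rewrite mrE mlE alE beE mulNr mulrC addNr.
  - by move=> x h; rewrite (Hright x h).1; exact: signed_powM (ltW al0).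
  - move=> x h; rewrite (Hleft x h).1 signed_powN mulNr; congr (- _).
    exact: signed_powM (ltW be0).
have mH : mass p j (- r) r H = be `^ p * integ (fun t => `|F3 t| `^ p * j (t - r)) 0 b3
      + al `^ p * integ (fun t => `|F2 t| `^ p * j (r - t)) 0 tau2.
  apply: (glue _ _ _ _ _ (caF _ cH) (caF _ cF2) (caF _ cF3)) => x h.
    by rewrite (Hright x h).1 -normrN; exact: pow_mul.
  by rewrite (Hleft x h).1; exact: pow_mul.
have mG : mass p j (- r) r G = be `^ p * integ (fun t => `|G3 t| `^ p * j (t - r)) 0 b3
      + al `^ p * integ (fun t => `|G2 t| `^ p * j (r - t)) 0 tau2.
  apply: (glue _ _ _ _ _ (caF _ cG) (caF _ cG2) (caF _ cG3)) => x h.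
    by rewrite (Hright x h).2; exact: pow_mul.
  by rewrite (Hleft x h).2; exact: pow_mul.
have rr : - r < r by rewrite gtrN.
have mH0 : 0 < mass p j (- r) r H.
  rewrite mH; apply: ltr_wpDl.
    rewrite mulr_ge0 ?powR_ge0//; apply: integ_ge0 => t _.
    by rewrite mulr_ge0 ?powR_ge0// ltW.
  rewrite mulr_gt0 ?powR_gt0//; have [x hx Fx] := F2x.
  apply: (@integ_gt0 _ 0 tau2 (ltW tau20) _ x) => //; first by apply: cmul => //; exact: caF.
    by move=> t _; rewrite mulr_ge0 ?powR_ge0// ltW.
  by rewrite mulr_gt0// powR_gt0// gtr0_norm.
have leGH : mass p j (- r) r G <= l * mass p j (- r) r H.
  rewrite mH mG mulrDr; apply: lerD.
    by rewrite mulrCA ler_pM2l ?powR_gt0//; exact: le3.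
  by rewrite mulrCA ler_pM2l ?powR_gt0//; exact: le2.
have [B B0 hB] := bounded_on (- r) r cH.
apply: (Lambda_upper p1 cj j0 rr xij hP cG dH B0 hB mH0 leGH) => k _.
exact: der_mass_cst.
Qed.

End slope_monotonicity.

(** * Linear arithmetic for the splitting point *)

Section real_arithmetic.
Context {R : realFieldType}.
Implicit Types (r t z a b : R).

Lemma exists_split r a b : 0 < r -> 0 < a -> 0 < b -> 2 * r < a + b ->
  exists z, [/\ - r <= z <= r, r - z <= a & r + z <= b].
Proof.
move=> r0 a0 b0 big; have [h|/ltW h] := leP a (2 * r).
  by exists (r - a); split; [apply/andP; split|..]; lra.
by exists (- r); split; [apply/andP; split|..]; lra.
Qed.

Lemma lt_double r z t : - r <= z <= r -> (t < r - z \/ t < r + z) -> t < 2 * r.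
Proof. by move=> /andP[zl zr] [tz|tz]; lra. Qed.

Lemma le_of_addr_le a b r : 0 < a -> 0 < b -> a + b <= r -> a <= r /\ b <= r.
Proof. by move=> a0 b0 ab; split; lra. Qed.

End real_arithmetic.

(** * Comparison of the constants for two slopes *)

Section oscillator_weights.
Context {R : realType}.
Variables (K e : R) (c s : R -> R).
Hypotheses (dc : forall x, der c x (- (K * e) * s x)) (ds : forall x, der s x (c x)).
Hypotheses (c0 : c 0 = 1) (s0 : s 0 = 0) (e0 : 0 <= e).
Implicit Types (x t h l r p : R) (j : R -> R).

Local Notation y := (osc_y e c s).
Local Notation T := (osc_T K e c s).

(** Through this reflection the left end of the interval is treated as the right end for the slope
    -h. *)
Lemma osc_y_opp h x : y (- h) (- x) = y h x.
Proof. by rewrite /osc_y (osc_even dc ds c0 s0) (osc_odd dc ds c0 s0); ring. Qed.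

Lemma osc_T_opp h x : T (- h) (- x) = - T h x.
Proof.
rewrite /osc_T osc_y_opp -mulNr; congr (_ / _).
by rewrite /osc_d (osc_even dc ds c0 s0) (osc_odd dc ds c0 s0); ring.
Qed.

(** The logarithmic derivative seen from the right end, frozen so as to be continuous on the whole
    line. *)
Definition osc_U h r t := T h (clamp r (r - t)).

Lemma osc_UE h r t : 0 <= t <= 2 * r -> osc_U h r t = T h (r - t).
Proof. by move=> /andP[t0 tr]; rewrite /osc_U clampK//; apply/andP; split; lra. Qed.

Lemma osc_U_continuous h r : 0 < r -> (forall x, - r <= x <= r -> 0 < y h x) ->
  continuous (osc_U h r).
Proof.
move=> r0 hy; apply: (@continuous_reflect _ (fun x => T h (clamp r x))).
apply: clamp_ext; first exact: ltW.
move=> x hx; apply: der_continuous (der_osc_T dc ds c0 s0 _).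
by rewrite gt_eqF// hy.
Qed.

Lemma der_osc_U h r t : (forall x, - r <= x <= r -> 0 < y h x) -> 0 < t < 2 * r ->
  der (osc_U h r) t ((K + e * h ^+ 2) * (y h (r - t)) ^- 2).
Proof.
move=> hy ht; have [t0 tr] := andP ht.
have y0 : y h (r - t) != 0 by rewrite gt_eqF// hy//; apply/andP; split; lra.
have d1 := der_reflect (der_osc_T dc ds c0 s0 y0).
rewrite mulNr opprK in d1; apply: der_near d1; apply: filterS (near_oo ht) => x /andP[x1 x2].
by rewrite osc_UE// !ltW.
Qed.

(** One number [tau] records both outcomes: the time at which the level b is reached, or a value
    beyond 2 r if it is never reached, in which case the last clause is void. *)
Lemma osc_riccati p l r b h : 1 < p -> 0 < l -> 0 < r -> 0 < b ->
  (forall x, - r <= x <= r -> 0 < y h x) ->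
  exists (f : R -> R) (tau : R), [/\ continuous f /\ f 0 = 0,
    0 < tau,
    forall t, 0 < t < tau -> t < 2 * r -> 0 <= f t /\ der f t (riccati_rhs p l (T h (r - t)) (f t)) &
    tau <= 2 * r -> exists g : R -> R, [/\ continuous g, g 0 = 0, g b = tau &
      forall sg, 0 < sg < b -> [/\ 0 < g sg < tau, 0 < riccati_rhs p l (T h (r - g sg)) sg &
        der g sg (riccati_rhs p l (T h (r - g sg)) sg)^-1]]].
Proof.
move=> p1 l0 r0 b0 hy; have r20 : 0 < 2 * r by rewrite mulr_gt0.
have cU := osc_U_continuous r0 hy.
have [f [cf f0 fp df]] := riccati_truncated p1 l0 b0 r20 cU.
have [hit|nohit] := pselect (exists2 t, 0 <= t <= 2 * r & b <= f t); last first.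
  exists f, (2 * r + 1); split => //.
  - by rewrite addr_gt0.
  - move=> t /andP[t0 _] tr; split; first by apply/ltW/fp; rewrite t0 ltW.
    have ht : 0 <= t <= 2 * r by rewrite !ltW.
    rewrite -(osc_UE _ ht); apply: df => //; rewrite leNgt; apply/negP => bt.
    by apply: nohit; exists t => //; exact: ltW.
  - by rewrite gerDl leNgt ltr01.
have f0b : f 0 < b by rewrite f0.
have [tau [/andP[tau0 taur] ftau fb]] := first_hit cf f0b hit.
have fin t : 0 < t < tau -> 0 < f t < b.
  move=> /andP[t0 tt]; rewrite fp ?t0 ?(ltW (lt_le_trans tt taur))//= fb//.
  by rewrite (ltW t0).
have tin t : 0 < t < tau -> 0 <= t <= 2 * r.
  by move=> /andP[t0 tt]; rewrite (ltW t0) (ltW (lt_le_trans tt taur)).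
have dft t : 0 < t < tau -> der f t (riccati_rhs p l (osc_U h r t) (f t)).
  by move=> ht; apply: df; [exact: tin|have /andP[_ /ltW] := fin t ht].
exists f, tau; split => //.
  move=> t ht _; split; first by have /andP[/ltW] := fin t ht.
  by rewrite -(osc_UE _ (tin t ht)); exact: dft.
move=> _.
have dU t : 0 < t < tau -> der (osc_U h r) t ((K + e * h ^+ 2) * (y h (r - t)) ^- 2).
  by move=> /andP[t0 tt]; apply: der_osc_U => //; rewrite t0 (lt_le_trans tt taur).
have sgn : (forall t, 0 < t < tau -> 0 <= (K + e * h ^+ 2) * (y h (r - t)) ^- 2) \/
    (forall t, 0 < t < tau -> (K + e * h ^+ 2) * (y h (r - t)) ^- 2 <= 0).
  have i0 t : 0 <= (y h (r - t)) ^- 2 by rewrite invr_ge0 sqr_ge0.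
  have [k0|/ltW k0] := leP 0 (K + e * h ^+ 2); [left|right] => t _.
    by rewrite mulr_ge0.
  by rewrite mulr_le0_ge0.
have [g [cg g0 gb hg]] := riccati_curve p1 l0 b0 tau0 cU dU sgn cf f0 fin ftau dft.
exists g; split => // sg hsg; have [g1 g2 g3] := hg sg hsg.
by rewrite -(osc_UE _ (tin _ g1)).
Qed.

Lemma osc_half_test p l l' r h j : 1 < p -> 0 < l -> l < l' -> 0 < r ->
  (forall x, - r <= x <= r -> 0 < y h x) -> continuous j -> (forall x, 0 < j x) ->
  (forall x, - r < x < r -> der j x (T h x * j x)) ->
  exists b0 : R, 0 < b0 /\
  forall b, b0 <= b -> forall g dg : R -> R, continuous g -> g 0 = 0 ->
  (forall sg, 0 < sg < b -> [/\ der g sg (dg sg), 0 < g sg < 2 * r,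
     0 < riccati_rhs p l (T h (r - g sg)) sg &
     (riccati_rhs p l (T h (r - g sg)) sg)^-1 <= dg sg]) ->
  exists F G : R -> R, let tau := g b in
  [/\ [/\ 0 < tau, continuous G & forall t, der F t (G t)],
    (forall t, tau <= t -> F t = 0 /\ G t = 0), (forall t, 0 <= F t),
    (exists2 x, 0 < x < tau & 0 < F x) &
    forall b', tau <= b' ->
      integ (fun t => `|G t| `^ p * j (r - t)) 0 b' <=
      l' * integ (fun t => `|F t| `^ p * j (r - t)) 0 b'].
Proof.
move=> p1 l0 ll r0 hy cj j0 dj.
have [M M0 hM] := bounded_on 0 (2 * r) (osc_U_continuous r0 hy).
apply: (@half_test R p l M (2 * r) (fun t => j (r - t)) (fun t => T h (r - t))) => //.
- exact: continuous_reflect.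
- move=> t /andP[t0 tr]; have hx : - r < r - t < r by apply/andP; split; lra.
  by apply: der_eq (der_reflect (dj _ hx)) _; rewrite mulNr.
- by move=> t /andP[t0 tr]; rewrite -osc_UE ?hM// !ltW.
- by rewrite mulr_gt0.
Qed.

Lemma Lambda_slope_monotone p r k h1 h2 (j1 j2 : R -> R)
    (xi1 xi2 : {measure set (measurableTypeR R) -> \bar R}) :
  1 < p -> 0 < r -> h1 = k * h2 -> k ^+ 2 <= 1 ->
  (forall x, - r <= x <= r -> 0 < y h1 x) -> (forall x, - r <= x <= r -> 0 < y h2 x) ->
  continuous j1 -> (forall x, 0 < j1 x) -> represents xi1 j1 (- r) r ->
  (forall x, - r < x < r -> der j1 x (T h1 x * j1 x)) ->
  continuous j2 -> (forall x, 0 < j2 x) -> represents xi2 j2 (- r) r ->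
  (forall x, - r < x < r -> der j2 x (T h2 x * j2 x)) ->
  (Lambda_Poi p xi1 <= Lambda_Poi p xi2)%E.
Proof.
move=> p1 r0 h12 k1 hy1 hy2 cj1 j10 x1 dj1 cj2 j20 x2 dj2.
rewrite leNgt; apply/negP => lt.
have [f [l0 [cf nf _ mf [ml l0L l0_ge]]]] := Lambda_witness p1 j20 x2 lt.
have l00 : 0 <= l0.
  have := le_trans (@mass_ge0 _ p j2 (- r) r j20 (derive1 f)) ml.
  by rewrite pmulr_lge0.
(* [l] exceeds the constant for [h2], so Barta's inequality cannot apply to it; the gap up to [l']
   pays for the losses of the test functions, and [l'] is still below the constant for [h1]. *)
have [l ll0 lL] := ereal_between l0L.
have [l' ll' l'L] := ereal_between lL.
have lp : 0 < l by exact: le_lt_trans ll0.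
have [P hP] := exists_smooth_step cf nf.
have oppy h : (forall x, - r <= x <= r -> 0 < y h x) ->
    forall x, - r <= x <= r -> 0 < y (- h) x.
  move=> hy x /andP[xa xb]; rewrite -[x]opprK osc_y_opp hy//.
  by rewrite lerN2 xb lerNl.
have cj1' : continuous (fun x => j1 (0 - x)) by exact: continuous_reflect.
have dj1' x : - r < x < r -> der (fun x => j1 (0 - x)) x (T (- h1) x * j1 (0 - x)).
  move=> /andP[xa xb]; have hx : - r < 0 - x < r by rewrite sub0r ltrN2 xb ltrNl.
  apply: der_eq (der_reflect (dj1 _ hx)) _.
  by rewrite -mulNr -osc_T_opp sub0r opprK.
have [b2 [b20 test2]] := osc_half_test p1 lp ll' r0 hy1 cj1 j10 dj1.
have [b3 [b30 test3]] := osc_half_test p1 lp ll' r0 (oppy _ hy1) cj1' (fun x => j10 _) dj1'.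
(* The two sides must be stopped at the same level, since [interpolate] pairs points of equal
   level. *)
have [b [b2b b3b]] : exists b : R, b2 <= b /\ b3 <= b.
  by exists (Num.max b2 b3); split; rewrite le_max lexx ?orbT.
have b0 : 0 < b by exact: lt_le_trans b2b.
have [s1 [tau1 [[cs1 s10] tau10 ds1 curve1]]] := osc_riccati p1 lp r0 b0 hy2.
have [s4 [tau4 [[cs4 s40] tau40 ds4 curve4]]] := osc_riccati p1 lp r0 b0 (oppy _ hy2).
have T2N x : T (- h2) x = - T h2 (- x) by rewrite -{1}[x]opprK osc_T_opp.
have T1N x : T (- h1) x = - T h1 (- x) by rewrite -{1}[x]opprK osc_T_opp.
(* If the two solutions jointly covered the interval before reaching the level
   [b], Barta's inequality would apply to the second weight. *)
have sum : tau1 + tau4 <= 2 * r.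
  rewrite leNgt; apply/negP => big.
  have [z [zr z1 z4]] := exists_split r0 tau10 tau40 big.
  have : (l%:E <= Lambda_Poi p xi2)%E.
    apply: (@Lambda_barta _ p l j2 (T h2) s1 s4 xi2 r z) => //.
    - exact: ltW.
    - move=> t /andP[t0 tz]; apply: (ds1 t _ _).1; first by rewrite t0 (lt_le_trans tz z1).
      by apply: (lt_double zr); left.
    - move=> t /andP[t0 tz]; apply: (ds1 t _ _).2; first by rewrite t0 (lt_le_trans tz z1).
      by apply: (lt_double zr); left.
    - move=> t /andP[t0 tz]; apply: (ds4 t _ _).1; first by rewrite t0 (lt_le_trans tz z4).
      by apply: (lt_double zr); right.
    - move=> t /andP[t0 tz]; have tt : 0 < t < tau4 by rewrite t0 (lt_le_trans tz z4).
      have tr : t < 2 * r by apply: (lt_double zr); right.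
      by apply: der_eq (ds4 t tt tr).2 _; rewrite T2N opprB.
  by move=> /le_trans/(_ l0_ge); rewrite lee_fin leNgt ll0.
have [tau1r tau4r] := le_of_addr_le tau10 tau40 sum.
have [t1 [ct1 t10 t1b ht1]] := curve1 tau1r.
have [t4 [ct4 t40 t4b ht4]] := curve4 tau4r.
have ineqs sg : 0 < sg < b -> [/\ 0 < t1 sg, 0 < t4 sg & t1 sg + t4 sg <= 2 * r].
  move=> hsg; have [/andP[a1 a2] _ _] := ht1 sg hsg; have [/andP[a3 a4] _ _] := ht4 sg hsg.
  by split => //; apply: le_trans sum; rewrite lerD ?ltW.
have dt1 sg : 0 < sg < b -> 0 < riccati_rhs p l (T h2 (r - t1 sg)) sg /\
    der t1 sg (riccati_rhs p l (T h2 (r - t1 sg)) sg)^-1.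
  by move=> /ht1[].
have dt4 sg : 0 < sg < b -> 0 < riccati_rhs p l (- T h2 (t4 sg - r)) sg /\
    der t4 sg (riccati_rhs p l (- T h2 (t4 sg - r)) sg)^-1.
  by move=> /ht4[]; rewrite T2N opprB.
have [t2 [t3 [d2 [d3 [[ct2 ct3 t20 t30] t23 ht2 ht3]]]]] :=
  interpolate dc ds c0 s0 e0 p1 lp r0 h12 k1 hy1 hy2 ct1 ct4 t10 t40 ineqs dt1 dt4.
have [F2 [G2 [[tau20 cG2 dF2] FG2 F2p F2x le2]]] := test2 b b2b t2 d2 ct2 t20 ht2.
have ht3' sg : 0 < sg < b -> [/\ der t3 sg (d3 sg), 0 < t3 sg < 2 * r,
    0 < riccati_rhs p l (T (- h1) (r - t3 sg)) sg &
    (riccati_rhs p l (T (- h1) (r - t3 sg)) sg)^-1 <= d3 sg].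
  by move=> /ht3; rewrite T1N opprB.
have [F3 [G3 [[tau30 cG3 dF3] FG3 F3p F3x le3]]] := test3 b b3b t3 d3 ct3 t30 ht3'.
have t23r : t2 b + t3 b <= 2 * r by rewrite t23 t1b t4b.
have refl t : 0 - (r - t) = t - r by ring.
have : (Lambda_Poi p xi1 <= l'%:E)%E.
  apply: (Lambda_glue p1 cj1 j10 r0 x1 hP tau20 tau30 t23r cG2 dF2 FG2 F2p F2x
    cG3 dF3 FG3 F3p F3x le2) => b' hb'.
  have := le3 b' hb'.
  rewrite (@eq_integ _ 0 b' _ (fun t => `|G3 t| `^ p * j1 (t - r))); last by move=> t _; rewrite refl.
  by rewrite (@eq_integ _ 0 b' (fun t => `|F3 t| `^ p * j1 (0 - (r - t))) (fun t => `|F3 t| `^ p * j1 (t - r)))//; move=> t _; rewrite refl.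
by rewrite leNgt l'L.
Qed.

End oscillator_weights.

(** * The two monotonicity statements *)

Unset Implicit Arguments.

Theorem theorem6p2p3 (R : realType) (p K : R) (N D : \bar R)
    (hp : 1 < p)
    (hN : ((-oo < N)%E /\ (N <= 0)%E) \/ (1 < N)%E)
    (hD : (0 < D)%E)
    (hTA : TA p) :
  (forall h0 d1 d2 : R, Dreg K N D h0 d1 -> Dreg K N D h0 d2 ->
     d1 <= d2 -> (lambda1 p K N h0 d2 <= lambda1 p K N h0 d1)%E) /\
  ((1 < N)%E ->
   forall d0 h1 h2 : R, Dreg K N D h1 d0 -> Dreg K N D h2 d0 ->
     `|h1| <= `|h2| -> (lambda1 p K N h1 d0 <= lambda1 p K N h2 d0)%E).
Proof.
have Nn : N != -oo%E.
  by case: hN => [[h _]|h]; apply/eqP => N0; move: h; rewrite N0.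
split=> [h0 d1 d2 D1 D2 d12|N1 d0 h1 h2 D1 D2 h12].
  (* Both measures are represented with the weight frozen outside the larger interval. *)
  have half : d1 / 2 <= d2 / 2 by rewrite ler_pM2r// invr_gt0.
  exact: (Lambda_domain_monotone hp (weight_continuous Nn D2)
    (fun x => weight_gt0 x Nn D2) (Dreg_half D1) half
    (weight_represents Nn D2 d12) (weight_represents Nn D2 (lexx d2))).
have [e [c [s [e0 dc ds [c0 s0] sys]]]] := model_system K N1.
(* The factor k is h1 / h2; for h2 = 0 both slopes are 0. *)
have [h20|h20] := eqVneq h2 0.
  by move: h12; rewrite h20 normr0 normr_le0 => /eqP ->.
have k1 : (h1 / h2) ^+ 2 <= 1.
  rewrite -real_normK ?num_real// normrM normfV expr_le1//.
  by rewrite ler_pdivrMr ?mul1r// normr_gt0.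
have y0 h : Dreg K N D h d0 -> forall x, - (d0 / 2) <= x <= d0 / 2 -> 0 < osc_y e c s h x.
  by move=> hh x hx; have [] := sys D h d0 hh x hx.
have dj h : Dreg K N D h d0 -> forall x, - (d0 / 2) < x < d0 / 2 ->
    der (weight K N h d0) x (osc_T K e c s h x * weight K N h d0 x).
  move=> hh x hx; have hx' : - (d0 / 2) <= x <= d0 / 2 by case/andP: hx => *; rewrite !ltW.
  have [_ d] := sys D h d0 hh x hx'.
  rewrite /weight clampK//; apply: der_near d.
  apply: filterS (near_oo hx) => z /andP[z1 z2].
  by rewrite clampK// !ltW.
apply: (Lambda_slope_monotone dc ds c0 s0 e0 hp (Dreg_half D1) _ k1 (y0 _ D1) (y0 _ D2)
  (weight_continuous Nn D1) (fun x => weight_gt0 x Nn D1) (weight_represents Nn D1 (lexx d0)) (dj _ D1)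
  (weight_continuous Nn D2) (fun x => weight_gt0 x Nn D2) (weight_represents Nn D2 (lexx d0)) (dj _ D2)).
by rewrite divfK.
Qed.
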